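(* Let $n\ge 1$ and let $\xi_0,\dots,\xi_n$ be independent real-valued random variables with probability density functions $f_0,\dots,f_n$ (with respect to Lebesgue measure on $\mathbb{R}$). Let $G(z)=\xi_0+\xi_1z+\dots+\xi_nz^n$, $z\in\mathbb{C}$, and let $\mu=\sum_{z:G(z)=0}\delta_z$ be the counting measure of the zeros of $G$. Let $k,l\ge 0$ be integers with $1\le k+2l\le n$. Then the mixed $(k,l)$-correlation function $\rho_{k,l}$ of the zeros of $G$ is given, for $(\mathbf{x},\mathbf{z})=(x_1,\dots,x_k,z_1,\dots,z_l)\in\mathbb{R}^k\times\mathbb{C}_+^l$, by $$\rho_{k,l}(\mathbf{x},\mathbf{z})=2^l\,\rho_{k+2l}(x_1,\dots,x_k,z_1,\dots,z_l,\bar z_1,\dots,\bar z_l),$$ where $\rho_{k+2l}$ is the explicit function defined in the context. That is, for every family of mutually disjoint Borel sets $B_1,\dots,B_k\subset\mathbb{R}$ and $B_{k+1},\dots,B_{k+l}\subset\mathbb{C}_+$, $$\mathbb{E}\Big[\prod_{i=1}^{k+l}\mu(B_i)\Big]=\int_{B_1}\cdots\int_{B_{k+l}}2^l\,\rho_{k+2l}(\mathbf{x},\mathbf{z},\bar{\mathbf{z}})\,d\mathbf{x}\,d\mathbf{z}.$$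
   Context: $\mathbb{C}_+=\{z\in\mathbb{C}:\operatorname{Im}z>0\}$; $d\mathbf{x}$ is Lebesgue measure on $\mathbb{R}^k$ and $d\mathbf{z}$ is Lebesgue measure on $\mathbb{C}_+^l\subset\mathbb{R}^{2l}$. With probability one $G$ has degree $n$ and all its zeros are simple. Mixed correlation functions: for $k+2l\le n$, a function $\rho_{k,l}:\mathbb{R}^k\times\mathbb{C}_+^l\to\mathbb{R}_+$ is called the mixed $(k,l)$-correlation function of the zeros of $G$ if for any mutually disjoint Borel sets $B_1,\dots,B_k\subset\mathbb{R}$ and $B_{k+1},\dots,B_{k+l}\subset\mathbb{C}_+$, $$\mathbb{E}\Big[\prod_{i=1}^{k+l}\mu(B_i)\Big]=\int_{B_1}\cdots\int_{B_{k+l}}\rho_{k,l}(\mathbf{x},\mathbf{z})\,d\mathbf{x}\,d\mathbf{z}.$$ As a density, it is specified by this property only up to Lebesgue-null sets. Elementary symmetric polynomials: $\sigma_0(w_1,\dots,w_m)=1$; $\sigma_i(w_1,\dots,w_m)=\sum_{1\le j_1<\dots<j_i\le m}w_{j_1}\cdots w_{j_i}$ for $1\le i\le m$; $\sigma_i=0$ for every other integer $i$ (i.e. $i<0$ or $i>m$). The function $\rho_m$: for $1\le m\le n$ and $(w_1,\dots,w_m)\in\mathbb{C}^m$ such that all $\sigma_i(w_1,\dots,w_m)$ are real, $$\rho_m(w_1,\dots,w_m)=\prod_{1\le i<j\le m}|w_i-w_j|\int_{\mathbb{R}^{n-m+1}}\prod_{i=0}^{n}f_i\Big(\sum_{j=0}^{n-m}(-1)^{m-i+j}\sigma_{m-i+j}(w_1,\dots,w_m)\,t_j\Big)\prod_{i=1}^m\Big|\sum_{j=0}^{n-m}t_jw_i^j\Big|\,dt_0\cdots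 dt_{n-m}.$$ The integrand is nonnegative and the integral is the Lebesgue integral, understood as an element of $[0,\infty]$. *)

(* Defs.v *)
From HB Require Import structures.
From mathcomp Require Import all_boot all_order all_algebra.
From mathcomp Require Import perm complex.
From mathcomp Require Import all_classical all_reals all_analysis.
From mathcomp Require Import measurable_realfun.

Set Implicit Arguments.
Unset Strict Implicit.
Unset Printing Implicit Defensive.

Import Order.TTheory GRing.Theory Num.Theory.
Import numFieldNormedType.Exports.
Import ComplexField.Normc.

Local Open Scope classical_set_scope.
Local Open Scope ring_scope.
Local Open Scope complex_scope.

Section pushforward_sigma_finite.
Local Open Scope ereal_scope.
Context d1 d2 (T1 : measurableType d1) (T2 : measurableType d2) (R : realType).
Variables (m : {measure set T1 -> \bar R}) (f : T1 -> T2) (g : T2 -> T1).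
Hypotheses (mf : measurable_fun setT f) (mg : measurable_fun setT g).
Hypotheses (fK : cancel f g) (m_sf : sigma_finite setT m).

Let mpre A : measurable A -> measurable (f @^-1` A).
Proof. by move=> mA; rewrite -[X in measurable X]setTI; exact: mf. Qed.

Lemma pushforward_sigma_finite_ex :
  exists m' : {sigma_finite_measure set T2 -> \bar R},
    m' = pushforward m f :> (set T2 -> \bar R).
Proof.
pose q A := m (f @^-1` A).
have q0 : q set0 = 0 by rewrite /q preimage_set0 measure0.
have q_ge0 A : 0 <= q A by exact: measure_ge0.
have q_add : semi_sigma_additive q.
  move=> F mF tF mUF; rewrite /q preimage_bigcup.
  apply: measure_semi_sigma_additive.
  - by move=> n; exact: mpre.
  - apply/trivIsetP => /= i j _ _ ij; rewrite -preimage_setI.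
    by move/trivIsetP : tF => /(_ _ _ _ _ ij) ->//; rewrite preimage_set0.
  - by rewrite -preimage_bigcup; exact: mpre.
pose qM := isMeasure.Build _ _ _ q q0 q_ge0 q_add.
pose m1 : {measure set T2 -> \bar R} := HB.pack q qM.
have q_sf : sigma_finite setT m1.
  have [F FT Foo] := m_sf.
  exists (fun n => g @^-1` F n).
    by rewrite -preimage_bigcup -FT preimage_setT.
  move=> n; have [mFn Fnoo] := Foo n; split.
    by rewrite -[X in measurable X]setTI; exact: mg.
  by rewrite /= /q -comp_preimage (_ : g \o f = id)//; apply/funext.
pose m1_sf := Measure_isSigmaFinite.Build _ _ _ m1 q_sf.
pose m2 := HB.pack_for {sigma_finite_measure set T2 -> \bar R}
  (Measure.sort m1) m1_sf.
by exists m2.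
Qed.

End pushforward_sigma_finite.

Lemma product_sigma_finite d1 d2 (T1 : measurableType d1)
    (T2 : measurableType d2) (R : realType)
    (m1 : {sigma_finite_measure set T1 -> \bar R})
    (m2 : {sigma_finite_measure set T2 -> \bar R}) :
  sigma_finite setT (m1 \x m2)%E.
Proof.
have /sigma_finiteP[F [TF ndF Foo]] := sigma_finiteT m1.
have /sigma_finiteP[G [TG ndG Goo]] := sigma_finiteT m2.
exists (fun n => F n `*` G n).
  rewrite -setXTT TF TG predeqE => -[x y]; split.
    move=> [/= [n _ Fnx] [k _ Gky]]; exists (maxn n k) => //; split.
    - by move: x Fnx; exact/subsetPset/ndF/leq_maxl.
    - by move: y Gky; exact/subsetPset/ndG/leq_maxr.
  by move=> [n _ []/= ? ?]; split; exists n.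
move=> k; have [? ?] := Foo k; have [? ?] := Goo k.
split; first exact: measurableX.
by rewrite product_measure1E// lte_mul_pinfty// ge0_fin_numE.
Qed.

Section power_measure.
Context d (T : measurableType d) (R : realType).
Local Open Scope ereal_scope.

(* The n-fold product mu \x ... \x mu, carried by n.-tuple T. *)
Fixpoint power_measure (mu : set T -> \bar R) (n : nat) :
    set (n.-tuple T) -> \bar R :=
  match n with
  | 0 => dirac [tuple]
  | n'.+1 => pushforward (mu \x @power_measure mu n')
               (fun p : T * n'.-tuple T => [tuple of p.1 :: p.2])
  end.
Arguments power_measure : clear implicits.

Variable mu : {sigma_finite_measure set T -> \bar R}.

Lemma power_measure_ex n :
  exists m : {sigma_finite_measure set (n.-tuple T) -> \bar R},
    m = power_measure mu n :> (set _ -> _).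
Proof.
elim: n => [|n [m mE]] /=; first by exists (dirac [tuple]).
rewrite -mE.
have mc : measurable_fun setT
  (fun p : T * n.-tuple T => [tuple of p.1 :: p.2]) by exact: measurable_cons.
have mu' : measurable_fun setT
    (fun t : n.+1.-tuple T => (thead t, [tuple of behead t])).
  apply/measurable_fun_pairP; split; first exact: measurable_tnth.
  exact: measurable_behead.
have [||m' m'E] := pushforward_sigma_finite_ex (m := (mu \x m)) mc mu'.
- by move=> [x t]; rewrite theadE; congr (_, _); apply/val_inj.
- exact: product_sigma_finite.
exists m'.
exact: m'E.
Qed.

Let power_measure0 n : power_measure mu n set0 = 0.
Proof. by have [m <-] := power_measure_ex n; exact: measure0. Qed.

Let power_measure_ge0 n A : 0 <= power_measure mu n A.
Proof. by have [m <-] := power_measure_ex n; exact: measure_ge0. Qed.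

Let power_measure_sigma_additive n : semi_sigma_additive (power_measure mu n).
Proof.
by have [m <-] := power_measure_ex n; exact: measure_semi_sigma_additive.
Qed.

HB.instance Definition _ n := isMeasure.Build _ _ _ (power_measure mu n)
  (power_measure0 n) (@power_measure_ge0 n) (@power_measure_sigma_additive n).

Let power_measure_sigma_finite n : sigma_finite setT (power_measure mu n).
Proof. by have [m <-] := power_measure_ex n; exact: sigma_finiteT. Qed.

HB.instance Definition _ n := Measure_isSigmaFinite.Build _ _ _
  (power_measure mu n) (@power_measure_sigma_finite n).

End power_measure.
Arguments power_measure {d T R} mu n.

Lemma measurable_box d (T : measurableType d) n (A : 'I_n -> set T) :
  (forall i, measurable (A i)) ->
  measurable [set t : n.-tuple T | forall i, A i (tnth t i)].
Proof.
move=> mA.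
rewrite (_ : mkset _ = \bigcap_(i in [set: 'I_n]) ((@tnth n T ^~ i) @^-1` A i)).
  apply: fin_bigcap_measurable => // i _; rewrite -[X in measurable X]setTI.
  exact: measurable_tnth.
by apply/seteqP; split=> t At i; [move=> _|]; exact: At.
Qed.

Lemma power_measure_box d (T : measurableType d) (R : realType)
    (mu : {sigma_finite_measure set T -> \bar R}) n (A : 'I_n -> set T) :
  (forall i, measurable (A i)) ->
  power_measure mu n [set t | forall i, A i (tnth t i)] =
  (\prod_(i < n) mu (A i))%E.
Proof.
elim: n A => [|n IHn] A mA.
  by rewrite big_ord0 /= diracE (_ : _ \in _)//; apply/mem_set => -[].
rewrite big_ord_recl /= /pushforward.
rewrite (_ : _ @^-1` _ =
    A ord0 `*` [set t | forall i, A (lift ord0 i) (tnth t i)]); last first.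
  apply/seteqP; split=> [[x t] /= At|[x t] /= [Ax At] i].
    split; first by have := At ord0.
    by move=> i; have := At (lift ord0 i); rewrite tnthS.
  case: (unliftP ord0 i) => [j ->|->]; [rewrite tnthS; have := At j|]; by [].
have mA' : measurable [set t : n.-tuple T |
    forall i, A (lift ord0 i) (tnth t i)].
  by apply: (measurable_box (A := fun i => A (lift ord0 i))).
rewrite product_measure1E//; congr (_ * _)%E.
exact: (IHn (fun i => A (lift ord0 i))).
Qed.

Section complex_measurable.
Variable R : realType.
Local Open Scope ereal_scope.

Definition complex_of_pair (p : R * R) : R[i] := p.1 +i* p.2.
Definition pair_of_complex (z : R[i]) : R * R := (complex.Re z, complex.Im z).

Lemma complex_of_pairK : cancel complex_of_pair pair_of_complex.
Proof. by case. Qed.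

HB.instance Definition _ := isPointed.Build R[i] 0%R.

Definition complex_display : measure_display.
Proof. exact. Qed.

(* The Borel sets of C, via the identification of C with R^2. *)
Definition complex_measurable : set (set R[i]) :=
  [set B | measurable (complex_of_pair @^-1` B)].

Let complex_measurable0 : complex_measurable set0.
Proof. by rewrite /complex_measurable/= preimage_set0. Qed.

Let complex_measurableC B :
  complex_measurable B -> complex_measurable (~` B).
Proof.
by move=> mB; rewrite /complex_measurable/= preimage_setC; exact: measurableC.
Qed.

Let complex_measurable_bigcup (F : (set R[i])^nat) :
  (forall n, complex_measurable (F n)) -> complex_measurable (\bigcup_n F n).
Proof.
move=> mF; rewrite /complex_measurable/= preimage_bigcup.
by apply: bigcupT_measurable => n; exact: mF.
Qed.

HB.instance Definition _ := @isMeasurable.Build complex_display R[i]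
  complex_measurable complex_measurable0 complex_measurableC
  complex_measurable_bigcup.

Definition lebesgue_complex : set R[i] -> \bar R :=
  pushforward (@lebesgue_measure R \x @lebesgue_measure R) complex_of_pair.

Lemma measurable_complex_of_pair : measurable_fun setT complex_of_pair.
Proof. by move=> _ B mB; rewrite setTI. Qed.

Lemma measurable_pair_of_complex : measurable_fun setT pair_of_complex.
Proof.
move=> _ B mB; rewrite setTI /measurable/= /complex_measurable/=.
by rewrite -comp_preimage (_ : _ \o _ = id)//; apply/funext; case.
Qed.

Let lebesgue_complex_ex :
  exists m : {sigma_finite_measure set R[i] -> \bar R},
    m = lebesgue_complex :> (set R[i] -> \bar R).
Proof.
have [|m mE] := pushforward_sigma_finite_ex
  (m := (@lebesgue_measure R \x @lebesgue_measure R))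
  measurable_complex_of_pair measurable_pair_of_complex complex_of_pairK.
  exact: product_sigma_finite.
by exists m.
Qed.

Let lebesgue_complex0 : lebesgue_complex set0 = 0.
Proof. by have [m <-] := lebesgue_complex_ex; exact: measure0. Qed.

Let lebesgue_complex_ge0 A : 0 <= lebesgue_complex A.
Proof. by have [m <-] := lebesgue_complex_ex; exact: measure_ge0. Qed.

Let lebesgue_complex_sigma_additive : semi_sigma_additive lebesgue_complex.
Proof.
by have [m <-] := lebesgue_complex_ex; exact: measure_semi_sigma_additive.
Qed.

HB.instance Definition _ := isMeasure.Build _ _ _ lebesgue_complex
  lebesgue_complex0 lebesgue_complex_ge0 lebesgue_complex_sigma_additive.

Let lebesgue_complex_sigma_finite : sigma_finite setT lebesgue_complex.
Proof. by have [m <-] := lebesgue_complex_ex; exact: sigma_finiteT. Qed.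

HB.instance Definition _ := Measure_isSigmaFinite.Build _ _ _
  lebesgue_complex lebesgue_complex_sigma_finite.

End complex_measurable.

Section probability.
Context d (T : measurableType d) (R : realType) (P : probability T R).
Local Open Scope ereal_scope.

Definition mutually_independent (I : finType) (X : I -> {RV P >-> R}) : Prop :=
  forall (J : {set I}) (B : I -> set R), (forall i, measurable (B i)) ->
    P (\bigcap_(i in [set` J]) (X i @^-1` B i)) =
    \prod_(i in J) P (X i @^-1` B i).

Definition has_density (X : {RV P >-> R}) (f : R -> R) : Prop :=
  [/\ measurable_fun setT f, forall x, (0 <= f x)%R &
      forall B, measurable B ->
        distribution P X B = \int[lebesgue_measure]_(x in B) (f x)%:E].

End probability.

Section zeros.
Context d (T : measurableType d) (R : realType) (P : probability T R).

Definition random_poly n (xi : 'I_n.+1 -> T -> R) (omega : T) : {poly R[i]} :=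
  \sum_(i < n.+1) (xi i omega)%:C *: 'X^i.

(* The sum of the Dirac masses at the zeros of p, each zero counted once
   (the zeros of the random polynomial are almost surely simple). *)
Definition zero_measure (p : {poly R[i]}) (B : set R[i]) : \bar R :=
  counting ([set z | root p z] `&` B).

Definition upper_half_plane : set R[i] := [set z | 0 < complex.Im z].

(* The l-tuples z range over C_+^l: r matters only on D.
   The sets A i of reals are disjoint from the sets B j of C_+, so it is enough
   to require disjointness within each of the two families. *)
Definition is_mixed_correlation (G : T -> {poly R[i]}) (k l : nat)
    (r : k.-tuple R -> l.-tuple R[i] -> \bar R) : Prop :=
  let D := [set q : k.-tuple R * l.-tuple R[i] |
             forall j, upper_half_plane (tnth q.2 j)] in
  [/\ forall q, D q -> (0 <= r q.1 q.2)%E,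
      measurable_fun D (fun q => r q.1 q.2) &
      forall (A : 'I_k -> set R) (B : 'I_l -> set R[i]),
        (forall i, measurable (A i)) ->
        (forall j, measurable (B j) /\ B j `<=` upper_half_plane) ->
        trivIset setT A -> trivIset setT B ->
        (\int[P]_omega
           (\prod_(i < k) zero_measure (G omega) (real_complex R @` A i) *
            \prod_(j < l) zero_measure (G omega) (B j)) =
         \int[power_measure lebesgue_measure k
              \x power_measure (@lebesgue_complex R) l]_(q in
             [set q | (forall i, A i (tnth q.1 i)) /\
                      (forall j, B j (tnth q.2 j))]) r q.1 q.2)%E].

End zeros.

Section rho.
Variable R : realType.

Definition elem_sym m (w : m.-tuple R[i]) (i : int) : R[i] :=
  match i with
  | Posz k => \sum_(J : {set 'I_m} | #|J| == k) \prod_(j in J) tnth w j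
  | Negz _ => 0
  end.

(* Meant for m <= n and for w whose elementary symmetric polynomials are real:
   taking their real parts then changes nothing. *)
Definition rho n (f : 'I_n.+1 -> R -> R) m (w : m.-tuple R[i]) : \bar R :=
  ((\prod_(i < m) \prod_(j < m | (i < j)%N) normc (tnth w i - tnth w j))%:E *
   \int[power_measure lebesgue_measure (n - m).+1]_t
     (\prod_(i < n.+1)
        f i (\sum_(j < (n - m).+1)
               let e := m%:Z - i%:Z + j%:Z in
               (-1) ^ e * complex.Re (elem_sym w e) * tnth t j) *
      \prod_(i < m)
        normc (\sum_(j < (n - m).+1) (tnth t j)%:C * tnth w i ^+ j))%:E)%E.

(* (x_1, ..., x_k, z_1, ..., z_l, conj z_1, ..., conj z_l) *)
Definition mixed_tuple k l (x : k.-tuple R) (z : l.-tuple R[i]) :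
    (k + (l + l)).-tuple R[i] :=
  [tuple of [seq a%:C | a <- x] ++ (z ++ [seq c^* | c <- z])].

Lemma elem_sym_mixed_tuple_real k l (x : k.-tuple R) (z : l.-tuple R[i]) (e : int) :
  elem_sym (mixed_tuple x z) e = (complex.Re (elem_sym (mixed_tuple x z) e))%:C.
Proof.
suff : (elem_sym (mixed_tuple x z) e)^* = elem_sym (mixed_tuple x z) e.
  case: (elem_sym _ _) => a b [] /eqP; rewrite -subr_eq0 -opprD oppr_eq0.
  by rewrite -mulr2n mulrn_eq0 /= => /eqP ->.
have /tuple_permP[s sE] : perm_eq [seq c^* | c <- mixed_tuple x z]
    (mixed_tuple x z).
  rewrite /= !map_cat -map_comp (eq_map (g := fun a => a%:C)); last first.
    by move=> a /=; rewrite oppr0.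
  rewrite perm_cat2l perm_catC perm_cat2r -map_comp map_id_in// => c _ /=.
  by rewrite conjcK.
have conj_tnth j :
    (tnth (mixed_tuple x z) j)^* = tnth (mixed_tuple x z) (s j).
  rewrite -(tnth_map (@conjc R)) (tnth_nth 0) /= sE.
  by rewrite -tnth_nth tnth_mktuple.
case: e => [e|e] /=; last by rewrite oppr0.
rewrite (rmorph_sum (@conjc R)) [RHS](reindex_inj (imset_inj (@perm_inj _ s))) /=.
apply: eq_big => [J|J _]; first by rewrite card_imset//; exact: perm_inj.
rewrite (rmorph_prod (@conjc R)) big_imset /=; last by move=> ? ? _ _; exact: perm_inj.
by apply: eq_bigr => j _; exact: conj_tnth.
Qed.

End rho.

(* Main.v *)
(* The roots are split off one at a time, and only one-dimensional changes of variables occur.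

   A real root x of G is split off by the change of variables a_0 = - (a_1 x + ... + a_n x^n),
   whose derivative is -G'(x); writing G = (X - x) t, G'(x) = t(x). For a root z = x + iy in C_+,
   put K = G - a_0 and H = G - a_0 - a_1 X. For fixed a_1, ..., a_n the nonreal roots run along
   the curve Im K = 0 as a_0 = - Re K varies, and da_0 = |K'|^2 / |Im K'| dy along it; for fixed
   y, a_2, ..., a_n one has a_1 = - Im H / y, so da_1 = |Im H'| / y dx. As Im H' = Im K', the
   product of the two factors is |G'(z)|^2 / y = 4 y |t(z)|^2 with G = (X - z)(X - conj z) t.
   Critical points of these parametrizations only occur for countably many parameters. Given z,
   the remaining coefficients of G and those of t are related by a unitriangular map.

   When x runs over A_1, the factor X - x has no root in the other sets A_i and B_j, so that
   mu(A_i) and mu(B_j) can be computed on t, and one goes on with t in place of G. The successive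
   factors |t(x)| and 2 |z - conj z| |t(z)|^2 multiply up to 2^l times the Vandermonde product
   times the values at all the chosen roots of the last cofactor. *)

From HB Require Import structures.
Require Import Defs.
From mathcomp Require Import finmap.
From mathcomp Require Import all_boot all_order all_algebra.
From mathcomp Require Import complex.
From mathcomp Require Import all_classical all_reals all_analysis.
From mathcomp Require Import measurable_realfun.
From mathcomp Require Import ring lra zify.

Set Implicit Arguments.
Unset Strict Implicit.
Unset Printing Implicit Defensive.

Import Order.TTheory GRing.Theory Num.Theory.
Import numFieldNormedType.Exports.
Import ComplexField.Normc.

Local Open Scope classical_set_scope.
Local Open Scope ring_scope.
Local Open Scope complex_scope.

(** * Densities along curves *)

Section lipschitz.
Context {R : realType}.
Local Notation mu := (@lebesgue_measure R).

(** Each change of variables compares two parameters a and b of one plane curve, without solving any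
    equation locally. Each parameter comes with a family of finite zero sets; integrating their
    counting measures over the parameter gives a measure on the plane, and on a piece of the curve
    where the parameter is injective this is the Lebesgue measure of the parameter values. The two
    plane measures are compared on countably many small squares on which |db| / |da| is almost
    constant. All that is needed there is that a map with Lipschitz constant c multiplies outer
    measure by at most c; no implicit function theorem enters. The price is that the number of zeros
    in a Borel set has to be shown measurable in the parameter, which rests on compactness of
    rectangles and on separating finitely many zeros by rational rectangles.

    The induction over the roots is carried out for an arbitrary nonnegative weight F on the
    coefficients instead of the product of the f_i: splitting off a root multiplies the weight by a
    Jacobian factor and composes it with a product of polynomials, and the result is again such a
    weight. *)

Lemma lebesgue_le_diam (S : set R) (r : R) : 0 <= r ->
  (forall x y, S x -> S y -> y - x <= r) -> (mu S <= r%:E)%E.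
Proof.
move=> r0 Sr; have [->|/set0P[x Sx]] := eqVneq S set0.
  by rewrite measure0 lee_fin.
have ubS y : S y -> ubound S (y + r).
  by move=> Sy z Sz; rewrite -lerBlDl; exact: Sr.
have lbS y : S y -> lbound S (y - r).
  by move=> Sy z Sz; rewrite lerBlDr -lerBlDl; exact: Sr.
have hs : has_sup S by split; [exists x|exists (x + r); exact: ubS].
have hi : has_inf S by split; [exists x|exists (x - r); exact: lbS].
have SI : S `<=` `[inf S, sup S].
  move=> y Sy; rewrite /= in_itv/=; apply/andP; split.
    by apply: ge_inf => //; exact: hi.2.
  by apply: ub_le_sup => //; exact: hs.2.
have /le_trans : (mu S <= mu `[inf S, sup S]%classic)%E.
  exact: (le_outer_measure mu).
apply; rewrite lebesgue_measure_itv/= lte_fin; case: ltP => // _.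
rewrite -EFinB lee_fin lerBlDr; apply: ge_sup; first by exists x.
move=> y Sy; rewrite -lerBlDl; apply: lb_le_inf; first by exists x.
by move=> z Sz; rewrite lerBlDl -lerBlDr; exact: Sr.
Qed.

Lemma lebesgue_lipschitz_image (T : Type) (E : set T) (a b : T -> R) (c : R) :
  0 < c -> (forall z w, E z -> E w -> `|b z - b w| <= c * `|a z - a w|) ->
  (mu (b @` E) <= c%:E * mu (a @` E))%E.
Proof.
move=> c0 ab.
have -> : mu (a @` E) = ereal_inf
    [set (\sum_(k <oo) wlength idfun (F k))%E | F in open_itv_cover (a @` E)].
  exact: outer_measure_open_itv_cover.
rewrite -lee_pdivrMl//; apply: le_ereal_inf_tmp => _ [F [Fitv EF] <-].
rewrite lee_pdivrMl//.
pose S k := b @` (E `&` a @^-1` F k).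
have bS : b @` E `<=` \bigcup_k S k.
  move=> _ [z Ez <-]; have [k _ Fk] := EF _ (ex_intro2 _ _ z Ez erefl).
  by exists k => //; exists z.
apply: (@le_trans _ _ (mu (\bigcup_k S k))).
  exact: (le_outer_measure mu).
apply: (le_trans (outer_measure_sigma_subadditive mu S)).
rewrite -nneseriesZl//.
apply: lee_nneseries => [k _ _|k _]; first exact: (outer_measure_ge0 mu).
have [[u v] Fk] := Fitv k; rewrite /= in Fk.
rewrite Fk wlength_itv/= lte_fin; case: ltP => [uv|vu]; last first.
  rewrite mule0 (_ : S k = set0) ?(outer_measure0 mu) ?lexx//.
  rewrite -subset0 => ? [z [_ +] _]; rewrite /= Fk/= in_itv/=.
  by case/andP => ua av; have := lt_trans ua av; rewrite ltNge vu.
rewrite -EFinB -EFinM; apply: lebesgue_le_diam.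
  by rewrite mulr_ge0 ?ltW// subr_gt0.
move=> _ _ [z [Ez +] <-] [w [Ew +] <-]; rewrite /= Fk/= !in_itv/=.
move=> /andP[uz zv] /andP[uw wv].
apply: (le_trans (ler_norm _)); apply: (le_trans (ab _ _ Ew Ez)).
rewrite ler_pM2l// ler_norml; apply/andP; split; lra.
Qed.

End lipschitz.

Section density.
Context d (T : measurableType d) (R : realType).
Variables (n1 n2 : {measure set T -> \bar R}) (G : set T) (D : T -> R).
Hypotheses (mG : measurable G) (mD : measurable_fun G D)
  (D0 : forall x, G x -> 0 <= D x).
Hypothesis n12 : forall B, measurable B -> B `<=` G ->
  n1 B = (\int[n2]_(x in B) (D x)%:E)%E.

Import HBNNSimple.

(** Simple functions increase to f, monotone convergence is applied on both sides, and by linearity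
    only indicators remain. Everything is relative to G, because the density is known on subsets of
    G only. *)
Lemma ge0_integral_density (f : T -> \bar R) :
  measurable_fun G f -> (forall x, G x -> (0 <= f x)%E) ->
  (\int[n1]_(x in G) f x = \int[n2]_(x in G) ((D x)%:E * f x))%E.
Proof.
move=> mf f0; pose f_ := nnsfun_approx mG mf.
have mfn n : measurable_fun G (fun x => (f_ n x)%:E).
  by apply/measurable_EFinP; apply: measurable_funTS; exact: measurable_funP.
have mDE : measurable_fun G (fun x => (D x)%:E) by exact/measurable_EFinP.
transitivity (limn (fun n => \int[n1]_(x in G) (f_ n x)%:E)%E).
  rewrite -monotone_convergence//.
  - apply: eq_integral => y /[!inE] yD; apply/esym/cvg_lim => //.
    by apply: cvg_nnsfun_approx.
  - by move=> n y _; rewrite lee_fin.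
  - by move=> y _ m n mn; rewrite lee_fin; exact/lefP/nd_nnsfun_approx.
transitivity (limn (fun n => \int[n2]_(x in G) ((D x)%:E * (f_ n x)%:E))%E); last first.
  rewrite -monotone_convergence//; first last.
  - move=> y Gy m n mn; rewrite lee_wpmul2l ?lee_fin ?D0//.
    exact/lefP/nd_nnsfun_approx.
  - by move=> n y Gy; rewrite mule_ge0// lee_fin// D0.
  - by move=> n; exact: emeasurable_funM.
  apply: eq_integral => y /[!inE] yD; apply/cvg_lim => //.
  apply: cvgeZl => //.
  by apply: cvg_nnsfun_approx.
congr (limn _); apply/funext => n.
transitivity (\sum_(k \in range (f_ n))
    \int[n1]_(x in G) (k * \1_(f_ n @^-1` [set k]) x)%:E)%E.
  under eq_integral do rewrite fimfunE -fsumEFin//.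
  rewrite ge0_integral_fsum//.
  - move=> r; apply/measurable_EFinP; apply: measurable_funM => //.
  - by move=> r x _; rewrite nnfun_muleindic_ge0.
transitivity (\sum_(k \in range (f_ n))
    \int[n2]_(x in G) ((D x)%:E * (k * \1_(f_ n @^-1` [set k]) x)%:E))%E; last first.
  rewrite -ge0_integral_fsum//.
  - apply: eq_integral => x _.
    rewrite -ge0_mule_fsumr.
      by rewrite fsumEFin// -fimfunE.
    by move=> r; rewrite nnfun_muleindic_ge0.
  - move=> r; apply: emeasurable_funM => //.
    by apply/measurable_EFinP; apply: measurable_funM.
  - by move=> r x Gx; apply: mule_ge0; [by rewrite lee_fin D0|by rewrite nnfun_muleindic_ge0].
apply: eq_fsbigr => r; rewrite inE => -[t _ ftr].
have r0 : 0 <= r by rewrite -ftr.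
rewrite integralZl_indic_nnsfun// integral_indic//.
rewrite setIC n12; last by move=> ? [].
  rewrite integral_mkcondr -ge0_integralZl//.
  - apply: eq_integral => x _; rewrite patchE indicE.
    by case: (x \in _); rewrite ?mulr1 ?mulr0 ?mule0// muleC.
  - by apply/measurable_restrict => //; exact: measurable_funS mDE.
  - by move=> x Gx; rewrite patchE; case: ifPn => // _; rewrite lee_fin D0.
by apply: measurableI.
Qed.

End density.

(** * Comparison of two parameters of a plane curve *)

Section curve.
Context {R : realType}.
Local Notation mu := (@lebesgue_measure R).

Definition square (z : R * R) (r : R) : set (R * R) :=
  [set w | `|w.1 - z.1| < r /\ `|w.2 - z.2| < r].

Lemma measurable_square z r : measurable (square z r).
Proof.
rewrite (_ : square z r = [set w | `|w - z.1| < r] `*` [set w | `|w - z.2| < r]); last first.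
  by apply/seteqP; split => w.
have h (x : R) : measurable [set w | `|w - x| < r].
  rewrite (_ : mkset _ = `]x - r, x + r[%classic) //.
  by apply/seteqP; split => w /=; rewrite in_itv/= ltr_distl.
exact: measurableX.
Qed.

Definition rational_square (q : rat * rat * nat) : set (R * R) :=
  square (ratr q.1.1, ratr q.1.2) q.2.+1%:R^-1.

Lemma rational_square_base (z : R * R) (r : R) : 0 < r ->
  exists q, rational_square q z /\ rational_square q `<=` square z r.
Proof.
move=> r0; have [m mr] : exists m, m.+1%:R^-1 < r / 2 :> R.
  have r20 : 0 < r / 2 by rewrite divr_gt0.
  exists (Num.truncn (r / 2)^-1).
  by rewrite invf_plt ?posrE// truncnS_gt.
have m0 : 0 < m.+1%:R^-1 :> R by rewrite invr_gt0.
have ex (x : R) : exists q : rat, `|x - ratr q| < m.+1%:R^-1.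
  have [|q] := @rat_in_itvoo _ (x - m.+1%:R^-1) (x + m.+1%:R^-1).
    by rewrite ltrBlDr -addrA ltrDl addr_gt0.
  by rewrite in_itv/= -ltr_distlC => qx; exists q.
have [q1 h1] := ex z.1; have [q2 h2] := ex z.2.
exists (q1, q2, m); split => // w [/= w1 w2].
rewrite distrC in h1; rewrite distrC in h2.
split.
- by apply: le_lt_trans (ler_distD (ratr q1) _ _) _; rewrite (splitr r) ltrD// (lt_trans _ mr).
- by apply: le_lt_trans (ler_distD (ratr q2) _ _) _; rewrite (splitr r) ltrD// (lt_trans _ mr).
Qed.

(** A Lindelöf argument: the rational squares form a countable base. Those on which P fails are
    replaced by the empty set, where P holds, and the sequence is then made disjoint; P passes to
    subsets. *)
Lemma square_cover (G : set (R * R)) (P : set (R * R) -> Prop) :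
  P set0 -> (forall A B, A `<=` B -> P B -> P A) ->
  (forall z, G z -> exists2 r, 0 < r & P (G `&` square z r)) ->
  exists F : (set (R * R))^nat, [/\ forall i, measurable (F i),
    trivIset setT F, G `<=` \bigcup_i F i & forall i, P (G `&` F i)].
Proof.
move=> P0 Psub PG.
pose F0 i := if unpickle i is Some q then
  (if `[< P (G `&` rational_square q) >] then rational_square q else set0)
  else set0.
exists (seqDU F0); split.
- apply: seqDU_measurable => i; rewrite /F0.
  by case: unpickle => // q; case: ifPn => // _; exact: measurable_square.
- exact: trivIset_seqDU.
- move=> z Gz; rewrite -seqDU_bigcup_eq; have [r r0 Pr] := PG z Gz.
  have [q [qz qr]] := rational_square_base z r0.
  exists (pickle q); [exact: I|]; rewrite /F0 pickleK asboolT//.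
  by apply: Psub Pr; exact: setIS.
- move=> i; apply: (@Psub _ (G `&` F0 i)).
    by apply: setIS; exact: subset_seqDU.
  rewrite /F0; case: unpickle => [q|]; last by rewrite setI0.
  by case: ifPn => [/asboolP//|_]; rewrite setI0.
Qed.

Variables (n1 n2 : {measure set (R * R) -> \bar R}).
Variables (G : set (R * R)) (a b D : R * R -> R).
Hypotheses (mG : measurable G) (mD : measurable_fun G D).
Hypothesis D0 : forall z, G z -> 0 < D z.
Hypothesis n1E : forall B, measurable B -> B `<=` G -> set_inj B b ->
  n1 B = mu (b @` B).
Hypothesis n2E : forall B, measurable B -> B `<=` G -> set_inj B a ->
  n2 B = mu (a @` B).
Hypothesis abD : forall z0, G z0 -> forall c1 c2, 0 < c1 < D z0 -> D z0 < c2 ->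
  exists2 r, 0 < r & forall z w, G z -> G w -> square z0 r z -> square z0 r w ->
   [/\ a z = a w -> z = w, c1 * `|a z - a w| <= `|b z - b w|,
    `|b z - b w| <= c2 * `|a z - a w|, c1 <= D z & D z <= c2].

Let close (c1 c2 : R) (V : set (R * R)) := forall z w, V z -> V w ->
  [/\ a z = a w -> z = w, c1 * `|a z - a w| <= `|b z - b w|,
    `|b z - b w| <= c2 * `|a z - a w|, c1 <= D z & D z <= c2].

(** On V both D and the ratio of increments of b and a lie between r c and c, for the same c; r is a
    prescribed precision that will tend to 1. *)
Let good (r : R) (V : set (R * R)) := exists2 c, 0 < c & close (r * c) c V.

(** Both [n1 B] and the integral of D lie between r c n2(B) and c n2(B). For [n1] these are the
    Lipschitz bounds of b in terms of a and of a in terms of b. *)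
Let good_le (r : R) (B : set (R * R)) : 0 < r -> measurable B -> B `<=` G ->
  good r B -> (r%:E * n1 B <= \int[n2]_(z in B) (D z)%:E)%E /\
  (r%:E * \int[n2]_(z in B) (D z)%:E <= n1 B)%E.
Proof.
move=> r0 mB BG [c c0 Bc].
have rc0 : 0 < r * c by rewrite mulr_gt0.
have mDB : measurable_fun B (EFin \o D).
  by apply/measurable_EFinP; exact: measurable_funS mD.
have ia : set_inj B a.
  by move=> z w /[!inE] Bz Bw; have [+ _ _ _ _] := Bc z w Bz Bw.
have ib : set_inj B b.
  move=> z w /[!inE] Bz Bw bE; have [+ h _ _ _] := Bc z w Bz Bw; apply.
  move: h; rewrite bE subrr normr0 pmulr_rle0// normr_le0 subr_eq0.
  by move/eqP.
have h1 : (n1 B <= c%:E * n2 B)%E.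
  rewrite n1E// n2E//; apply: lebesgue_lipschitz_image => // z w Bz Bw.
  by have [] := Bc z w Bz Bw.
have h2 : ((r * c)%:E * n2 B <= n1 B)%E.
  rewrite n1E// n2E// -lee_pdivlMl//.
  apply: lebesgue_lipschitz_image; first by rewrite invr_gt0.
  move=> z w Bz Bw; rewrite ler_pdivlMl//.
  by have [] := Bc z w Bz Bw.
have h3 : ((r * c)%:E * n2 B <= \int[n2]_(z in B) (D z)%:E)%E.
  rewrite -integral_cst//; apply: ge0_le_integral => //.
  - by move=> z Bz; rewrite lee_fin ltW.
  - by move=> z Bz; rewrite lee_fin; have [] := Bc z z Bz Bz.
have h4 : (\int[n2]_(z in B) (D z)%:E <= c%:E * n2 B)%E.
  rewrite -integral_cst//; apply: ge0_le_integral => //.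
  - by move=> z Bz; rewrite lee_fin ltW// D0//; exact: BG.
  - by move=> z Bz; rewrite lee_fin; have [] := Bc z z Bz Bz.
split.
- apply: le_trans h3; rewrite EFinM -muleA.
  by apply: lee_wpmul2l => //; rewrite lee_fin ltW.
- apply: le_trans h2; rewrite EFinM -muleA.
  by apply: lee_wpmul2l => //; rewrite lee_fin ltW.
Qed.

(* On G the functions a and b are two local coordinates of the same curve,
   and D is the local ratio |db| / |da|. *)
Lemma curve_measure (B : set (R * R)) : measurable B -> B `<=` G ->
  n1 B = (\int[n2]_(z in B) (D z)%:E)%E.
Proof.
move=> mB BG.
(* The equality is the limit r -> 1 of two inequalities. *)
suff H (r : R) : 0 < r < 1 -> (r%:E * n1 B <= \int[n2]_(z in B) (D z)%:E)%E /\
  (r%:E * \int[n2]_(z in B) (D z)%:E <= n1 B)%E.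
  apply/eqP; rewrite eq_le; apply/andP; split.
    by apply/lee_mul01Pr => // r /H[].
  apply/lee_mul01Pr => [|r /H[//]].
  by apply: integral_ge0 => z Bz; rewrite lee_fin ltW// D0//; exact: BG.
move=> /andP[r0 r1].
have [|||F [mF tF GF gF]] := @square_cover G (good r).
- by exists 1.
- move=> A A' AA' [c c0 A'c]; exists c => // z w Az Aw.
  by apply: A'c; exact: AA'.
- move=> z0 Gz0; have Dz0 := D0 Gz0.
  (* With this c one has r c = (1 + r) / 2 * D z0 < D z0 < c, because r < 1. *)
  pose c := (1 + r) / (2 * r) * D z0.
  have c0 : 0 < c by rewrite mulr_gt0// divr_gt0//; lra.
  have [||s s0 Hs] := abD Gz0 (c1 := r * c) (c2 := c).
  + rewrite mulr_gt0//= /c mulrA (_ : r * _ = (1 + r) / 2).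
      by rewrite gtr_pMl//; lra.
    by field; lra.
  + by rewrite ltr_pMl// ltr_pdivlMr; lra.
  exists s => //; exists c => // z w [Gz sz] [Gw sw].
  exact: Hs.
have BE : B = \bigcup_i (B `&` F i).
  rewrite -setI_bigcupr; apply/seteqP; split => [z Bz|z []//].
  by split => //; exact/GF/BG.
have mBF i : measurable (B `&` F i) by exact: measurableI.
have tBF : trivIset setT (fun i => B `&` F i) by exact: trivIset_setIl.
have BFG i : B `&` F i `<=` G by move=> z [/BG].
have I0 i : (0 <= \int[n2]_(z in B `&` F i) (D z)%:E)%E.
  by apply: integral_ge0 => z /BFG Gz; rewrite lee_fin ltW// D0.
have n1B : (n1 B = \sum_(i <oo) n1 (B `&` F i))%E.
  by rewrite {1}BE measure_bigcup//; apply: eq_eseriesl => i; rewrite in_setT.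
have iB : (\int[n2]_(z in B) (D z)%:E =
    \sum_(i <oo) \int[n2]_(z in B `&` F i) (D z)%:E)%E.
  rewrite {1}BE ge0_integral_bigcup//.
  - by rewrite -BE; apply/measurable_EFinP; exact: measurable_funS mD.
  - by rewrite -BE => z /BG Gz; rewrite lee_fin ltW// D0.
have gBF i : good r (B `&` F i).
  have [c c0 gc] := gF i; exists c => // z w [/BG Gz Fz] [/BG Gw Fw].
  by apply: gc; split.
rewrite n1B iB; split.
- rewrite -nneseriesZl//; apply: lee_nneseries => [i _ _|i _].
    by rewrite mule_ge0// lee_fin ltW.
  by have [] := good_le r0 (mBF i) (@BFG i) (gBF i).
- rewrite -nneseriesZl//; apply: lee_nneseries => [i _ _|i _].
    by rewrite mule_ge0// lee_fin ltW.
  by have [] := good_le r0 (mBF i) (@BFG i) (gBF i).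
Qed.

End curve.

(** * Sums over the zeros of a family of continuous functions *)

Section countable_generator.
Context {R : realType}.

Definition quadrant (z : R * R) : set (R * R) := [set w | z.1 <= w.1 /\ z.2 <= w.2].

Lemma quadrantE z : quadrant z = `[z.1, +oo[ `*` `[z.2, +oo[.
Proof. by apply/seteqP; split => w; rewrite /quadrant /= !in_itv/= !andbT. Qed.

Lemma measurable_quadrant z : measurable (quadrant z).
Proof. by rewrite quadrantE; exact: measurableX. Qed.

Lemma itvN_cover (x : R) : exists n : nat, - n%:R <= x.
Proof.
exists (Num.truncn `|x|).+1; rewrite lerNl (le_trans (ler_norm _))// normrN.
by rewrite ltW// truncnS_gt.
Qed.

(** The preimage of a ray [[x, +oo[] under a coordinate is the union of the quadrants whose other
    coordinate is - n. Quadrants are chosen because they are stable under intersection and meet a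
    closed rectangle in a closed rectangle, for which [measurable_hit_rect] is available. *)
Lemma measurable_plane_generator :
  @measurable _ (R * R)%type = <<s range quadrant >>.
Proof.
rewrite eqEsubset; split; last first.
  apply: smallest_sub; first exact: sigma_algebra_measurable.
  by move=> _ [z _ <-]; exact: measurable_quadrant.
have sG : sigma_algebra setT (<<s range quadrant >>).
  exact: smallest_sigma_algebra.
have [s0 sC sU] := sG.
have key (f : R * R -> R) : (forall x, <<s range quadrant >> (f @^-1` `[x, +oo[)) ->
    forall A, measurable A -> <<s range quadrant >> (f @^-1` A).
  move=> fx A mA; have {mA} : <<s @RGenCInfty.G R >> A.
    have : (@ocitv R).-sigma.-measurable A by exact: mA.
    by rewrite RGenCInfty.measurableE.
  move: A.
  have fs : sigma_algebra setT [set A | <<s range quadrant >> (f @^-1` A)].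
    split => /=.
    - by rewrite preimage_set0.
    - by move=> B; rewrite !setTD preimage_setC -setTD; exact: sC.
    - by move=> F mF; rewrite preimage_bigcup; exact: sU.
  apply: (smallest_sub fs) => _ [x ->] /=.
  by have := fx x; rewrite set_itvcy.
apply: smallest_sub => // B [] [A mA <-]; rewrite setTI; apply: key => // x.
- rewrite (_ : _ @^-1` _ = \bigcup_n quadrant (x, - n%:R)).
    by apply: sU => n; apply: sub_sigma_algebra; exists (x, - n%:R).
  apply/seteqP; split => [w /=|w [n _] /= []]; rewrite /quadrant/= in_itv/= andbT//.
  by move=> xw; have [n nw] := itvN_cover w.2; exists n.
- rewrite (_ : _ @^-1` _ = \bigcup_n quadrant (- n%:R, x)).
    by apply: sU => n; apply: sub_sigma_algebra; exists (- n%:R, x).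
  apply/seteqP; split => [w /=|w [n _] /= []]; rewrite /quadrant/= in_itv/= andbT//.
  by move=> xw; have [n nw] := itvN_cover w.1; exists n.
Qed.

Lemma quadrantI z w :
  quadrant z `&` quadrant w = quadrant (Num.max z.1 w.1, Num.max z.2 w.2).
Proof.
apply/seteqP; split=> [u [[/= h1 h2] [/= h3 h4]]|u [/=]].
  by split; rewrite /= ge_max; apply/andP.
by rewrite !ge_max => /andP[? ?] /andP[? ?].
Qed.

End countable_generator.

(** * Measurability of the number of zeros *)

Section zero_kernel.
Context d (Th : measurableType d) {R : realType} (phi : Th -> R * R -> R).
Hypotheses (mphi : forall z, measurable_fun setT (phi ^~ z))
  (cphi : forall t, continuous (phi t)).

Let zeros t := [set z | phi t z = 0].

Lemma continuous_square (t : Th) (z : R * R) (e : R) : 0 < e ->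
  exists2 r, 0 < r & forall w, square z r w -> `|phi t w - phi t z| < e.
Proof.
move=> e0; have /cvgrPdist_lt/(_ e e0)/nbhs_ballP[r r0 H] := @cphi t z.
exists r => // w [w1 w2]; rewrite distrC; apply: H; split; rewrite /ball/=.
  by rewrite distrC.
by rewrite distrC.
Qed.

(** Moving rational points into a rectangle by clamping gives a countable dense subset of it even if
    the rectangle is degenerate, in which case it may contain no rational point at all. *)
Let clamp (a b x : R) := Num.max a (Num.min b x).

Let clamp_itv a b x : a <= b -> a <= clamp a b x <= b.
Proof. by move=> ab; rewrite /clamp le_max lexx/= ge_max ab/= ge_min lexx. Qed.

Let clamp_lip a b x y : a <= x <= b -> `|clamp a b y - x| <= `|y - x|.
Proof.
move=> /andP[ax xb]; rewrite /clamp.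
case: (leP b y) => [bY|yb].
  rewrite maxEle (le_trans ax xb) !ger0_norm; lra.
rewrite maxEle; case: ifPn => [//|]; rewrite -ltNge => ya.
rewrite !ler0_norm; lra.
Qed.

Let rat_close (x r : R) : 0 < r -> exists q : rat, `|ratr q - x| < r.
Proof.
move=> r0; have [|q] := @rat_in_itvoo _ (x - r) (x + r).
  by rewrite ltrBlDr -addrA ltrDl addr_gt0.
by rewrite in_itv/= -ltr_distl => qx; exists q.
Qed.

Definition rect (a b : R * R) : set (R * R) :=
  `[a.1, b.1]%classic `*` `[a.2, b.2]%classic.

Lemma rectP a b z : rect a b z <-> a.1 <= z.1 <= b.1 /\ a.2 <= z.2 <= b.2.
Proof. by rewrite /rect/= !in_itv. Qed.

(* By compactness a zero exists iff |phi| is arbitrarily small on a countable dense subset. *)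
Lemma measurable_hit_rect (a b : R * R) :
  measurable [set t | rect a b `&` zeros t !=set0].
Proof.
have [[ab1 ab2]|nab] := pselect (a.1 <= b.1 /\ a.2 <= b.2); last first.
  rewrite (_ : mkset _ = set0)//; rewrite -subset0 => t [z [/rectP]].
  by move=> [/andP[? ?] /andP[? ?]] _; apply: nab; split; [exact: le_trans z.1 _ _ _ _|exact: le_trans z.2 _ _ _ _].
pose p (q : rat * rat) := (clamp a.1 b.1 (ratr q.1), clamp a.2 b.2 (ratr q.2)).
have pab q : rect a b (p q) by apply/rectP; split; exact: clamp_itv.
rewrite (_ : mkset _ = \bigcap_m \bigcup_i [set t | exists2 q, unpickle i = Some q &
    `|phi t (p q)| < m.+1%:R^-1]); last first.
  apply/seteqP; split => t.
    move=> [z [/rectP[az bz] tz]] m _.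
    have [|r r0 H] := @continuous_square t z m.+1%:R^-1; first by rewrite invr_gt0.
    have [q1 h1] := rat_close z.1 r0; have [q2 h2] := rat_close z.2 r0.
    exists (pickle (q1, q2)); [exact: I|]; exists (q1, q2); first by rewrite pickleK.
    rewrite -[X in `|X|]subr0 -tz; apply: H; split => /=.
      by apply: le_lt_trans h1; exact: clamp_lip.
    by apply: le_lt_trans h2; exact: clamp_lip.
  move=> H.
  have [|||z zab zmin] := @compact_EVT_min _ R (fun z => `|phi t z|) (rect a b).
  - by exists (p (0, 0)).
  - by apply: compact_setX; exact: segment_compact.
  - apply: continuous_subspaceT => z.
    by apply: (@continuous_comp _ _ _ (phi t) Num.norm); [exact: cphi|exact: norm_continuous].
  exists z; split; first by rewrite inE in zab.
  apply/eqP; rewrite -normr_eq0 eq_le normr_ge0 andbT.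
  apply/ler_addgt0Pl => e e0; rewrite addr0.
  have [i _ [q _ qe]] := H (Num.truncn e^-1) I.
  apply: (le_trans (zmin (p q) _)); first by rewrite inE.
  by rewrite (le_trans (ltW qe))// invf_ple ?posrE// ltW// truncnS_gt.
apply: bigcap_measurable => // m _; apply: bigcup_measurable => i _.
case: (unpickle i) => [q|]; last first.
  by rewrite (_ : mkset _ = set0)// -subset0 => t [].
rewrite (_ : mkset _ = setT `&` (fun t => `|phi t (p q)|) @^-1` `]-oo, m.+1%:R^-1[); last first.
  rewrite setTI; apply/seteqP; split => t /=; rewrite in_itv/=.
    by move=> [_ [<-]].
  by move=> h; exists q.
have mf : measurable_fun setT (fun t => `|phi t (p q)|).
  by apply: measurableT_comp => //; exact: mphi.
exact: mf.
Qed.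

Lemma small_uniform (T : eqType) (s : seq T) (P : T -> R -> Prop) :
  (forall x r r', 0 < r' <= r -> P x r -> P x r') ->
  (forall x, x \in s -> exists2 r, 0 < r & P x r) ->
  exists2 r, 0 < r & forall x, x \in s -> P x r.
Proof.
move=> Pr; elim: s => [|x s IH] H; first by exists 1.
have [|r r0 Hr] := IH; first by move=> y ys; apply: H; rewrite inE ys orbT.
have [|r' r'0 Hr'] := H x; first by rewrite mem_head.
have m0 : 0 < Num.min r r' by rewrite lt_min r0.
exists (Num.min r r') => // y; rewrite inE => /predU1P[->|ys].
  by apply: Pr Hr'; rewrite m0 ge_min lexx orbT.
by apply: Pr (Hr _ ys); rewrite m0 ge_min lexx.
Qed.

Let qrect (q : (rat * rat) * (rat * rat)) : set (R * R) :=
  rect (ratr q.1.1, ratr q.1.2) (ratr q.2.1, ratr q.2.2).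

Let qrect_around (z : R * R) (r : R) : 0 < r ->
  exists q, qrect q z /\ qrect q `<=` square z r.
Proof.
move=> r0; have h (x : R) : exists q1 q2 : rat, x - r < ratr q1 < x /\ x < ratr q2 < x + r.
  have [|q1] := @rat_in_itvoo _ (x - r) x; first by rewrite ltrBlDr ltrDl.
  have [|q2] := @rat_in_itvoo _ x (x + r); first by rewrite ltrDl.
  by rewrite !in_itv/=; exists q1, q2.
have [a [b [/andP[a1 a2] /andP[b1 b2]]]] := h z.1; have [c [e [/andP[c1 c2] /andP[e1 e2]]]] := h z.2.
exists ((a, c), (b, e)); split; first by apply/rectP => /=; rewrite !ltW.
move=> w /rectP[/= /andP[w1 w2] /andP[w3 w4]].
split; rewrite ltr_distl; apply/andP; split.
- exact: lt_le_trans w1.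
- exact: le_lt_trans b2.
- exact: lt_le_trans w3.
- exact: le_lt_trans e2.
Qed.

Let disjoint_family (s : seq ((rat * rat) * (rat * rat))) :=
  uniq s /\ forall p q, p \in s -> q \in s -> p != q -> qrect p `&` qrect q = set0.

(** There are at least m zeros in B exactly if m pairwise disjoint rational rectangles each contain
    one. There are only countably many finite families of such rectangles. *)
Lemma measurable_count_ge (B : set (R * R)) (m : nat) :
  (forall t, finite_set (zeros t)) ->
  (forall q, measurable [set t | qrect q `&` B `&` zeros t !=set0]) ->
  measurable [set t | (m <= #|` fset_set (B `&` zeros t)|)%N].
Proof.
move=> fz mB.
rewrite (_ : mkset _ = \bigcup_i [set t | exists2 s, unpickle i = Some s &
   [/\ size s = m, disjoint_family s & forall q, q \in s -> qrect q `&` B `&` zeros t !=set0]]).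
  apply: bigcup_measurable => i _; case: (unpickle i) => [s|]; last first.
    by rewrite (_ : mkset _ = set0)// -subset0 => t [].
  have [[sm ds]|ns] := pselect (size s = m /\ disjoint_family s); last first.
    rewrite (_ : mkset _ = set0)// -subset0 => t [_ [<-] [? ? _]]; exact: ns.
  rewrite (_ : mkset _ = \bigcap_(q in [set` s]) [set t | qrect q `&` B `&` zeros t !=set0]).
    by apply: fin_bigcap_measurable.
  apply/seteqP; split => t /=; first by move=> [_ [<-] [_ _ H]] q /H.
  by move=> H; exists s => //; split.
apply/seteqP; split => t /=.
- move=> mt.
  pose S : seq (R * R) := take m (fset_set (B `&` zeros t)).
  have Sm : size S = m by rewrite size_take_min; apply/minn_idPl.
  have Su : uniq S by rewrite take_uniq// fset_uniq.
  have fBz : finite_set (B `&` zeros t) by apply: sub_finite_set (fz t) => z [].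
  have SB z : z \in S -> (B `&` zeros t) z.
    by move=> /mem_take; rewrite in_fset_set// inE.
  have [r r0 Hr] : exists2 r, 0 < r &
      forall z, z \in S -> forall w, w \in S -> w != z -> ~ square z r w.
    apply: (@small_uniform _ S (fun z r => forall w, w \in S -> w != z -> ~ square z r w)).
      move=> z s s' /andP[_ ss'] H w wS wz [h1 h2]; apply: (H w wS wz).
      by split; apply: lt_le_trans ss'.
    move=> z zS.
    apply: (@small_uniform _ S (fun w r => w != z -> ~ square z r w)).
      move=> w s s' /andP[_ ss'] H wz [h1 h2]; apply: (H wz).
      by split; apply: lt_le_trans ss'.
    move=> w wS; have [->|wz] := eqVneq w z; first by exists 1.
    exists (Num.max `|w.1 - z.1| `|w.2 - z.2|).
      rewrite lt_max !normr_gt0 !subr_eq0 -negb_and.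
      by apply: contra wz => /andP[/eqP h1 /eqP h2]; rewrite [w]surjective_pairing h1 h2 -surjective_pairing.
    move=> _ [h1 h2]; suff : Num.max `|w.1 - z.1| `|w.2 - z.2| < Num.max `|w.1 - z.1| `|w.2 - z.2|.
      by rewrite ltxx.
    by rewrite [X in X < _]maxEle; case: ifPn.
  have r20 : 0 < r / 2 by rewrite divr_gt0.
  (* Rectangles inside the squares of half the separating radius r are disjoint by the triangle
     inequality. *)
  pose f z := projT1 (cid (qrect_around z r20)).
  have fP z : qrect (f z) z /\ qrect (f z) `<=` square z (r / 2).
    by rewrite /f; case: cid.
  have fdisj z w : z \in S -> w \in S -> w != z -> qrect (f z) `&` qrect (f w) = set0.
    move=> zS wS wz; rewrite -subset0 => u [/(fP z).2[u1 u2] /(fP w).2[v1 v2]].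
    apply: (Hr z zS w wS wz); rewrite distrC in v1; rewrite distrC in v2; split.
      by apply: le_lt_trans (ler_distD u.1 _ _) _; rewrite (splitr r) ltrD.
    by apply: le_lt_trans (ler_distD u.2 _ _) _; rewrite (splitr r) ltrD.
  have finj : {in S &, injective f}.
    move=> z w zS wS fzw; apply/eqP; apply: contrapT => /negP zw.
    have := fdisj _ _ wS zS zw; rewrite fzw setIid => /seteqP[+ _] => /(_ w).
    by apply; exact: (fP w).1.
  exists (pickle (map f S)); [exact: I|]; exists (map f S); first by rewrite pickleK.
  split; first by rewrite size_map.
    split; first by rewrite map_inj_in_uniq.
    move=> _ _ /mapP[z zS ->] /mapP[w wS ->] zw; apply: fdisj => //.
    by apply: contra zw => /eqP ->.
  move=> _ /mapP[z zS ->]; exists z; have [? ?] := SB z zS.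
  by split => //; split => //; exact: (fP z).1.
- move=> [_ _ [s _ [<- [us ds] hs]]].
  have fBz : finite_set (B `&` zeros t) by apply: sub_finite_set (fz t) => z [].
  have ex q : exists z, q \in s -> (qrect q `&` B `&` zeros t) z.
    case: (boolP (q \in s)) => [/hs[z ?]|_]; first by exists z.
    by exists (0, 0).
  pose g q := projT1 (cid (ex q)).
  have gP q : q \in s -> (qrect q `&` B `&` zeros t) (g q).
    by rewrite /g; case: cid.
  have ginj : {in s &, injective g}.
    move=> p q ps qs gpq; apply/eqP; apply: contrapT => /negP pq.
    have := ds _ _ ps qs pq; move=> /seteqP[+ _] => /(_ (g p)); apply.
    by split; [exact: (gP p ps).1.1|rewrite gpq; exact: (gP q qs).1.1].
  rewrite -(size_map g) ; apply: uniq_leq_size; first by rewrite map_inj_in_uniq.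
  move=> _ /mapP[q qs ->]; rewrite in_fset_set// inE.
  by have [[]] := gP q qs.
Qed.

Variable N : nat.
Hypothesis zerosN : forall t, exists2 s : seq (R * R), (size s <= N)%N &
  forall z, zeros t z -> z \in s.

Let finite_zeros t : finite_set (zeros t).
Proof.
have [s _ sP] := zerosN t.
by apply: (@sub_finite_set _ _ [set` s]) => [z /sP//|]; exact: finite_seq.
Qed.

Let finite_zerosI B t : finite_set (B `&` zeros t).
Proof. by apply: sub_finite_set (finite_zeros t) => z []. Qed.

Let card_zeros B t : (#|` fset_set (B `&` zeros t)| <= N)%N.
Proof.
have [s sN sP] := zerosN t; apply: leq_trans sN.
apply: uniq_leq_size; first exact: fset_uniq.
by move=> z; rewrite in_fset_set// inE => -[_ /sP].
Qed.

Let countingE B t : counting (B `&` zeros t) =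
  (#|` fset_set (B `&` zeros t)|%:R : R)%:E.
Proof. by rewrite /counting asboolT. Qed.

(** The count is at most N, so it is the sum over i < N of the indicators that it is at least i +
    1. *)
Let measurable_count_hit B :
  (forall q, measurable [set t | qrect q `&` B `&` zeros t !=set0]) ->
  measurable_fun setT (fun t => counting (B `&` zeros t) : \bar R).
Proof.
move=> mB.
pose E i := [set t | (i.+1 <= #|` fset_set (B `&` zeros t)|)%N].
rewrite (_ : (fun t => _) = fun t => ((\sum_(i < N) \1_(E i) t)%:E)).
  apply/measurable_EFinP; apply: measurable_sum => i.
  by apply: measurable_indic; exact: measurable_count_ge.
apply/funext => t; rewrite countingE; congr (_%:E).
rewrite (eq_bigr (fun i : 'I_N => (i < #|` fset_set (B `&` zeros t)|)%N%:R)); last first.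
  by move=> i _; rewrite indicE; congr (_%:R); congr nat_of_bool; apply/idP/idP; rewrite inE.
rewrite -natr_sum; congr (_%:R).
by rewrite -big_mkcond -(big_ord_widen N (fun=> 1%N))// sum1_card card_ord.
Qed.

Let measurable_zeros t : measurable (zeros t).
Proof.
rewrite (_ : zeros t = \bigcup_(z in zeros t) ([set z.1] `*` [set z.2])).
  apply: fin_bigcup_measurable => // z _; exact: measurableX.
apply/seteqP; split => [z zt|z [w wt [/= h1 h2]]]; first by exists z.
by rewrite [z]surjective_pairing h1 h2 -surjective_pairing.
Qed.

(** Dynkin induction on B. Complements are handled by subtracting from the total number of zeros,
    which is possible because the counts are finite. *)
Let measurable_counting B : measurable B ->
  measurable_fun setT (fun t => counting (B `&` zeros t) : \bar R).
Proof.
rewrite measurable_plane_generator; move: B.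
have countT : measurable_fun setT (fun t => counting (zeros t) : \bar R).
  under eq_fun do rewrite -[zeros _]setTI.
  apply: measurable_count_hit => q; rewrite setIT.
  exact: measurable_hit_rect.
apply: (dynkin_induction measurable_plane_generator).
- move=> _ _ [z _ <-] [w _ <-]; rewrite quadrantI.
  by exists (Num.max z.1 w.1, Num.max z.2 w.2).
- by under eq_fun do rewrite setTI.
- move=> _ [z _ <-]; apply: measurable_count_hit => q.
  rewrite (_ : qrect q `&` quadrant z = rect (Num.max (ratr q.1.1) z.1, Num.max (ratr q.1.2) z.2) (ratr q.2.1, ratr q.2.2)).
    exact: measurable_hit_rect.
  apply/seteqP; split => w; rewrite /qrect /=.
    move=> [/rectP[/= /andP[a1 b1] /andP[a2 b2]] [c1 c2]]; apply/rectP.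
    by rewrite /= !ge_max a1 a2 b1 b2 c1 c2.
  move=> /rectP/=; rewrite !ge_max => -[/andP[/andP[a1 c1] b1] /andP[/andP[a2 c2] b2]].
  by split; [apply/rectP; rewrite /= a1 a2 b1 b2|].
- move=> S mS mSc.
  rewrite (_ : (fun t => _) = (fun t => counting (zeros t) - counting (S `&` zeros t)))%E; last first.
    apply/funext => t; have := measureDI (counting : {measure set _ -> \bar R}) (measurable_zeros t) mS.
    move=> /= ->; rewrite [zeros t `&` S]setIC addeK; last by rewrite countingE.
    by rewrite setDE setIC.
  by apply: emeasurable_funB.
- move=> F mF tF H.
  rewrite (_ : (fun t => _) = (fun t => \sum_(i <oo) counting (F i `&` zeros t)))%E.
    by apply: ge0_emeasurable_sum.
  apply/funext => t; rewrite setI_bigcupl measure_bigcup//=.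
  - by apply: eq_eseriesl => i; rewrite in_setT.
  - by move=> i _; exact: measurableI.
  - exact: trivIset_setIr.
Qed.

Let zkernel (t : Th) : {measure set (R * R) -> \bar R} :=
  mrestr counting (measurable_zeros t).

Let measurable_zkernel B : measurable B -> measurable_fun setT (zkernel ^~ B).
Proof. by move=> mB; exact: measurable_counting. Qed.

Let zkernel_uub : measure_fam_uub zkernel.
Proof.
(* The uniform bound of a finite kernel is strict, hence N + 1. *)
exists N.+1%:R => t; rewrite /zkernel/= /mrestr countingE lte_fin ltr_nat ltnS.
exact: card_zeros.
Qed.

(** As a kernel, the counting measure of the zeros can be integrated against functions that depend
    on the parameter too, with a result that is measurable in the parameter. *)
Lemma zero_kernel_ex : exists k : R.-fker Th ~> (R * R)%type,
  forall t B, k t B = counting (B `&` [set z | phi t z = 0]).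
Proof.
pose k1 := isKernel.Build _ _ Th (R * R)%type R zkernel measurable_zkernel.
pose k2 : R.-ker Th ~> (R * R)%type := HB.pack zkernel k1.
pose k3 := Kernel_isFinite.Build _ _ Th (R * R)%type R k2 zkernel_uub.
pose k4 : R.-fker Th ~> (R * R)%type := HB.pack (Kernel.sort k2) k3.
by exists k4.
Qed.

End zero_kernel.

(** * Integrating the zeros over the parameter *)

Section mixture.
Context d d' (Th : measurableType d) (Z : measurableType d') (R : realType).
Variable mu : {sfinite_measure set Th -> \bar R}.

Let cst_kernel (m : {measure set Th -> \bar R}) (_ : unit) := m.

Let cst_kernel_measurable m U : measurable U ->
  measurable_fun setT (cst_kernel m ^~ U).
Proof. by move=> mU; exact: measurable_cst. Qed.

Let cst_kernel_finite (m : {finite_measure set Th -> \bar R}) :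
  measure_fam_uub (cst_kernel m).
Proof.
have fm : m setT \is a fin_num by rewrite fin_num_measure.
by exists (fine (m setT) + 1) => u; rewrite /cst_kernel EFinD fineK// lteDl.
Qed.

(** The constant kernel inherits from [mu] its decomposition into countably many finite measures. *)
Let cst_kernel_sfinite : exists k : R.-sfker unit ~> Th, forall u, k u = mu.
Proof.
pose s n : R.-fker unit ~> Th :=
  let k1 := isKernel.Build _ _ unit Th R (cst_kernel (sfinite_measure_seq mu n))
    (cst_kernel_measurable (sfinite_measure_seq mu n)) in
  let k2 : R.-ker unit ~> Th := HB.pack (cst_kernel (sfinite_measure_seq mu n)) k1 in
  let k3 := Kernel_isFinite.Build _ _ unit Th R k2
    (cst_kernel_finite (sfinite_measure_seq mu n)) in
  HB.pack (Kernel.sort k2) k3.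
pose k1 := isKernel.Build _ _ unit Th R (cst_kernel mu) (cst_kernel_measurable mu).
pose k2 : R.-ker unit ~> Th := HB.pack (cst_kernel mu) k1.
have h : exists s : (R.-fker unit ~> Th)^nat,
    forall x U, measurable U -> k2 x U = kseries s x U.
  by exists s => x U mU; exact: sfinite_measure_seqP.
pose k3 := Kernel_isSFinite.Build _ _ unit Th R k2 h.
pose k4 : R.-sfker unit ~> Th := HB.pack (Kernel.sort k2) k3.
by exists k4.
Qed.

(** The mixture is the composition of the constant kernel [mu], issued from the one-point space,
    with k; the second property is the integration formula for composed kernels. *)
Lemma mixture_ex (k : R.-sfker (unit * Th)%type ~> Z) :
  exists nu : {measure set Z -> \bar R},
    (forall B, nu B = \int[mu]_t k (tt, t) B)%E /\
    (forall f : Z -> \bar R, (forall z, (0 <= f z)%E) -> measurable_fun setT f ->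
      \int[nu]_z f z = \int[mu]_t \int[k (tt, t)]_z f z)%E.
Proof.
have [l lE] := cst_kernel_sfinite.
exists (mkcomp l k tt); split => [B|f f0 mf].
  by rewrite /= /kcomp lE.
by rewrite integral_kcomp// lE.
Qed.

End mixture.

Section zero_sum.
Context {R : realType}.
Local Notation Z := (R * R)%type.
Local Notation mu := (@lebesgue_measure R).

(** An integral against [counting], so that convergence and measurability come from integration
    theory. *)
Definition zsum (S : set Z) (F : Z -> \bar R) : \bar R :=
  (\int[counting]_(z in S) F z)%E.

Lemma eq_zsum S F F' : (forall z, S z -> F z = F' z) -> zsum S F = zsum S F'.
Proof. by move=> FF'; apply: eq_integral => z /[!inE] /FF'. Qed.

Lemma zsum_ge0 S F : (forall z, S z -> (0 <= F z)%E) -> (0 <= zsum S F)%E.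
Proof. by move=> F0; exact: integral_ge0. Qed.

Lemma measurable_point (z : Z) : measurable [set z].
Proof.
rewrite (_ : [set z] = [set z.1] `*` [set z.2]); first exact: measurableX.
by apply/seteqP; split => [_ ->//|[w1 w2] [/= -> ->]]; rewrite -surjective_pairing.
Qed.

Lemma zsum1 p F : zsum [set p] F = F p.
Proof.
have mp := measurable_point p.
rewrite /zsum (@eq_integral _ _ _ _ _ (cst (F p))); last by move=> z /[!inE] ->.
rewrite integral_cst//= /counting asboolT//.
by rewrite fset_set1 finmap.cardfs1 mule1.
Qed.

Lemma zsum0 F : zsum set0 F = 0%E.
Proof. exact: integral_set0. Qed.

(** k has no mass outside S and coincides with [counting] on the measurable subsets of S. *)
Lemma kernel_zsum (k : {measure set Z -> \bar R}) (S : set Z) (F : Z -> \bar R) :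
  measurable S -> (forall B, k B = counting (B `&` S)) ->
  (forall z, (0 <= F z)%E) -> measurable_fun setT F ->
  (\int[k]_z F z = zsum S F)%E.
Proof.
move=> mS kE F0 mF.
rewrite -(setvU S) ge0_integral_setU//; first last.
- by rewrite disj_set2E setICl.
- by rewrite setvU.
- exact: measurableC.
rewrite [X in (X + _)%E](_ : _ = 0%E) ?add0e; last first.
  apply: null_set_integral => //; first exact: measurableC.
    exact: measurable_funTS.
  by rewrite kE setICl /counting asboolT// fset_set0.
by apply: eq_measure_integral => A mA AS; rewrite kE setIidl.
Qed.

Section family.
Context d (Th : measurableType d) (phi : Th -> Z -> R) (N : nat).
Hypotheses (mphi : forall z, measurable_fun setT (phi ^~ z))
  (cphi : forall t, continuous (phi t)).
Hypothesis phiN : forall t, exists2 s : seq Z, (size s <= N)%N &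
  forall z, phi t z = 0 -> z \in s.

Let zeros t := [set z | phi t z = 0].

Lemma measurable_zeros t : measurable (zeros t).
Proof.
have [s _ sP] := phiN t.
have fz : finite_set (zeros t).
  by apply: (@sub_finite_set _ _ [set` s]) => [z /sP//|]; exact: finite_seq.
rewrite (_ : zeros t = \bigcup_(z in zeros t) [set z]).
  by apply: fin_bigcup_measurable => // z _; exact: measurable_point.
by apply/seteqP; split => [z zt|z [w wt ->//]]; exists z.
Qed.

Lemma measurable_zsum (F : Th * Z -> \bar R) : (forall q, (0 <= F q)%E) ->
  measurable_fun setT F -> measurable_fun setT (fun t => zsum (zeros t) (fun z => F (t, z))).
Proof.
move=> F0 mF; have [k kE] := zero_kernel_ex mphi cphi phiN.
rewrite (_ : (fun t => _) = fun t => \int[k t]_z F (t, z))%E.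
  exact: measurable_fun_integral_finite_kernel.
apply/funext => t; apply/esym/kernel_zsum => //; first exact: measurable_zeros.
by apply: measurableT_comp => //; exact: pair1_measurable.
Qed.

(** m is the intensity measure of the zeros when the parameter is distributed according to [nu]:
    sums over zeros, integrated over the parameter, become integrals over the plane. *)
Lemma zero_mixture_ex (nu : {sfinite_measure set Th -> \bar R}) :
  exists m : {measure set Z -> \bar R},
    (forall B, m B = \int[nu]_t counting (B `&` zeros t))%E /\
    (forall f : Z -> \bar R, (forall z, (0 <= f z)%E) -> measurable_fun setT f ->
      \int[m]_z f z = \int[nu]_t zsum (zeros t) f)%E.
Proof.
pose phi' (q : unit * Th) := phi q.2.
have [|||k kE] := @zero_kernel_ex _ (unit * Th)%type R phi' _ _ N.
- by move=> z; exact: (measurableT_comp (mphi z) measurable_snd).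
- by move=> q; exact: cphi.
- by move=> q; exact: phiN.
have [m [m1 m2]] := mixture_ex nu k.
exists m; split => [B|f f0 mf].
  by rewrite m1; apply: eq_integral => t _; rewrite kE.
rewrite m2//; apply: eq_integral => t _; apply: kernel_zsum => //.
  exact: measurable_zeros.
by move=> B; rewrite kE.
Qed.

End family.
End zero_sum.

Section curve_sum.
Context {R : realType}.
Local Notation Z := (R * R)%type.
Local Notation mu := (@lebesgue_measure R).

Lemma mixture_injective (p : R -> Z -> R) (N : nat) (G : set Z) (a : Z -> R)
    (m : {measure set Z -> \bar R}) :
  (forall z, measurable_fun setT (p ^~ z)) -> (forall t, continuous (p t)) ->
  (forall t, exists2 s : seq Z, (size s <= N)%N & forall z, p t z = 0 -> z \in s) ->
  (forall z t, G z -> p t z = 0 <-> a z = t) ->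
  (forall B, m B = \int[mu]_t counting (B `&` [set z | p t z = 0%R]))%E ->
  forall B, measurable B -> B `<=` G -> set_inj B a -> m B = mu (a @` B).
Proof.
move=> mp cp pN pG mE B mB BG aB.
have cE t : counting (B `&` [set z | p t z = 0]) = (\1_(a @` B) t)%:E :> \bar R.
  rewrite indicE; case: (boolP (t \in a @` B)) => [/[!inE] -[z Bz azt]|/negP tB].
    rewrite (_ : B `&` _ = [set z]).
      by rewrite /counting asboolT// fset_set1 finmap.cardfs1.
    apply/seteqP; split => [w [Bw /= pw]|_ -> /=].
      by apply: aB; rewrite ?inE// azt; apply/pG => //; exact: BG.
    by split => //; apply/pG => //; exact: BG.
  rewrite (_ : B `&` _ = set0).
    by rewrite /counting asboolT// fset_set0.
  rewrite -subset0 => w [Bw /= pw]; apply: tB; rewrite inE; exists w => //.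
  by apply/pG => //; exact: BG.
(* The image of the Borel set B is Borel since it is the set of parameters at which the number of
   zeros in B equals 1, and this number is measurable. *)
have maB : measurable (a @` B).
  have [k kE] := zero_kernel_ex mp cp pN.
  have mk : measurable_fun setT (fun t => k t B) by exact: measurable_kernel.
  have := mk measurableT [set 1%E] (emeasurable_set1 1%E).
  rewrite setTI; congr measurable; apply/seteqP; split => t /=.
    rewrite kE cE indicE; case: (boolP (t \in a @` B)) => [/[!inE]//|_] [] /eqP.
    by rewrite eq_sym oner_eq0.
  by move=> tB; rewrite kE cE indicE mem_set.
rewrite mE; under eq_integral do rewrite cE.
by rewrite integral_indic// setIT.
Qed.

Variables (pa pb : R -> Z -> R) (N : nat) (G : set Z) (a b D : Z -> R).
Hypotheses (mpa : forall z, measurable_fun setT (pa ^~ z))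
  (cpa : forall t, continuous (pa t))
  (paN : forall t, exists2 s : seq Z, (size s <= N)%N & forall z, pa t z = 0 -> z \in s)
  (paG : forall z t, G z -> pa t z = 0 <-> a z = t).
Hypotheses (mpb : forall z, measurable_fun setT (pb ^~ z))
  (cpb : forall t, continuous (pb t))
  (pbN : forall t, exists2 s : seq Z, (size s <= N)%N & forall z, pb t z = 0 -> z \in s)
  (pbG : forall z t, G z -> pb t z = 0 <-> b z = t).
Hypotheses (mG : measurable G) (mD : measurable_fun G D).
Hypothesis D0 : forall z, G z -> 0 < D z.
Hypothesis abD : forall z0, G z0 -> forall c1 c2, 0 < c1 < D z0 -> D z0 < c2 ->
  exists2 r, 0 < r & forall z w, G z -> G w -> square z0 r z -> square z0 r w ->
   [/\ a z = a w -> z = w, c1 * `|a z - a w| <= `|b z - b w|,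
    `|b z - b w| <= c2 * `|a z - a w|, c1 <= D z & D z <= c2].

(** Both sides are integrals over G against the two intensity measures, and [curve_measure] says
    that D is the density of one with respect to the other. All the one-dimensional changes of
    variables are instances of this formula. *)
Lemma curve_zsum (f : Z -> \bar R) :
  (forall z, (0 <= f z)%E) -> measurable_fun setT f ->
  (\int[mu]_t zsum [set z | pb t z = 0%R] (f \_ G) =
   \int[mu]_t zsum [set z | pa t z = 0%R] ((fun z => (D z)%:E * f z) \_ G))%E.
Proof.
move=> f0 mf.
have [n1 [n1E n1f]] := zero_mixture_ex (Th := measurableTypeR R) mpb cpb pbN mu.
have [n2 [n2E n2f]] := zero_mixture_ex (Th := measurableTypeR R) mpa cpa paN mu.
have mfG : measurable_fun G f by exact: measurable_funTS.
have mDf : measurable_fun G (fun z => (D z)%:E * f z)%E.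
  by apply: emeasurable_funM => //; exact/measurable_EFinP.
rewrite -n1f; first last.
- by apply/(measurable_restrictT _ mG).
- by move=> z; rewrite patchE; case: ifPn.
rewrite -n2f; first last.
- by apply/(measurable_restrictT _ mG).
- move=> z; rewrite patchE; case: ifPn => // /[!inE] Gz.
  by rewrite mule_ge0// lee_fin ltW// D0.
rewrite -!integral_mkcond; apply: ge0_integral_density => //.
- by move=> z Gz; rewrite ltW// D0.
- move=> B mB BG; apply: (@curve_measure _ _ _ G a b D) => //.
  + exact: (mixture_injective mpb cpb pbN pbG n1E).
  + exact: (mixture_injective mpa cpa paN paG n2E).
Qed.

End curve_sum.

(** * Real polynomials on the complex plane *)

Section complex_facts.
Context {R : realType}.
Implicit Types (z w : R[i]) (a b : R).

Lemma normc_ge0 z : 0 <= normc z.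
Proof. by case: z => a b; exact: sqrtr_ge0. Qed.

Lemma normcR a : normc a%:C = `|a|.
Proof. by rewrite /normc/= expr0n/= addr0 sqrtr_sqr. Qed.

Lemma normc_eq0 z : (normc z == 0) = (z == 0).
Proof.
apply/eqP/eqP => [|->]; last exact: normc0.
by move/(@ComplexField.Normc.eq0_normc _ z).
Qed.

Lemma normc_sqr z : normc z ^+ 2 = complex.Re z ^+ 2 + complex.Im z ^+ 2.
Proof. by case: z => a b /=; rewrite sqr_sqrtr// addr_ge0// sqr_ge0. Qed.

Lemma normReIm z : normc z <= `|complex.Re z| + `|complex.Im z|.
Proof.
rewrite -(@ler_sqr _ (normc z)) ?nnegrE ?normc_ge0 ?addr_ge0// normc_sqr sqrrD.
by rewrite !real_normK ?num_real// lerD2r lerDl mulrn_wge0// mulr_ge0.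
Qed.

Lemma normRe z : `|complex.Re z| <= normc z.
Proof.
rewrite -ler_sqr ?nnegrE ?normc_ge0// normc_sqr real_normK ?num_real//.
by rewrite lerDl sqr_ge0.
Qed.

Lemma normIm z : `|complex.Im z| <= normc z.
Proof.
rewrite -ler_sqr ?nnegrE ?normc_ge0// normc_sqr real_normK ?num_real//.
by rewrite lerDr sqr_ge0.
Qed.

Lemma cReD z w : complex.Re (z + w) = complex.Re z + complex.Re w.
Proof. by case: z; case: w. Qed.
Lemma cImD z w : complex.Im (z + w) = complex.Im z + complex.Im w.
Proof. by case: z; case: w. Qed.
Lemma cReN z : complex.Re (- z) = - complex.Re z.
Proof. by case: z. Qed.
Lemma cImN z : complex.Im (- z) = - complex.Im z.
Proof. by case: z. Qed.
Lemma cReM z w : complex.Re (z * w) =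
  complex.Re z * complex.Re w - complex.Im z * complex.Im w.
Proof. by case: z; case: w. Qed.
Lemma cImM z w : complex.Im (z * w) =
  complex.Re z * complex.Im w + complex.Im z * complex.Re w.
Proof. by case: z => a b; case: w => c d /=; rewrite [b * c]mulrC. Qed.

Lemma normcB z w : normc (z - w) = normc (w - z).
Proof.
by case: z => a b; case: w => c d; rewrite /normc/= -(sqrrN (a - c)) -(sqrrN (b - d)) !opprB.
Qed.

(** Both z and w move near z0: the local comparison of two parameters concerns increments between
    arbitrary points of a square, so differentiability at z0 alone would not do. *)
Lemma poly_strict_diff (p : {poly R[i]}) (z0 : R[i]) :
  exists2 M : R, 0 <= M & forall z w, normc (z - z0) <= 1 -> normc (w - z0) <= 1 ->
    normc (p.[z] - p.[w] - p^`().[z0] * (z - w)) <=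
      M * (normc (z - z0) + normc (w - z0)) * normc (z - w).
Proof.
elim/poly_ind: p => [|p c [M M0 IH]].
  exists 0 => // z w _ _; rewrite deriv0 !horner0 mul0r !subr0 normc0.
  by rewrite !mul0r.
pose d := normc (p^`().[z0]).
have d0 : 0 <= d by exact: normc_ge0.
(* The summands correspond to the three terms of the identity below: |z| <= |z0| + 1 times the
   remainder of p, then z - z0 times its linear part, then p(w) - p(z0), which is at most (2 M + d)
   |w - z0|. *)
pose M' := (normc z0 + 1) * M + d + (M * 2 + d).
exists M'.
  by rewrite !addr_ge0// ?mulr_ge0// ?addr_ge0// normc_ge0.
move=> z w zz0 wz0; rewrite derivMXaddC !hornerE.
set pz := p.[z]; set pw := p.[w]; set p0 := p.[z0]; set d1 := p^`().[z0].
have -> : pz * z + c - (pw * w + c) - (p0 + d1 * z0) * (z - w) =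
  z * (pz - pw - d1 * (z - w)) + (z - z0) * (d1 * (z - w)) + (pw - p0) * (z - w) by ring.
have h1 := IH z w zz0 wz0.
have h2 := IH w z0 wz0; rewrite subrr normc0 addr0 in h2.
have {}h2 : normc (pw - p0) <= (M * 2 + d) * normc (w - z0).
  have -> : pw - p0 = (pw - p0 - d1 * (w - z0)) + d1 * (w - z0) by ring.
  apply: le_trans (le_normcD _ _) _; rewrite [X in _ <= X]mulrDl normcM lerD2r.
  apply: le_trans (h2 ler01) _; rewrite -[X in _ <= X]mulrA -[X in X <= _]mulrA ler_wpM2l//.
  apply: ler_wpM2r; first exact: normc_ge0.
  lra.
have hz : normc z <= normc z0 + 1.
  rewrite -(subrK z0 z) addrC; apply: le_trans (le_normcD _ _) _.
  by rewrite lerD2l.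
have nzw := normc_ge0 (z - w); have nz := normc_ge0 (z - z0); have nw := normc_ge0 (w - z0).
apply: le_trans (le_normcD _ _) _.
apply: le_trans (lerD (le_normcD _ _) (lexx _)) _.
rewrite !normcM -/d.
have e1 : normc z * normc (pz - pw - d1 * (z - w)) <=
    (normc z0 + 1) * (M * (normc (z - z0) + normc (w - z0)) * normc (z - w)).
  by apply: ler_pM => //; exact: normc_ge0.
have e2 : normc (pw - p0) * normc (z - w) <= (M * 2 + d) * normc (w - z0) * normc (z - w).
  by rewrite ler_wpM2r.
have e3 : 0 <= d * normc (w - z0) * normc (z - w) by rewrite !mulr_ge0.
have e4 : 0 <= (M * 2 + d) * normc (z - z0) * normc (z - w) by rewrite !mulr_ge0// addr_ge0// mulr_ge0.
apply: le_trans (lerD (lerD e1 (lexx _)) e2) _.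
rewrite -subr_ge0; have := addr_ge0 e3 e4; congr (0 <= _).
by rewrite /M'; ring.
Qed.

Lemma poly_roots_seq (F : idomainType) (p : {poly F}) : p != 0 ->
  exists2 s : seq F, (size s < size p)%N & forall x, root p x -> x \in s.
Proof.
elim: (size p) {-2}p (leqnn (size p)) => [|m IH] {}p pm p0.
  by move: pm; rewrite leqn0 size_poly_eq0 (negbTE p0).
have [[x /factor_theorem[q pE]]|nx] := pselect (exists x, root p x); last first.
  exists [::]; first by rewrite lt0n size_poly_eq0.
  by move=> x rx; exfalso; apply: nx; exists x.
have q0 : q != 0 by apply: contra p0 => /eqP q0; rewrite pE q0 mul0r.
have sp : size p = (size q).+1.
  by rewrite pE size_Mmonic ?monicXsubC// size_XsubC addn2.
have [|s sq sP] := IH q _ q0; first by rewrite -ltnS -sp.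
exists (x :: s); first by rewrite /= sp ltnS.
move=> y; rewrite pE rootM root_XsubC inE => /orP[/sP ->|->//].
by rewrite orbT.
Qed.

End complex_facts.

Section real_poly.
Context {R : realType}.
Implicit Types (K p : {poly R}) (z w : R * R).

(* Points of the complex plane are handled as pairs of reals, since R * R carries the topology
   and the sigma-algebra of the library. *)
Definition ev K z : R[i] := (map_poly (real_complex R) K).[complex_of_pair z].

Lemma ev_real K x : ev K (x, 0) = (K.[x])%:C.
Proof. exact: horner_map. Qed.

Lemma evMXaddC K c z : ev (K * 'X + c%:P) z = ev K z * complex_of_pair z + c%:C.
Proof. by rewrite /ev rmorphD rmorphM/= map_polyX map_polyC hornerMXaddC. Qed.

Lemma ev0 z : ev 0 z = 0.
Proof. by rewrite /ev rmorph0 horner0. Qed.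

Lemma evD K p z : ev (K + p) z = ev K z + ev p z.
Proof. by rewrite /ev rmorphD hornerD. Qed.

Lemma evM K p z : ev (K * p) z = ev K z * ev p z.
Proof. by rewrite /ev rmorphM hornerM. Qed.

Lemma evC c z : ev c%:P z = c%:C.
Proof. by rewrite /ev map_polyC hornerC. Qed.

Lemma evX z : ev 'X z = complex_of_pair z.
Proof. by rewrite /ev map_polyX hornerX. Qed.

Definition reK K z := complex.Re (ev K z).
Definition imK K z := complex.Im (ev K z).

Lemma reKS K c z : reK (K * 'X + c%:P) z = reK K z * z.1 - imK K z * z.2 + c.
Proof. by rewrite /reK /imK evMXaddC cReD cReM. Qed.

Lemma imKS K c z : imK (K * 'X + c%:P) z = reK K z * z.2 + imK K z * z.1.
Proof. by rewrite /reK /imK evMXaddC cImD cImM addr0. Qed.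

Lemma continuous_reim K : continuous (reK K) /\ continuous (imK K).
Proof.
have c1 : continuous (fst : R * R -> R) by move=> z; exact: cvg_fst.
have c2 : continuous (snd : R * R -> R) by move=> z; exact: cvg_snd.
elim/poly_ind: K => [|K c [IH1 IH2]].
  split; rewrite /reK /imK.
    by rewrite (_ : (fun z => _) = cst 0); [move=> z; exact: cvg_cst|apply/funext => z; rewrite ev0].
  by rewrite (_ : (fun z => _) = cst 0); [move=> z; exact: cvg_cst|apply/funext => z; rewrite ev0].
split.
- rewrite (_ : reK _ = fun z => reK K z * z.1 - imK K z * z.2 + c); last first.
    by apply/funext => z; rewrite reKS.
  move=> z; apply: cvgD; last exact: cvg_cst.
  by apply: cvgB; apply: cvgM; [exact: IH1|exact: c1|exact: IH2|exact: c2].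
- rewrite (_ : imK _ = fun z => reK K z * z.2 + imK K z * z.1); last first.
    by apply/funext => z; rewrite imKS.
  move=> z; apply: cvgD; apply: cvgM; [exact: IH1|exact: c2|exact: IH2|exact: c1].
Qed.

Lemma square_le (z : R * R) (r s : R) : r <= s -> square z r `<=` square z s.
Proof. by move=> rs w [h1 h2]; split; apply: lt_le_trans rs. Qed.

Lemma cop_sub z w : complex_of_pair z - complex_of_pair w =
  (z.1 - w.1) +i* (z.2 - w.2).
Proof. by []. Qed.

Lemma ev_strict_diff K z0 (e : R) : 0 < e -> exists2 r, 0 < r &
  forall z w, square z0 r z -> square z0 r w ->
  normc (ev K z - ev K w - ev K^`() z0 * (complex_of_pair z - complex_of_pair w)) <=
    e * normc (complex_of_pair z - complex_of_pair w).
Proof.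
move=> e0; rewrite /ev -deriv_map.
have [M M0 H] := poly_strict_diff (map_poly (real_complex R) K) (complex_of_pair z0).
have M1 : 0 < M + 1 by rewrite ltr_wpDl.
(* Points of the square of radius r are within 2 r of z0: at most 1 by the first bound, while two
   such distances add up to at most 4 r, which the second bound compares with e. *)
pose r := Num.min (1 / 2) (e / (4 * (M + 1))).
have r0 : 0 < r by rewrite lt_min !divr_gt0// mulr_gt0.
have r1 : r <= 1 / 2 by rewrite ge_min lexx.
have rM : r * (4 * (M + 1)) <= e.
  by rewrite -ler_pdivlMr ?mulr_gt0// ge_min lexx orbT.
have hz z : square z0 r z -> normc (complex_of_pair z - complex_of_pair z0) <= 2 * r.
  move=> [h1 h2]; rewrite cop_sub; apply: le_trans (normReIm _) _ => /=.
  by apply: le_trans (lerD (ltW h1) (ltW h2)) _; lra.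
exists r => // z w /hz zz /hz ww.
apply: le_trans (H _ _ _ _) _; [lra|lra|].
apply: ler_wpM2r; first exact: normc_ge0.
have := normc_ge0 (complex_of_pair z - complex_of_pair z0).
have := normc_ge0 (complex_of_pair w - complex_of_pair z0).
nra.
Qed.

Lemma continuous_between (D : R * R -> R) z0 (c1 c2 : R) :
  {for z0, continuous D} -> c1 < D z0 -> D z0 < c2 ->
  exists2 r, 0 < r & forall z, square z0 r z -> c1 <= D z /\ D z <= c2.
Proof.
move=> cD c1D Dc2; pose e := Num.min (D z0 - c1) (c2 - D z0).
have e0 : 0 < e by rewrite lt_min !subr_gt0 c1D.
have /cvgrPdist_lt/(_ e e0)/nbhs_ballP[r r0 H] := cD.
exists r => // w [w1 w2].
have : `|D z0 - D w| < e by apply: H; split; rewrite /ball/= distrC.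
rewrite lt_min !ltr_norml => /andP[/andP[h1 h2] /andP[h3 h4]]; split; lra.
Qed.

End real_poly.

Section plane_polynomials.
Context {R : realType}.
Local Notation mu := (@lebesgue_measure R).
Implicit Types (K p H : {poly R}) (z w : R * R).

(** For p of degree m with leading coefficient a, the expansion of a (x + i y)^m has the imaginary
    part m a y x^(m-1) + ..., with lower powers of x omitted. If y and m are nonzero, Im p is thus a
    nonzero polynomial in x on the line of height y and has finitely many zeros there. *)
Lemma re_im_line p (y : R) : exists q1 q2 : {poly R},
  [/\ (size q1 <= size p)%N /\ (size q2 <= size p)%N,
   forall x, reK p (x, y) = q1.[x], forall x, imK p (x, y) = q2.[x],
   q1`_(size p).-1 = lead_coef p &
   q2`_(size p).-2 = (size p).-1%:R * lead_coef p * y].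
Proof.
elim/poly_ind: p => [|r c [q1 [q2 [[s1 s2] e1 e2 l1 l2]]]].
  exists 0, 0; rewrite size_poly0; split => //; rewrite ?coef0 ?lead_coef0 ?mulr0 ?mul0r//.
  - by move=> x; rewrite /reK ev0 horner0.
  - by move=> x; rewrite /imK ev0 horner0.
have [->|r0] := eqVneq r 0.
  rewrite mul0r add0r; exists c%:P, 0; rewrite size_poly0; split => //.
  - by move=> x; rewrite /reK evC hornerC.
  - by move=> x; rewrite /imK evC horner0.
  - by rewrite coef0 size_polyC; case: (c != 0); rewrite /= !mul0r.
have sp : size (r * 'X + c%:P) = (size r).+1.
  by rewrite size_MXaddC (negbTE r0).
have lp : lead_coef (r * 'X + c%:P) = lead_coef r.
  rewrite lead_coefDl ?lead_coefMX// size_polyC size_mulX//.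
  by apply: leq_ltn_trans (leq_b1 _) _; rewrite ltnS lt0n size_poly_eq0.
have sr0 : (0 < size r)%N by rewrite lt0n size_poly_eq0.
exists (q1 * 'X - y *: q2 + c%:P), (q2 * 'X + y *: q1); rewrite sp lp; split.
- have sX (q : {poly R}) : (size q <= size r)%N -> (size (q * 'X)%R <= (size r).+1)%N.
    move=> h; apply: leq_trans (size_polyMleq _ _) _.
    by rewrite size_polyX addn2/= ltnS.
  split.
    apply: leq_trans (size_polyD _ _) _; rewrite geq_max; apply/andP; split.
      apply: leq_trans (size_polyD _ _) _; rewrite geq_max sX//= size_polyN.
      by apply: leq_trans (size_scale_leq _ _) _; exact: leqW.
    by rewrite size_polyC; apply: leq_trans (leq_b1 _) _.
  apply: leq_trans (size_polyD _ _) _; rewrite geq_max sX//=.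
  by apply: leq_trans (size_scale_leq _ _) _; exact: leqW.
- by move=> x; rewrite reKS e1 e2 !hornerE/=; ring.
- by move=> x; rewrite imKS e1 e2 !hornerE/=; ring.
- rewrite /= !coefD coefN coefZ coefMX coefC.
  rewrite (gtn_eqF sr0)/= l1 (nth_default _ s2) mulr0 subr0 addr0//.
- rewrite /= coefD coefMX coefZ l1.
  case: (posnP (size r).-1) => [r1|r1].
    have -> : size r = 1%N by rewrite -(prednK sr0) r1.
    by rewrite /= add0r mul1r mulrC.
  rewrite l2 -[in RHS](prednK sr0) -natr1; ring.
Qed.

Lemma imK_line_roots p (y : R) : y != 0 -> (1 < size p)%N ->
  exists2 s : seq R, (size s < size p)%N & forall x, imK p (x, y) = 0 -> x \in s.
Proof.
move=> y0 sp; have [q1 [q2 [[_ s2] _ e2 _ l2]]] := re_im_line p y.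
have q20 : q2 != 0.
  apply/eqP => q20; move: l2; rewrite q20 coef0 => /esym/eqP.
  rewrite !mulf_eq0 (negbTE y0) lead_coef_eq0 orbF -size_poly_eq0 gtn_eqF//.
    by rewrite pnatr_eq0 orbF -subn1 subn_eq0 leqNgt sp.
  exact: ltn_trans sp.
have [s sq sP] := poly_roots_seq q20.
exists s; first exact: leq_trans sq s2.
by move=> x; rewrite e2 => /eqP; exact: sP.
Qed.

Lemma ev_eq0 p z : ev p z = 0 <-> reK p z = 0 /\ imK p z = 0.
Proof.
rewrite /reK /imK; case: (ev p z) => a b /=; split => [[]//|[-> ->]//].
Qed.

Lemma ev_roots p : p != 0 ->
  exists2 s : seq (R * R), (size s < size p)%N & forall z, ev p z = 0 -> z \in s.
Proof.
move=> p0; have pc0 : map_poly (real_complex R) p != 0 by rewrite map_poly_eq0.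
have [s sp sP] := poly_roots_seq pc0.
exists (map (@pair_of_complex R) s); first by rewrite size_map -(size_map_poly (real_complex R)).
move=> z /eqP /sP zs; apply/mapP; exists (complex_of_pair z) => //.
by rewrite complex_of_pairK.
Qed.

(** Each point is singled out by a rational square that contains no other point of S. *)
Lemma countable_isolated (S : set (R * R)) :
  (forall z, S z -> exists2 r, 0 < r & forall w, S w -> square z r w -> w = z) ->
  countable S.
Proof.
move=> H.
have ex z : exists q, S z -> rational_square q z /\ forall w, S w -> rational_square q w -> w = z.
  have [Sz|nSz] := pselect (S z); last by exists (0, 0, 0%N).
  have [r r0 Hr] := H z Sz; have [q [qz qr]] := rational_square_base z r0.
  by exists q => _; split => // w Sw /qr; exact: Hr.
pose f z := projT1 (cid (ex z)).
have fP z : S z -> rational_square (f z) z /\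
    forall w, S w -> rational_square (f z) w -> w = z.
  by rewrite /f; case: cid.
apply/countable_injP; exists (fun z => pickle (f z)).
move=> z w /[!inE] Sz Sw /(pcan_inj pickleK) fzw.
by apply: (fP w Sw).2 => //; rewrite -fzw; exact: (fP z Sz).1.
Qed.

Lemma size_deriv_real p : size p^`() = (size p).-1.
Proof.
have [->|p0] := eqVneq p 0; first by rewrite deriv0 size_poly0.
have [p1|p1] := leqP (size p) 1.
  by rewrite (size1_polyC p1) derivC size_poly0 size_polyC; case: eqP.
apply/eqP; rewrite eqn_leq -ltnS prednK ?size_poly_gt0// lt_size_deriv//=.
have : p^`()`_(size p).-2 != 0.
  rewrite coef_deriv -mulr_natr mulf_neq0//.
    rewrite (_ : (size p).-2.+1 = (size p).-1) ?lead_coef_eq0//.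
    by rewrite prednK// -subn1 subn_gt0.
apply: contraR; rewrite -ltnNge => h; apply/eqP/nth_default.
by rewrite -ltnS prednK// -subn1 subn_gt0.
Qed.

(* At such a point the curve Im K = 0 is horizontal; the first derivative
   of p having a nonreal value there isolates the point. *)
Lemma countable_real_values K p : (1 < size p)%N ->
  countable [set z | [/\ 0 < z.2, imK K z = 0, imK K^`() z = 0,
    reK K^`() z != 0 & imK p z = 0]].
Proof.
elim: (size p) {-2}p (leqnn (size p)) => [|m IH] {}p; first by rewrite leqn0 => /eqP ->.
move=> pm sp; have [sp2|sp2] := leqP (size p) 2.
  (* For p of degree 1 the imaginary part is the leading coefficient times y, which does not vanish
     for y > 0. *)
  rewrite (_ : mkset _ = set0)//; rewrite -subset0 => -[x y] [/= y0 _ _ _].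
  have [q1 [q2 [[_ s2] _ e2 _ l2]]] := re_im_line p y.
  have p2 : size p = 2%N by apply/eqP; rewrite eqn_leq sp2 sp.
  have -> : p = (p`_1)%:P * 'X + (p`_0)%:P.
    apply/polyP => i; rewrite coefD coefMX !coefC; case: i => [|[|i]]/=; rewrite ?add0r ?addr0//.
    by rewrite nth_default ?p2// addr0.
  rewrite imKS /reK /imK evC /= mul0r addr0 => /eqP; rewrite mulf_eq0 (gt_eqF y0) orbF.
  by have := lead_coef_eq0 p; rewrite lead_coefE p2/= => -> /eqP p0; rewrite p0 size_poly0 in p2.
(* Points at which p' is real as well are left to the induction; the others, in S2, are shown to be
   isolated. *)
pose S1 := [set z | [/\ 0 < z.2, imK K z = 0, imK K^`() z = 0,
  reK K^`() z != 0 & imK p^`() z = 0]].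
pose S2 := [set z | [/\ 0 < z.2, imK K z = 0, imK K^`() z = 0,
  reK K^`() z != 0 & imK p z = 0] /\ imK p^`() z != 0].
apply: (@sub_countable _ _ _ (\bigcup_b (if b then S1 else S2))).
  apply: subset_card_le => z [h1 h2 h3 h4 h5].
  by have [e|e] := eqVneq (imK p^`() z) 0; [exists true|exists false].
apply: bigcup_countable => // -[] _.
  apply: IH; rewrite size_deriv_real -ltnS prednK ?(ltnW sp)//.
apply: countable_isolated => z0 [[_ K0 K1 k0 p0] v0].
pose k := reK K^`() z0; pose u := reK p^`() z0; pose v := imK p^`() z0.
have v0' : 0 < `|v| by rewrite normr_gt0.
have k0' : 0 < `|k| by rewrite normr_gt0.
(* B is such that the two linear estimates below, with error e N for e = 1 / (2 B) and N = |w - z0|,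
   give |dx| + |dy| <= e B N = N / 2. Hence N <= N / 2 and N = 0. *)
pose B := (1 + `|u| / `|k|) / `|v| + `|k|^-1.
have B0 : 0 < B by rewrite addr_gt0 ?invr_gt0// divr_gt0// addr_gt0// ?divr_ge0.
have e0 : 0 < (2 * B)^-1 by rewrite invr_gt0 mulr_gt0.
have [r1 r10 H1] := ev_strict_diff K z0 e0.
have [r2 r20 H2] := ev_strict_diff p z0 e0.
exists (Num.min r1 r2); first by rewrite lt_min r10.
move=> w [[_ K0w _ _ p0w] _] wr.
have w1 : square z0 r1 w by apply: square_le wr; rewrite ge_min lexx.
have w2 : square z0 r2 w by apply: square_le wr; rewrite ge_min lexx orbT.
have c0 r : 0 < r -> square z0 r z0 by move=> ?; split; rewrite subrr normr0.
have {H1} := H1 _ _ w1 (c0 _ r10).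
have {H2} := H2 _ _ w2 (c0 _ r20).
rewrite cop_sub; set dx := w.1 - z0.1; set dy := w.2 - z0.2.
set n := normc _ => H2; set n1 := (X in X <= _); move=> H1.
(* K'(z0) = k is real, so k dy is the imaginary part of the linear approximation to K(w) - K(z0), a
   number that is itself real. *)
have h1 : `|k * dy| <= (2 * B)^-1 * normc (dx +i* dy).
  apply: le_trans H1; apply: le_trans (normIm _).
  rewrite !cImD !cImN cImM -/(imK K w) -/(imK K z0) K0w K0 -/(imK _ _) -/(reK _ _) K1 /= mul0r addr0 subr0 sub0r normrN.
  exact: lexx.
have h2 : `|u * dy + v * dx| <= (2 * B)^-1 * normc (dx +i* dy).
  apply: le_trans H2; apply: le_trans (normIm _).
  rewrite !cImD !cImN cImM -/(imK p w) -/(imK p z0) p0w p0 -/(imK _ _) -/(reK _ _) /= subr0 sub0r normrN.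
  exact: lexx.
set e := (2 * B)^-1 in h1 h2; set N := normc (dx +i* dy) in h1 h2.
have N0 : 0 <= N by exact: normc_ge0.
have g1 : `|dy| <= e * N / `|k| by rewrite ler_pdivlMr// mulrC -normrM.
have g2 : `|dx| <= e * N * (1 + `|u| / `|k|) / `|v|.
  rewrite ler_pdivlMr// mulrC -normrM.
  have -> : v * dx = (u * dy + v * dx) - u * dy by ring.
  have g3 : `|u * dy| <= e * N * (`|u| / `|k|).
    rewrite normrM (_ : _ * (_ / _) = `|u| * (e * N / `|k|)); last by ring.
    exact: ler_wpM2l.
  have -> : e * N * (1 + `|u| / `|k|) = e * N + e * N * (`|u| / `|k|) by ring.
  by apply: le_trans (ler_normB _ _) _; exact: lerD.
have NB : N <= e * B * N.
  apply: le_trans (normReIm _) _ => /=.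
  apply: le_trans (lerD g2 g1) _; rewrite le_eqVlt; apply/orP; left; apply/eqP.
  by rewrite /B; ring.
have eB : e * B = 2^-1.
  by rewrite /e invfM -mulrA mulVf ?mulr1// gt_eqF.
have N00 : N = 0 by rewrite eB in NB; lra.
have /eqP := N00; rewrite normc_eq0 eq_complex/= !subr_eq0 => /andP[/eqP h3 /eqP h4].
by rewrite [w]surjective_pairing h3 h4 -surjective_pairing.
Qed.

End plane_polynomials.

Section reim.
Context {R : realType}.
Implicit Types (p q : {poly R}) (z : R * R).

Lemma reKD p q z : reK (p + q) z = reK p z + reK q z.
Proof. by rewrite /reK evD cReD. Qed.
Lemma imKD p q z : imK (p + q) z = imK p z + imK q z.
Proof. by rewrite /imK evD cImD. Qed.
Lemma reKMX p z : reK (p * 'X) z = reK p z * z.1 - imK p z * z.2.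
Proof. by rewrite -[p * 'X]addr0 reKS addr0. Qed.
Lemma imKMX p z : imK (p * 'X) z = reK p z * z.2 + imK p z * z.1.
Proof. by rewrite -[p * 'X]addr0 imKS. Qed.
Lemma reKC c z : reK c%:P z = c.
Proof. by rewrite /reK evC. Qed.
Lemma imKC c z : imK c%:P z = 0.
Proof. by rewrite /imK evC. Qed.

Lemma measurable_invr : measurable_fun setT (fun x : R => x^-1).
Proof.
have := measurable_set1 (0 : R) => m0.
rewrite -(setvU [set 0 : R]); apply/measurable_funU => //; first exact: measurableC.
split.
  apply: open_continuous_measurable_fun.
    by apply: closed_openC; exact: closed_eq.
  by move=> x /[!inE] /eqP x0; exact: inv_continuous.
by apply: eq_measurable_fun (measurable_cst (0 : R)) => x /[!inE] ->; rewrite invr0.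
Qed.

(** Serves to write a pair of real equations as the vanishing of a single continuous function, as in
    the general results on zero sets. *)
Lemma normD_eq0 (x y : R) : `|x| + `|y| = 0 <-> x = 0 /\ y = 0.
Proof.
split=> [/eqP|[-> ->]]; last by rewrite normr0 addr0.
by rewrite paddr_eq0// !normr_eq0 => /andP[/eqP -> /eqP ->].
Qed.

Lemma continuous_normD (u v : R * R -> R) :
  continuous u -> continuous v -> continuous (fun z => `|u z| + `|v z|).
Proof.
move=> cu cv z; apply: cvgD; apply: cvg_norm; [exact: cu|exact: cv].
Qed.

End reim.

Section measurable_evaluation.
Context {R : realType} d (Th : measurableType d).

(** Joint measurability in the coefficients and the point, by the Horner recursion on the length of
    the coefficient vector. *)
Lemma measurable_reim_Poly n (a : Th -> n.-tuple R) (z : Th -> R * R) :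
  measurable_fun setT a -> measurable_fun setT z ->
  [/\ measurable_fun setT (fun t => reK (Poly (a t)) (z t)),
   measurable_fun setT (fun t => imK (Poly (a t)) (z t)),
   measurable_fun setT (fun t => reK (Poly (a t))^`() (z t)) &
   measurable_fun setT (fun t => imK (Poly (a t))^`() (z t))].
Proof.
move=> + mz.
have m1 : measurable_fun setT (fun t => (z t).1) by exact: (measurableT_comp measurable_fst mz).
have m2 : measurable_fun setT (fun t => (z t).2) by exact: (measurableT_comp measurable_snd mz).
elim: n a => [|n IH] a ma.
  have aE t : Poly (a t) = 0 by rewrite tuple0.
  split; under eq_fun do rewrite aE ?deriv0 /reK /imK ev0; exact: measurable_cst.
have mh : measurable_fun setT (fun t => tnth (a t) ord0).
  by apply: (measurableT_comp (measurable_tnth ord0)).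
have mb : measurable_fun setT (fun t => [tuple of behead (a t)]).
  by apply: (measurableT_comp (@measurable_behead _ _ n)).
have [IH1 IH2 IH3 IH4] := IH _ mb.
have aE t : Poly (a t) = Poly [tuple of behead (a t)] * 'X + (tnth (a t) ord0)%:P.
  by rewrite {1}(tuple_eta (a t)) /= cons_poly_def.
split.
- by under eq_fun do rewrite aE reKS; apply: measurable_funD => //;
    apply: measurable_funB; apply: measurable_funM.
- by under eq_fun do rewrite aE imKS; apply: measurable_funD; apply: measurable_funM.
- by under eq_fun do rewrite aE derivMXaddC reKD reKMX; apply: measurable_funD => //;
    apply: measurable_funB; apply: measurable_funM.
- by under eq_fun do rewrite aE derivMXaddC imKD imKMX; apply: measurable_funD => //;
    apply: measurable_funD; apply: measurable_funM.
Qed.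

Lemma measurable_reim p (z : Th -> R * R) : measurable_fun setT z ->
  measurable_fun setT (fun t => reK p (z t)) /\ measurable_fun setT (fun t => imK p (z t)).
Proof.
move=> mz; rewrite -(polyseqK p).
have [] := @measurable_reim_Poly (size p) (fun=> in_tuple p) z _ mz => //.
Qed.

End measurable_evaluation.

Lemma measurable_patch d (T : measurableType d) (R : realType) (G : set T) (f : T -> \bar R) :
  measurable G -> measurable_fun setT f -> measurable_fun setT (f \_ G).
Proof. by move=> mG mf; apply/(measurable_restrictT _ mG); exact: measurable_funTS. Qed.

(** * Changes of variables for one root *)

Section one_root.
Context {R : realType}.
Local Notation mu := (@lebesgue_measure R).
Local Notation Z := (R * R)%type.
Implicit Types (K H : {poly R}) (z : Z) (f : Z -> \bar R).

Definition zset (p : {poly R}) : set Z := [set z | ev p z = 0].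

Lemma countable_zset p : p != 0 -> countable (zset p).
Proof.
move=> /ev_roots[s _ sP]; apply: finite_set_countable.
by apply: (@sub_finite_set _ _ [set` s]) => [z /sP//|]; exact: finite_seq.
Qed.

(* The zeros in a countable set E only affect countably many parameters t = b z. *)
Lemma zsum_countable (zeros : R -> set Z) (b : Z -> R) (E : set Z) (f1 f2 : Z -> \bar R) :
  countable E -> (forall t z, zeros t z -> b z = t) ->
  (forall t z, zeros t z -> ~ E z -> f1 z = f2 z) ->
  (forall z, (0 <= f1 z)%E) -> (forall z, (0 <= f2 z)%E) ->
  measurable_fun setT (fun t => zsum (zeros t) f1) ->
  measurable_fun setT (fun t => zsum (zeros t) f2) ->
  (\int[mu]_t zsum (zeros t) f1 = \int[mu]_t zsum (zeros t) f2)%E.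
Proof.
move=> cE zb f12 f10 f20 m1 m2; apply: ge0_ae_eq_integral => //.
- by move=> t _; exact: zsum_ge0.
- by move=> t _; exact: zsum_ge0.
have cbE : countable (b @` E) by apply: sub_countable cE; exact: card_image_le.
exists (b @` E); split.
- exact: countable_measurable.
- exact: countable_lebesgue_measure0.
- move=> t /= ne; apply: contrapT => nt; apply: ne => _.
  apply: eq_zsum => z tz; apply: (f12 t) => // Ez; apply: nt.
  by exists z => //; exact: zb tz.
Qed.

Let gphi K (t : R) z : R := `|reK K z + t| + `|imK K z|.

Let gphi0 K t : [set z | gphi K t z = 0] = zset (K + t%:P).
Proof.
apply/seteqP; split => z; rewrite /zset/= /gphi ev_eq0 reKD imKD reKC imKC addr0.
  by move/normD_eq0.
by move=> ?; apply/normD_eq0.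
Qed.

Let gphi_measurable K z : measurable_fun setT (gphi K ^~ z).
Proof.
by apply: measurable_funD => //; apply: measurableT_comp => //; exact: measurable_funD.
Qed.

Let gphi_continuous K t : continuous (gphi K t).
Proof.
have [c1 c2] := continuous_reim K; apply: continuous_normD => // z.
by apply: cvgD; [exact: c1|exact: cvg_cst].
Qed.

Let gphi_roots K t : (1 < size K)%N -> exists2 s : seq Z, (size s <= size K)%N &
  forall z, gphi K t z = 0 -> z \in s.
Proof.
move=> sK; have sKt : size (K + t%:P) = size K.
  by rewrite size_polyDl// size_polyC; apply: leq_ltn_trans sK; exact: leq_b1.
have [|s ss sP] := @ev_roots _ (K + t%:P); first by rewrite -size_poly_gt0 sKt; exact: ltn_trans sK.
exists s; first by rewrite -sKt ltnW.
move=> z gz; apply: sP; have : [set z | gphi K t z = 0] z by [].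
by rewrite gphi0.
Qed.

Let measurable_zset_sum K f : (1 < size K)%N -> (forall z, (0 <= f z)%E) ->
  measurable_fun setT f -> measurable_fun setT (fun t : R => zsum (zset (K + t%:P)) f).
Proof.
move=> sK f0 mf.
have h := @measurable_zsum _ _ R (gphi K) (size K) (gphi_measurable K) (@gphi_continuous K)
  (fun t => gphi_roots t sK) (fun q => f q.2).
rewrite (_ : (fun t : R => _) = fun t => zsum [set z | gphi K t z = 0] f).
  by apply: h => //; exact: (measurableT_comp mf measurable_snd).
by apply/funext => t; rewrite gphi0.
Qed.

Let patch_ge0 f (G : set Z) : (forall z, (0 <= f z)%E) -> forall z, (0 <= (f \_ G) z)%E.
Proof. by move=> f0 z; rewrite patchE; case: ifPn. Qed.

Let line_roots (y : R) (t : R) : exists2 s : seq Z, (size s <= 1)%N &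
  forall z, `|z.1 - t| + `|z.2 - y| = 0 -> z \in s.
Proof.
exists [:: (t, y)] => // z /normD_eq0[/eqP + /eqP]; rewrite !subr_eq0 inE.
by move=> /eqP h1 /eqP h2; apply/eqP; rewrite [z]surjective_pairing h1 h2.
Qed.

Let line_measurable (y : R) z : measurable_fun setT (fun t : R => `|z.1 - t| + `|z.2 - y|).
Proof.
by apply: measurable_funD => //; apply: measurableT_comp => //; exact: measurable_funB.
Qed.

Let line_continuous (y t : R) : continuous (fun z : Z => `|z.1 - t| + `|z.2 - y|).
Proof.
apply: continuous_normD => z; apply: cvgB; try exact: cvg_cst.
  exact: cvg_fst.
exact: cvg_snd.
Qed.

Let line_set (y t : R) : [set z : Z | `|z.1 - t| + `|z.2 - y| = 0] = [set (t, y)].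
Proof.
apply/seteqP; split => [z /normD_eq0[/eqP + /eqP]|_ ->]/=; last by rewrite !subrr normr0 addr0.
by rewrite !subr_eq0 => /eqP h1 /eqP h2; rewrite [z]surjective_pairing h1 h2.
Qed.

Let ratio_bounds (u v A D0 e c1 c2 : R) : `|u - v| <= e * A -> `|v| = D0 * A ->
  0 <= A -> e <= D0 - c1 -> e <= c2 - D0 -> c1 * A <= `|u| /\ `|u| <= c2 * A.
Proof.
move=> uv vE A0 e1 e2.
have h1 : `|u| <= `|v| + `|u - v| by rewrite -[X in `|X| <= _](subrK v) addrC ler_normD.
have h2 : `|v| <= `|u| + `|u - v| by rewrite -{1}(subKr u v); exact: ler_normB.
have h3 : e * A <= (D0 - c1) * A by exact: ler_wpM2r.
have h4 : e * A <= (c2 - D0) * A by exact: ler_wpM2r.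
rewrite mulrBl in h3; rewrite mulrBl in h4; split; lra.
Qed.

Let eps_lt (D0 c1 c2 : R) : c1 < D0 -> D0 < c2 ->
  exists2 e, 0 < e & e <= D0 - c1 /\ e <= c2 - D0.
Proof.
move=> h1 h2; exists (Num.min (D0 - c1) (c2 - D0)).
  by rewrite lt_min !subr_gt0 h1.
by rewrite !ge_min !lexx orbT.
Qed.

Let squareI z0 (r1 r2 : R) z : square z0 (Num.min r1 r2) z -> square z0 r1 z /\ square z0 r2 z.
Proof.
by move=> h; split; apply: square_le h; rewrite ge_min lexx ?orbT.
Qed.

Let mz1 : measurable_fun setT (fst : Z -> R). Proof. exact: measurable_fst. Qed.
Let mz2 : measurable_fun setT (snd : Z -> R). Proof. exact: measurable_snd. Qed.
Let mre K : measurable_fun setT (reK K).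
Proof. by have [] := measurable_reim K (@measurable_id _ Z setT). Qed.
Let mim K : measurable_fun setT (imK K).
Proof. by have [] := measurable_reim K (@measurable_id _ Z setT). Qed.
Let meq0 (u : Z -> R) : measurable_fun setT u -> measurable [set z | u z = 0].
Proof. by move=> mu_; rewrite -[X in measurable X]setTI; exact: (mu_ measurableT [set 0]). Qed.
Let mneq0 (u : Z -> R) : measurable_fun setT u -> measurable [set z | u z != 0].
Proof.
move=> /meq0/measurableC; congr measurable; apply/seteqP; split => z /= /eqP//.
Qed.

(** On the real axis x is a root of K + t exactly if t = - K(x), so this is the change of variables
    t = - K(x) with the number of preimages taken into account. *)
Lemma real_root_formula K f : (1 < size K)%N -> (forall z, (0 <= f z)%E) ->
  measurable_fun setT f ->
  (\int[mu]_t zsum (zset (K + t%:P)) (f \_ [set z | z.2 = 0%R]) =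
   \int[mu]_x (`|K^`().[x]|%:E * f (x, 0%R)))%E.
Proof.
move=> sK f0 mf.
pose G := [set z : Z | z.2 = 0] `&` [set z | reK K^`() z != 0].
have mG : measurable G by apply: measurableI; [exact: meq0|exact: mneq0].
have my0 : measurable [set z : Z | z.2 = 0] by exact: meq0.
have K'0 : K^`() != 0 by rewrite -size_poly_gt0 size_deriv_real -ltnS prednK// ltnW.
(* The finitely many zeros of K' are removed: they are roots of K + t for countably many t only, and
   their factor |K'| is 0 on the other side. *)
rewrite (@zsum_countable _ (fun z => - reK K z) (zset K^`()) _ (f \_ G)); first last.
- by apply: measurable_zset_sum => //; [exact: patch_ge0|exact: measurable_patch].
- by apply: measurable_zset_sum => //; [exact: patch_ge0|exact: measurable_patch].
- exact: patch_ge0.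
- exact: patch_ge0.
- move=> t z _ nz; rewrite !patchE; congr (if _ then _ else _).
  apply/idP/idP => /[!inE]; last by case.
  move=> z20; split => //=; apply/eqP => r0; apply: nz; apply/ev_eq0; split => //.
  by rewrite /imK [z]surjective_pairing /= z20 ev_real.
- move=> t z /ev_eq0[]; rewrite reKD reKC => /eqP; rewrite addr_eq0 => /eqP -> _.
  by rewrite opprK.
- exact: countable_zset.
under eq_integral do rewrite -gphi0.
(* The parameter a is the abscissa, whose zero sets are the single points (t, 0); the parameter b is
   - K. *)
rewrite (@curve_zsum _ (fun t z => `|z.1 - t| + `|z.2 - 0|) (gphi K) (size K) G
  fst (fun z => - reK K z) (fun z => `|reK K^`() z|)) //.
- apply: eq_integral => t _; rewrite line_set zsum1 patchE.
  have -> : reK K^`() (t, 0) = K^`().[t] by rewrite /reK ev_real.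
  case: ifPn => // /negP; rewrite inE => nG.
  suff -> : K^`().[t] = 0 by rewrite normr0 mul0e.
  apply/eqP; apply: contrapT => /negP nK; apply: nG; split => //=.
  by rewrite /reK ev_real.
- move=> t; have [s ss sP] := line_roots 0 t; exists s => //.
  by apply: leq_trans ss _; exact: ltn_trans sK.
- move=> z t [/= z20 _]; rewrite z20 subrr normr0 addr0; split => [/eqP|->].
    by rewrite normr_eq0 subr_eq0 => /eqP.
  by rewrite subrr normr0.
- by move=> t; exact: gphi_roots.
- move=> z t [/= z20 _]; rewrite /gphi (_ : imK K z = 0); last first.
    by rewrite /imK [z]surjective_pairing /= z20 ev_real.
  rewrite normr0 addr0; split => [/eqP|<-]; last by rewrite subrr normr0.
  by rewrite normr_eq0 addr_eq0 => /eqP ->; rewrite opprK.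
- by apply: measurable_funTS; apply: measurableT_comp => //.
- by move=> z [_]; rewrite normr_gt0.
- move=> z0 [/= z02 d0] c1 c2 /andP[c10 c1D] Dc2.
  have [e e0 [e1 e2]] := eps_lt c1D Dc2.
  have [r1 r10 H1] := ev_strict_diff K z0 e0.
  have [|r2 r20 H2] := @continuous_between _ (fun z => `|reK K^`() z|) z0 _ _ _ c1D Dc2.
    by apply: cvg_norm; exact: (continuous_reim _).1.
  exists (Num.min r1 r2); first by rewrite lt_min r10.
  move=> z w [/= z20 _] [/= w20 _] /squareI[z1 z2] /squareI[w1 w2].
  have [D1 D2] := H2 _ z2.
  have {H1} := H1 _ _ z1 w1.
  rewrite cop_sub z20 w20 subrr [X in _ <= _ * X]normcR => h.
  have {}h : `|(reK K w - reK K z) - - (reK K^`() z0 * (z.1 - w.1))| <= e * `|z.1 - w.1|.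
    apply: le_trans h; apply: le_trans (normRe _).
    rewrite !cReD !cReN cReM -/(reK _ _) -/(reK _ _) -/(reK _ _) /= mulr0 subr0.
    by rewrite -normrN le_eqVlt; apply/orP; left; apply/eqP; congr `|_|; ring.
  have [h1 h2] : c1 * `|z.1 - w.1| <= `|reK K w - reK K z| /\ `|reK K w - reK K z| <= c2 * `|z.1 - w.1|.
    by apply: ratio_bounds h _ _ e1 e2 => //; rewrite normrN normrM.
  have bE : - reK K z - - reK K w = reK K w - reK K z by rewrite opprK addrC.
  split => //=; rewrite ?bE//.
  by move=> zw; rewrite [z]surjective_pairing [w]surjective_pairing zw z20 w20.
Qed.

(** At height y the equation Im (c X + H) = 0 reads c = - Im H / y, a function of the abscissa with
    derivative - Im H' / y by the Cauchy-Riemann equations. Critical points are excluded on the left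
    and have weight 0 on the right. *)
Lemma line_root_formula H (y : R) f : 0 < y -> (2 < size H)%N ->
  (forall z, (0 <= f z)%E) -> measurable_fun setT f ->
  (\int[mu]_c zsum [set z | z.2 = y /\ imK (c%:P * 'X + H) z = 0%R]
                (f \_ [set z | imK H^`() z != 0%R]) =
   \int[mu]_x ((`|imK H^`() (x, y)| / y)%:E * f (x, y)))%E.
Proof.
move=> y0 sH f0 mf.
pose G := [set z : Z | z.2 - y = 0] `&` [set z | imK H^`() z != 0].
have mG : measurable G.
  by apply: measurableI; [apply: meq0; exact: measurable_funB|exact: mneq0].
pose pb (c : R) (z : Z) : R := `|c * z.2 + imK H z| + `|z.2 - y|.
have imE c z : imK (c%:P * 'X + H) z = c * z.2 + imK H z.
  by rewrite imKD imKMX reKC imKC mul0r addr0.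
have pbE c : [set z | pb c z = 0] = [set z | z.2 = y /\ imK (c%:P * 'X + H) z = 0].
  apply/seteqP; split => z /=; rewrite imE /pb.
    by move=> /normD_eq0[-> /eqP]; rewrite subr_eq0 => /eqP.
  by move=> [-> ->]; rewrite subrr normr0 addr0.
transitivity (\int[mu]_c zsum [set z | pb c z = 0%R] (f \_ G))%E.
  apply: eq_integral => c _; rewrite pbE; apply: eq_zsum => z [/= zy _].
  rewrite !patchE; congr (if _ then _ else _).
  apply/idP/idP => /[!inE]; last by case.
  by move=> h; split => //=; rewrite zy subrr.
rewrite (@curve_zsum _ (fun t z => `|z.1 - t| + `|z.2 - y|) pb (size H) G
  fst (fun z => - (imK H z) / y) (fun z => `|imK H^`() z| / y)) //.
- apply: eq_integral => t _; rewrite line_set zsum1 patchE.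
  case: ifPn => // /negP; rewrite inE => nG.
  suff -> : imK H^`() (t, y) = 0 by rewrite normr0 mul0r mul0e.
  apply/eqP; apply: contrapT => /negP nK; apply: nG; split => //=.
  by rewrite subrr.
- move=> t; have [s ss sP] := line_roots y t; exists s => //.
  by apply: leq_trans ss _; apply: ltn_trans sH.
- move=> z t [/= z2 _]; rewrite z2 normr0 addr0; split => [/eqP|->].
    by rewrite normr_eq0 subr_eq0 => /eqP.
  by rewrite subrr normr0.
- move=> z; apply: measurable_funD => //; apply: measurableT_comp => //.
  by apply: measurable_funD => //; exact: measurable_funM.
- move=> c; apply: continuous_normD => z; last first.
    by apply: cvgB; [exact: cvg_snd|exact: cvg_cst].
  apply: cvgD; last exact: (continuous_reim H).2.
  by apply: cvgM; [exact: cvg_cst|exact: cvg_snd].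
- move=> c; have sK : size (c%:P * 'X + H) = size H.
    rewrite addrC size_polyDl//; apply: leq_ltn_trans (size_polyMleq _ _) _.
    rewrite size_polyX addn2/=; apply: leq_ltn_trans sH.
    by rewrite ltnS size_polyC leq_b1.
  have [||s ss sP] := @imK_line_roots _ (c%:P * 'X + H) y; first by rewrite gt_eqF.
    by rewrite sK; exact: ltn_trans sH.
  exists (map (fun x => (x, y)) s); first by rewrite size_map -sK ltnW.
  move=> z pz; have : [set z | pb c z = 0] z by [].
  rewrite pbE => -[zy iz]; apply/mapP; exists z.1.
    by apply: sP; rewrite -zy -surjective_pairing.
  by rewrite -zy -surjective_pairing.
- move=> z c [/= zy _]; rewrite /pb zy normr0 addr0.
  have z2 : z.2 = y by apply/eqP; rewrite -subr_eq0 zy.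
  rewrite z2; split => [/eqP|<-].
    by rewrite normr_eq0 addr_eq0 => /eqP h; rewrite -h mulfK// gt_eqF.
  by rewrite divfK ?gt_eqF// addNr normr0.
- apply: measurable_funTS; apply: measurable_funM => //.
  by apply: measurableT_comp.
- by move=> z [_ /= h]; rewrite divr_gt0// normr_gt0.
- move=> z0 [/= z02 d0] c1 c2 /andP[c10 c1D] Dc2.
  have [e e0 [e1 e2]] := eps_lt c1D Dc2.
  have ey0 : 0 < e * y by rewrite mulr_gt0.
  have [r1 r10 H1] := ev_strict_diff H z0 ey0.
  have [|r2 r20 H2] := @continuous_between _ (fun z => `|imK H^`() z| / y) z0 _ _ _ c1D Dc2.
    by apply: cvgM; [apply: cvg_norm; exact: (continuous_reim _).2|exact: cvg_cst].
  exists (Num.min r1 r2); first by rewrite lt_min r10.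
  move=> z w [/= zy _] [/= wy _] /squareI[z1 z2] /squareI[w1 w2].
  have [D1 D2] := H2 _ z2.
  have {H1} := H1 _ _ z1 w1.
  have zw2 : z.2 - w.2 = 0 by lra.
  rewrite cop_sub zw2 [X in _ <= _ * X]normcR => h.
  have {}h : `|(imK H w - imK H z) / y - - (imK H^`() z0 / y * (z.1 - w.1))| <= e * `|z.1 - w.1|.
    have -> : (imK H w - imK H z) / y - - (imK H^`() z0 / y * (z.1 - w.1)) =
      (imK H w - imK H z + imK H^`() z0 * (z.1 - w.1)) / y by ring.
    rewrite normrM [ `|y^-1|]gtr0_norm ?invr_gt0// ler_pdivrMr// mulrAC.
    apply: le_trans h; apply: le_trans (normIm _).
    rewrite !cImD !cImN cImM -/(imK _ _) -/(imK _ _) -/(imK _ _) /= mulr0 add0r.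
    by rewrite -normrN le_eqVlt; apply/orP; left; apply/eqP; congr `|_|; ring.
  have [h1 h2] : c1 * `|z.1 - w.1| <= `|(imK H w - imK H z) / y| /\ `|(imK H w - imK H z) / y| <= c2 * `|z.1 - w.1|.
    apply: ratio_bounds h _ _ e1 e2 => //.
    by rewrite normrN normrM normrM [ `|y^-1|]gtr0_norm ?invr_gt0.
  have bE : - imK H z / y - - imK H w / y = (imK H w - imK H z) / y by ring.
  split => //=; rewrite ?bE//.
  move=> zw; rewrite [z]surjective_pairing [w]surjective_pairing zw; congr (_, _).
  by apply/eqP; rewrite -subr_eq0 zw2.
Qed.

(* Along the curve Im K = 0 parametrized by its ordinate y, the real part of K has derivative
   |K'|^2 / |Im K'| up to sign, by the Cauchy-Riemann equations. *)
Definition jac K z : R := (reK K^`() z ^+ 2 + imK K^`() z ^+ 2) / `|imK K^`() z|.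

(** The curve is Im K = 0 in the upper half-plane, with the ordinate as parameter a and - Re K as
    parameter b. Since K is real along it, an increment of K determines dz up to first order as dK /
    K', so that dy = Im (1 / K') dK; the comparison is made in this inverse direction, where only K'
    != 0 is needed to control dz. *)
Lemma complex_root_formula K f : (2 < size K)%N -> (forall z, (0 <= f z)%E) ->
  measurable_fun setT f ->
  (\int[mu]_t zsum (zset (K + t%:P)) (f \_ [set z | (0 < z.2)%R]) =
   \int[mu]_y zsum [set z | [/\ (0 < y)%R, z.2 = y & imK K z = 0%R]]
     ((fun z => (jac K z)%:E * f z) \_ [set z | imK K^`() z != 0%R]))%E.
Proof.
move=> sK f0 mf; have sK1 : (1 < size K)%N by exact: ltn_trans sK.
have mpos : measurable [set z : Z | 0 < z.2].
  rewrite (_ : mkset _ = setT `&` snd @^-1` `]0, +oo[).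
    exact: mz2.
  by rewrite setTI; apply/seteqP; split => z /=; rewrite in_itv/= andbT.
pose G := [set z : Z | 0 < z.2] `&` ([set z | imK K z = 0] `&` [set z | imK K^`() z != 0]).
have mG : measurable G.
  by apply: measurableI => //; apply: measurableI; [exact: meq0|exact: mneq0].
have K'0 : K^`() != 0 by rewrite -size_poly_gt0 size_deriv_real -ltnS prednK// ltnW.
(* The value 1 leaves no zero at heights t <= 0 and is continuous in z. *)
pose pa (t : R) (z : Z) : R := if 0 < t then `|imK K z| + `|z.2 - t| else 1.
(* The set treated by [countable_real_values] for p = K'. Together with the zeros of K' it accounts
   for every point of the curve where Im K' = 0. *)
pose S1 := [set z : Z | [/\ 0 < z.2, imK K z = 0, imK K^`() z = 0,
  reK K^`() z != 0 & imK K^`() z = 0]].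
rewrite (@zsum_countable _ (fun z => - reK K z)
  (\bigcup_b (if b then zset K^`() else S1)) _ (f \_ G)); first last.
- by apply: measurable_zset_sum => //; [exact: patch_ge0|exact: measurable_patch].
- by apply: measurable_zset_sum => //; [exact: patch_ge0|exact: measurable_patch].
- exact: patch_ge0.
- exact: patch_ge0.
- move=> t z /ev_eq0[_]; rewrite imKD imKC addr0 => zt nz.
  rewrite !patchE; congr (if _ then _ else _).
  apply/idP/idP => /[!inE]; last by case.
  move=> z20; split => //; split => //=; apply/eqP => i0; apply: nz.
  have [r0|r0] := eqVneq (reK K^`() z) 0.
    by exists true => //; apply/ev_eq0.
  by exists false.
- move=> t z /ev_eq0[]; rewrite reKD reKC => /eqP; rewrite addr_eq0 => /eqP -> _.
  by rewrite opprK.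
- apply: bigcup_countable => // -[] _; first exact: countable_zset.
  by apply: countable_real_values; rewrite size_deriv_real -ltnS prednK// ltnW.
under eq_integral do rewrite -gphi0.
rewrite (@curve_zsum _ pa (gphi K) (size K) G
  snd (fun z => - reK K z) (jac K)) //.
- apply: eq_integral => t _.
  have -> : [set z | pa t z = 0] = [set z | [/\ 0 < t, z.2 = t & imK K z = 0]].
    apply/seteqP; split => z; rewrite /pa/=; case: ifPn => // t0.
    + by move=> /normD_eq0[-> /eqP]; rewrite subr_eq0 => /eqP.
    + by move=> /eqP; rewrite oner_eq0.
    + by move=> [_ -> ->]; rewrite subrr normr0 addr0.
    + by case.
  apply: eq_zsum => z [/= t0 zt zK]; rewrite !patchE; congr (if _ then _ else _).
  apply/idP/idP => /[!inE]; first by case=> _ [].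
  by move=> h; split => /=; rewrite ?zt.
- move=> z; rewrite /pa; apply: measurable_fun_ifT => //.
  + apply: measurable_fun_ltr => //.
  + apply: measurable_funD => //; apply: measurableT_comp => //.
    exact: measurable_funB.
- move=> t; have [t0|t0] := boolP (0 < t); last first.
    rewrite (_ : pa t = cst 1); first by move=> z; exact: cvg_cst.
    by apply/funext => z; rewrite /pa (negbTE t0).
  rewrite (_ : pa t = fun z => `|imK K z| + `|z.2 - t|); last first.
    by apply/funext => z; rewrite /pa t0.
  apply: continuous_normD => z; first exact: (continuous_reim K).2.
  by apply: cvgB; [exact: cvg_snd|exact: cvg_cst].
- move=> t; rewrite /pa; have [t0|t0] := boolP (0 < t); last first.
    by exists [::] => // z /eqP; rewrite oner_eq0.
  have [||s ss sP] := @imK_line_roots _ K t => //; first by rewrite gt_eqF.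
  exists (map (fun x => (x, t)) s); first by rewrite size_map ltnW.
  move=> z /normD_eq0[zK /eqP]; rewrite subr_eq0 => /eqP zt.
  apply/mapP; exists z.1; last by rewrite -zt -surjective_pairing.
  by apply: sP; rewrite -zt -surjective_pairing.
- move=> z t [/= z0 [/= zK _]]; rewrite /pa zK normr0 add0r; split.
    case: ifPn => _ /eqP; rewrite ?oner_eq0// normr_eq0 subr_eq0 => /eqP//.
  by move=> <-; rewrite z0 subrr normr0.
- by move=> t; exact: gphi_roots.
- move=> z t [/= z0 [/= zK _]]; rewrite /gphi zK.
  rewrite normr0 addr0; split => [/eqP|<-]; last by rewrite subrr normr0.
  by rewrite normr_eq0 addr_eq0 => /eqP ->; rewrite opprK.
- apply: measurable_funTS; apply: measurable_funM.
    by apply: measurable_funD; exact: measurable_funX.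
  by apply: (measurableT_comp measurable_invr); exact: measurableT_comp.
- move=> z [_ [_ /= h]]; rewrite divr_gt0// ?normr_gt0//.
  by rewrite ltr_wpDl ?sqr_ge0// exprn_even_gt0//= h.
- move=> z0 [/= z00 [/= zK d0]] c1 c2 /andP[c10 c1D] Dc2.
  have D0 : 0 < jac K z0 by exact: lt_trans c1D.
  pose N := normc (ev K^`() z0).
  have N0 : 0 < N by apply: lt_le_trans (normIm _); rewrite normr_gt0.
  have NE : N ^+ 2 = reK K^`() z0 ^+ 2 + imK K^`() z0 ^+ 2 by rewrite normc_sqr.
  have c20 : 0 < c2 by exact: lt_trans Dc2.
  (* The tolerance is taken for the reciprocals, because it is the ratio |dy| / |d Re K| that will
     be estimated. *)
  have [||e e0 [e1 e2]] := @eps_lt (jac K z0)^-1 c2^-1 c1^-1.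
  + by rewrite ltf_pV2.
  + by rewrite ltf_pV2.
  (* With N = |K'(z0)|, the first bound absorbs the error into N |dz| and yields N |dz| <= 2 |rho|;
     the second then turns the error e' |dz| / N into at most e |rho|. *)
  pose e' := Num.min (N / 2) (e * N ^+ 2 / 2).
  have e'0 : 0 < e' by rewrite lt_min divr_gt0//= divr_gt0// mulr_gt0// exprn_gt0.
  have e'1 : e' <= N / 2 by rewrite ge_min lexx.
  have e'2 : e' <= e * N ^+ 2 / 2 by rewrite ge_min lexx orbT.
  have [r1 r10 H1] := ev_strict_diff K z0 e'0.
  have [|r2 r20 H2] := @continuous_between _ (jac K) z0 _ _ _ c1D Dc2.
    apply: cvgM.
      by apply: cvgD; apply: cvgM; first [exact: (continuous_reim _).1|exact: (continuous_reim _).2].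
    apply: cvgV; first by rewrite normr_eq0.
    by apply: cvg_norm; exact: (continuous_reim _).2.
  exists (Num.min r1 r2); first by rewrite lt_min r10.
  move=> z w [/= _ [/= zK0 _]] [/= _ [/= wK0 _]] /squareI[z1 z2] /squareI[w1 w2].
  have [D1 D2] := H2 _ z2.
  have {H1} := H1 _ _ z1 w1.
  set rho := reK K z - reK K w.
  have rhoE : ev K z - ev K w = rho%:C.
    apply/eqP; rewrite eq_complex; apply/andP; split; apply/eqP.
      by rewrite cReD cReN.
    by rewrite cImD cImN -/(imK K z) -/(imK K w) zK0 wK0 subrr.
  rewrite rhoE; set dz := complex_of_pair z - complex_of_pair w; set k := ev K^`() z0.
  move=> h.
  have nk : normc k = N by [].
  have k0 : k != 0 by rewrite -normc_eq0 nk gt_eqF.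
  have dz0 := normc_ge0 dz.
  have dzr : N * normc dz <= 2 * `|rho|.
    have h1 : N * normc dz <= `|rho| + e' * normc dz.
      rewrite -nk -normcM; have -> : k * dz = rho%:C - (rho%:C - k * dz) by ring.
      apply: le_trans (le_normcD _ _) _; rewrite normcR lerD2l.
      by have := normcB 0 (rho%:C - k * dz); rewrite sub0r subr0 => ->.
    have h2 : e' * normc dz <= N / 2 * normc dz by exact: ler_wpM2r.
    lra.
  have dyE : z.2 - w.2 = complex.Im dz by [].
  have key : `|(z.2 - w.2) - complex.Im (k^-1) * rho| <= e * `|rho|.
    have -> : z.2 - w.2 - complex.Im k^-1 * rho = complex.Im (- (k^-1 * (rho%:C - k * dz))).
      have -> : - (k^-1 * (rho%:C - k * dz)) = dz - k^-1 * rho%:C by field.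
      by rewrite cImD cImN cImM /= mulr0 add0r dyE.
    apply: le_trans (normIm _) _.
    have := normcB 0 (k^-1 * (rho%:C - k * dz)); rewrite sub0r subr0 => ->.
    rewrite normcM normcV nk mulrC ler_pdivrMr//.
    apply: le_trans h _.
    have h3 : e' * normc dz <= e * N ^+ 2 / 2 * normc dz by exact: ler_wpM2r.
    apply: le_trans h3 _.
    have -> : e * N ^+ 2 / 2 * normc dz = e * N / 2 * (N * normc dz) by ring.
    have -> : e * `|rho| * N = e * N / 2 * (2 * `|rho|) by field.
    by apply: ler_wpM2l => //; rewrite divr_ge0// mulr_ge0// ltW.
  (* |Im (1 / k)| = |Im k| / |k|^2, the reciprocal of [jac]. *)
  have imV : `|complex.Im k^-1| = (jac K z0)^-1.
    rewrite /jac invfM invrK -NE mulrC -/N.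
    have -> : complex.Im k^-1 = - (complex.Im k) / N ^+ 2.
      by rewrite NE /imK /reK -/k mulNr; case: (k).
    by rewrite normrM normrN [ `|(N ^+ 2)^-1|]ger0_norm// invr_ge0 exprn_ge0// ltW.
  have [h1 h2] : c2^-1 * `|rho| <= `|z.2 - w.2| /\ `|z.2 - w.2| <= c1^-1 * `|rho|.
    by apply: ratio_bounds key _ _ e1 e2 => //; rewrite normrM imV.
  have bE : - reK K z - - reK K w = - rho by rewrite /rho; ring.
  split => //=; rewrite ?bE ?normrN.
  + move=> zw; rewrite zw subrr normr0 pmulr_rle0 ?invr_gt0// in h1.
    have nd : normc dz <= 0.
      by rewrite -(pmulr_rle0 _ N0); apply: le_trans dzr _; rewrite pmulr_rle0.
    have : normc dz == 0 by rewrite eq_le nd dz0.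
    rewrite normc_eq0 /dz cop_sub eq_complex/= !subr_eq0.
    move=> /andP[/eqP h3 /eqP h4].
    by rewrite [z]surjective_pairing [w]surjective_pairing h3 h4.
  + by rewrite -ler_pdivlMl.
  + by rewrite -ler_pdivrMl.
Qed.

End one_root.

(** * Integration over coefficient vectors *)

Section power_measure_fubini.
Context d (T : measurableType d) (R : realType).
Variable mu : {sigma_finite_measure set T -> \bar R}.
Local Open Scope ereal_scope.

Let cons_tuple n (p : T * n.-tuple T) : n.+1.-tuple T := [tuple of p.1 :: p.2].

Lemma measurable_cons_tuple n : measurable_fun setT (@cons_tuple n).
Proof. exact: measurable_cons. Qed.

Variables (n : nat) (F : n.+1.-tuple T -> \bar R).
Hypotheses (F0 : forall t, 0 <= F t) (mF : measurable_fun setT F).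

Lemma measurable_fun_cons : measurable_fun setT (fun p : T * n.-tuple T => F [tuple of p.1 :: p.2]).
Proof. exact: (measurableT_comp mF (@measurable_cons_tuple n)). Qed.

Lemma measurable_fun_consl (t : n.-tuple T) : measurable_fun setT (fun x : T => F [tuple of x :: t]).
Proof. exact: (measurableT_comp measurable_fun_cons (pair2_measurable t)). Qed.

Lemma measurable_integral_cons :
  measurable_fun setT (fun t : n.-tuple T => \int[mu]_x F [tuple of x :: t]).
Proof.
have h := measurable_fun_fubini_tonelli_G (m1 := mu)
  (fun p : T * n.-tuple T => F [tuple of p.1 :: p.2]).
by apply: h => //; exact: measurable_fun_cons.
Qed.

Let integral_powerS_prod : \int[power_measure mu n.+1]_t F t =
  \int[mu \x power_measure mu n]_p F [tuple of p.1 :: p.2].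
Proof.
pose c := measurable_fun_cons.
transitivity (\int[pushforward (mu \x power_measure mu n) (@cons_tuple n)]_t F t).
  by apply: eq_measure_integral => [|A mA _]; first exact: measurable_cons_tuple.
rewrite ge0_integral_pushforward//.
exact: measurable_cons_tuple.
Qed.

Lemma integral_powerS : \int[power_measure mu n.+1]_t F t =
  \int[mu]_x \int[power_measure mu n]_t F [tuple of x :: t].
Proof.
rewrite integral_powerS_prod fubini_tonelli1//; exact: measurable_fun_cons.
Qed.

Lemma integral_powerS_swap : \int[power_measure mu n.+1]_t F t =
  \int[power_measure mu n]_t \int[mu]_x F [tuple of x :: t].
Proof.
rewrite integral_powerS_prod fubini_tonelli2//; exact: measurable_fun_cons.
Qed.

End power_measure_fubini.

Section translation.
Context {R : realType}.
Local Notation mu := (@lebesgue_measure R).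

(** A translation and its inverse have Lipschitz constant 1, so each of the two outer measures
    bounds the other. *)
Lemma lebesgue_translation (c : R) (A : set R) :
  mu ((fun x => x + c) @^-1` A) = mu A.
Proof.
have -> : (fun x => x + c) @^-1` A = (fun x => x - c) @` A.
  apply/seteqP; split => [x Ax|_ [x Ax <-]]/=; last by rewrite subrK.
  by exists (x + c); rewrite ?addrK.
apply/eqP; rewrite eq_le; apply/andP; split.
  rewrite -[X in (_ <= mu X)%E]image_id -[X in (_ <= X)%E]mul1e.
  apply: lebesgue_lipschitz_image => // x y _ _; rewrite mul1r.
  by rewrite opprB addrA subrK.
rewrite -[X in (mu X <= _)%E]image_id -[X in (_ <= X)%E]mul1e.
apply: lebesgue_lipschitz_image => // x y _ _; rewrite mul1r.
by rewrite opprB addrA subrK.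
Qed.

Lemma integral_translation (c : R) (g : measurableTypeR R -> \bar R) :
  (forall x, (0 <= g x)%E) -> measurable_fun setT g ->
  (\int[mu]_x g (x + c)%R = \int[mu]_x g x)%E.
Proof.
move=> g0 mg.
have mc : measurable_fun setT (fun x : measurableTypeR R => (x + c)%R : measurableTypeR R).
  exact: measurable_funD.
transitivity (\int[pushforward mu (fun x : measurableTypeR R => (x + c)%R : measurableTypeR R)]_x g x)%E.
  by rewrite ge0_integral_pushforward.
apply: eq_measure_integral => A mA _.
exact: lebesgue_translation.
Qed.

End translation.

Section unimodular.
Context {R : realType}.
Local Notation RT := (measurableTypeR R).
Local Notation lam n := (power_measure (@lebesgue_measure R) n).

(** The coefficients of D t from the degree of D upwards. The lower ones are left out since they are
    determined by the condition that the roots of D are roots of the product. *)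
Definition high (D : {poly R}) n (t : n.-tuple R) : n.-tuple R :=
  [tuple (D * Poly t)`_(i + (size D).-1) | i < n].

Lemma nth_high D n (t : n.-tuple R) i : (i < n)%N ->
  (high D t)`_i = (D * Poly t)`_(i + (size D).-1).
Proof. by move=> ni; rewrite -(tnth_nth 0 (high D t) (Ordinal ni)) tnth_mktuple. Qed.

Lemma measurable_coef d (Th : measurableType d) n (a : Th -> n.-tuple R) k :
  measurable_fun setT a -> measurable_fun setT (fun t => (Poly (a t))`_k).
Proof.
move=> ma; have [kn|kn] := ltnP k n.
  rewrite (_ : (fun t => _) = (fun t => tnth (a t) (Ordinal kn))).
    by apply: (measurableT_comp (measurable_tnth (Ordinal kn))).
  by apply/funext => t; rewrite coef_Poly (tnth_nth 0).
rewrite (_ : (fun t => _) = cst 0); first exact: measurable_cst.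
by apply/funext => t; rewrite coef_Poly nth_default// size_tuple.
Qed.

Lemma measurable_coefM d (Th : measurableType d) (p q : Th -> {poly R}) k :
  (forall i, measurable_fun setT (fun t => (p t)`_i)) ->
  (forall i, measurable_fun setT (fun t => (q t)`_i)) ->
  measurable_fun setT (fun t => (p t * q t)`_k).
Proof.
move=> mp mq; under eq_fun do rewrite coefM.
by apply: measurable_sum => i; exact: measurable_funM.
Qed.

Lemma measurable_high d (Th : measurableType d) (D : Th -> {poly R}) (m : nat) n (a : Th -> n.-tuple R) :
  (forall t, size (D t) = m) ->
  (forall i, measurable_fun setT (fun t => (D t)`_i)) -> measurable_fun setT a ->
  measurable_fun setT (fun t => high (D t) (a t)).
Proof.
move=> sD mD ma; apply/measurable_fun_tnthP => i.
rewrite (_ : _ \o _ = fun t => (D t * Poly (a t))`_(i + m.-1)); last first.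
  by apply/funext => t /=; rewrite tnth_mktuple sD.
by apply: measurable_coefM => // j; exact: measurable_coef.
Qed.

(* The map is triangular with unit diagonal: the head entry of t occurs, with coefficient one,
   in the head entry of its image only. *)
Lemma integral_high (D : {poly R}) n (F : n.-tuple RT -> \bar R) : D \is monic ->
  (forall t, (0 <= F t)%E) -> measurable_fun setT F ->
  (\int[lam n]_t F (high D t) = \int[lam n]_t F t)%E.
Proof.
move=> mD; elim: n F => [|n IH] F F0 mF.
  by apply: eq_integral => t _; rewrite (tuple0 (high D t)) (tuple0 t).
have mh : measurable_fun setT (@high D n.+1 : n.+1.-tuple RT -> n.+1.-tuple RT).
  apply: (@measurable_high _ (n.+1.-tuple R) (fun=> D) (size D) n.+1 id) => //.
have mhn : measurable_fun setT (@high D n : n.-tuple RT -> n.-tuple RT).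
  apply: (@measurable_high _ (n.-tuple R) (fun=> D) (size D) n id) => //.
rewrite integral_powerS_swap//; last exact: (measurableT_comp mF mh).
(* The contribution of the tail to the head entry: the coefficient of D t just below the degree of
   D, and 0 if D is constant. *)
pose L (t : n.-tuple R) := if (size D).-1 is k.+1 then (D * Poly t)`_k else 0.
have highE x (t : n.-tuple R) : high D [tuple of x :: t] = [tuple of (x + L t) :: high D t].
  apply: eq_from_tnth => i; rewrite tnth_mktuple /= cons_poly_def mulrDr mulrA coefD coefMX coefMC.
  have lD : D`_(size D).-1 = 1 by exact/eqP.
  case: (unliftP ord0 i) => [j ->|->]; rewrite ?tnthS ?tnth0/=.
    rewrite tnth_mktuple /bump/= add1n addSn/= [D`_ _]nth_default ?mul0r ?addr0//.
    by case: (size D) => // m; rewrite ltnS leq_addl.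
  rewrite add0n lD mul1r addrC /L; congr (_ + _).
  by case: ((size D).-1) => [|k].
under eq_integral do under eq_integral do rewrite highE.
transitivity (\int[lam n]_t \int[lebesgue_measure]_x F [tuple of x :: high D t])%E.
  apply: eq_integral => t _.
  apply: (@integral_translation _ (L t) (fun x => F [tuple of x :: high D t])) => //.
  exact: (measurable_fun_consl mF).
rewrite (integral_powerS_swap _ F0 mF).
apply: (IH (fun t => \int[lebesgue_measure]_x F [tuple of x :: t])%E).
  by move=> t; exact: integral_ge0.
exact: measurable_integral_cons.
Qed.

End unimodular.

(** * Splitting off one root *)

Section real_step.
Context {R : realType}.
Local Notation RT := (measurableTypeR R).
Local Notation lam n := (power_measure (@lebesgue_measure R) n).
Local Notation mu := (@lebesgue_measure R).
Local Notation Z := (R * R)%type.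

(* The zero polynomial is given no root, so that all the root sets are finite. *)
Definition zroots (p : {poly R}) : set Z := if p == 0 then set0 else zset p.

(** A test for the zero polynomial that is visibly measurable in the coefficients. *)
Lemma tuple_norm_eq0 n (t : n.-tuple R) : (\sum_(i < n) `|tnth t i| == 0) = (Poly t == 0).
Proof.
rewrite psumr_eq0//; apply/allP/eqP => [h|p0 i _].
  apply/polyP => i; rewrite coef0 coef_Poly.
  have [ni|ni] := ltnP i n; last by rewrite nth_default// size_tuple.
  have := h (Ordinal ni) (mem_index_enum _); rewrite normr_eq0 (tnth_nth 0) => /eqP//.
have := coef0 R i; rewrite -{1}p0 coef_Poly (tnth_nth 0) => ->.
by rewrite normr0 eqxx.
Qed.

Lemma measurable_zsum_zroots d (Th : measurableType d) n (a : Th -> n.-tuple R)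
    (F : Th * Z -> \bar R) : measurable_fun setT a ->
  (forall q, (0 <= F q)%E) -> measurable_fun setT F ->
  measurable_fun setT (fun t => zsum (zroots (Poly (a t))) (fun z => F (t, z))).
Proof.
move=> ma F0 mF.
(* The constant 1 for the zero polynomial realizes the convention of [zroots]. *)
pose phi t z : R := if \sum_(i < n) `|tnth (a t) i| == 0 then 1
  else `|reK (Poly (a t)) z| + `|imK (Poly (a t)) z|.
have s0 t := tuple_norm_eq0 (a t).
have pE t : zroots (Poly (a t)) = [set z | phi t z = 0].
  rewrite /zroots /phi s0; case: ifPn => p0; apply/seteqP; split => z //=.
  - by move/eqP; rewrite oner_eq0.
  - by rewrite /zset/= => /ev_eq0 h; apply/normD_eq0.
  - by move/normD_eq0/ev_eq0.
rewrite (_ : (fun t => _) = fun t => zsum [set z | phi t z = 0] (fun z => F (t, z))); last first.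
  by apply/funext => t; rewrite pE.
apply: (@measurable_zsum _ _ _ phi n.+1) => //.
- move=> z; apply: measurable_fun_ifT => //.
    apply: measurable_fun_eqr => //; apply: measurable_sum => i.
    apply: measurableT_comp => //.
    exact: (measurableT_comp (measurable_tnth i) ma).
  have [h1 h2 _ _] := @measurable_reim_Poly _ _ _ _ a (fun=> z) ma (measurable_cst z).
  by apply: measurable_funD; apply: measurableT_comp.
- move=> t; rewrite /phi; case: (_ == 0) => z; first exact: cvg_cst.
  by have [c1 c2] := continuous_reim (Poly (a t)); apply: continuous_normD.
- move=> t; have [p0|p0] := eqVneq (Poly (a t)) 0.
    exists [::] => // z; rewrite /phi s0 p0 eqxx => /eqP.
    by rewrite oner_eq0.
  have [s ss sP] := ev_roots p0; exists s.
    rewrite ltnW// (leq_trans ss)//; apply: leq_trans (size_Poly _) _.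
    by rewrite size_tuple.
  move=> z; rewrite /phi s0 (negbTE p0) => /normD_eq0/ev_eq0.
  exact: sP.
Qed.

(** In all uses of interest N is n plus the degree of D, so that no coefficient of the product is
    cut off; see [Poly_mulp]. *)
Definition mulp (D : {poly R}) N n (t : n.-tuple R) : N.-tuple R :=
  [tuple (D * Poly t)`_i | i < N].

Lemma Poly_cons (x : R) n (t : n.-tuple R) :
  Poly [tuple of x :: t] = Poly t * 'X + x%:P.
Proof. by rewrite /= cons_poly_def. Qed.

Lemma zroots_cons (x : R) (p : {poly R}) : p != 0 ->
  zroots (p * 'X + x%:P) = zset (p * 'X + x%:P).
Proof.
move=> p0; rewrite /zroots; case: eqP => // /(congr1 (fun q : {poly R} => size q)).
by rewrite size_MXaddC (negbTE p0) size_poly0.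
Qed.

Let measurable_real_line : measurable [set z : Z | z.2 = 0].
Proof.
have m2 : measurable_fun setT (snd : Z -> R) by exact: measurable_snd.
by rewrite -[X in measurable X]setTI; exact: (m2 measurableT [set 0]).
Qed.

(** Psi depends on the coefficients and on the root, so that it can carry the weight, the numbers of
    the remaining roots and the condition on the chosen root at once. *)
Lemma real_step n (Psi : n.+1.-tuple RT * Z -> \bar R) :
  (forall q, (0 <= Psi q)%E) -> measurable_fun setT Psi ->
  (\int[lam n.+1]_a zsum (zroots (Poly a)) ((fun z => Psi (a, z)) \_ [set z | z.2 = 0%R]) =
   \int[mu]_x \int[lam n]_t (`|(Poly t).[x]|%:E * Psi (mulp ('X - x%:P)%R n.+1 t, (x, 0%R))))%E.
Proof.
move=> P0 mP.
pose F (q : n.+1.-tuple RT * Z) := (Psi \_ [set q | q.2.2 = 0%R]) q.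
have F0 q : (0 <= F q)%E by rewrite /F patchE; case: ifPn.
have FE a : (fun z => Psi (a, z)) \_ [set z | z.2 = 0%R] = fun z => F (a, z).
  by apply/funext => z; rewrite /F !patchE; congr (if _ then _ else _);
    apply/idP/idP => /[!inE].
have mF : measurable_fun setT F.
  apply: measurable_patch => //.
  have m2 : measurable_fun setT (snd : n.+1.-tuple RT * Z -> Z) by exact: measurable_snd.
  by rewrite -[X in measurable X]setTI; exact: (m2 measurableT _ measurable_real_line).
under eq_integral do rewrite FE.
have mz : measurable_fun setT (fun a : n.+1.-tuple RT => zsum (zroots (Poly a)) (fun z => F (a, z))).
  exact: (@measurable_zsum_zroots _ (n.+1.-tuple RT) n.+1 id F).
have S0 (a : n.+1.-tuple RT) : (0 <= zsum (zroots (Poly a)) (fun z => F (a, z)))%E.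
  exact: zsum_ge0.
rewrite (integral_powerS_swap _ S0 mz).
pose K (b : n.-tuple R) := Poly b * 'X.
pose g (q : n.-tuple RT * RT) : \bar R := (`|(K q.1)^`().[q.2]|%:E *
  Psi ([tuple of (- (K q.1).[q.2])%R :: q.1], (q.2, 0%R)))%E.
have g0 q : (0 <= g q)%E by rewrite /g mule_ge0// lee_fin.
have mg : measurable_fun setT g.
  have m0 : measurable_fun setT (fun q : n.-tuple RT * RT => (q.2, 0) : R * R).
    by apply/measurable_fun_pairP; split; [exact: measurable_snd|exact: measurable_cst].
  have m1 : measurable_fun setT (fun q : n.-tuple RT * RT => [tuple of 0 :: q.1] : n.+1.-tuple R).
    apply: measurable_cons; [exact: measurable_cst|exact: measurable_fst].
  have KE (q : n.-tuple R) : Poly [tuple of 0 :: q] = K q.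
    by rewrite Poly_cons addr0.
  have [h1 _ h3 _] := measurable_reim_Poly m1 m0.
  have {}h1 : measurable_fun setT (fun q : n.-tuple RT * RT => (K q.1).[q.2]).
    apply: eq_measurable_fun h1 => q _.
    by rewrite KE /reK ev_real.
  have {}h3 : measurable_fun setT (fun q : n.-tuple RT * RT => (K q.1)^`().[q.2]).
    apply: eq_measurable_fun h3 => q _.
    by rewrite KE /reK ev_real.
  apply: emeasurable_funM.
    by apply/measurable_EFinP; apply: measurableT_comp.
  apply: (measurableT_comp mP).
  apply/measurable_fun_pairP; split => //.
  by apply: measurable_cons; [exact: measurableT_comp|exact: measurable_fst].
transitivity (\int[lam n]_b \int[mu]_x g (b, x))%E.
  apply: eq_integral => b _.
  (* If all coefficients but a_0 vanish, the polynomial is constant and has no root, by convention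
     even if it is 0; on the right the factor K' vanishes. *)
  have [b0|b0] := eqVneq (Poly b) 0.
    rewrite [RHS]integral0_eq; last first.
      by move=> x _; rewrite /g /K /= b0 mul0r deriv0 horner0 normr0 mul0e.
    apply: integral0_eq => x _.
    rewrite (_ : zroots _ = set0) ?zsum0// Poly_cons b0 mul0r add0r /zroots.
    case: ifPn => //; rewrite polyC_eq0 => x0; rewrite -subset0 => z.
    by rewrite /zset/= evC => /eqP; rewrite eq_complex/= (negbTE x0).
  have sK : (1 < size (K b))%N by rewrite /K size_mulX// ltnS size_poly_gt0.
  (* At a root z the constant coefficient equals - Re K(z), so Psi becomes a function of z alone
     once b is fixed. *)
  pose f z := Psi ([tuple of (- reK (K b) z) :: b], z).
  have mf : measurable_fun setT f.
    apply: (measurableT_comp mP); apply/measurable_fun_pairP.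
    split; last exact: measurable_id.
    apply: measurable_cons; last exact: measurable_cst.
    apply: measurableT_comp => //.
    by have [] := measurable_reim (K b) (@measurable_id _ Z setT).
  have f0 z : (0 <= f z)%E by exact: P0.
  rewrite [LHS](_ : _ = \int[mu]_x zsum (zset (K b + x%:P)) (f \_ [set z | z.2 = 0%R]))%E.
    rewrite real_root_formula//; apply: eq_integral => x _.
    by rewrite /f /g/= /reK ev_real.
  apply: eq_integral => x _; rewrite Poly_cons zroots_cons//.
  apply: eq_zsum => z /ev_eq0[]; rewrite reKD reKC => /eqP.
  rewrite addrC addr_eq0 => /eqP -> _.
  by rewrite /F /f !patchE; congr (if _ then _ else _); apply/idP/idP => /[!inE].
rewrite (fubini_tonelli g mg g0).
apply: eq_integral => x _.
have mD : ('X - x%:P) \is monic by exact: monicXsubC.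
(* For fixed x, the coefficients a_1, ..., a_n are replaced by those of the cofactor t. *)
rewrite -(@integral_high _ ('X - x%:P) n (fun b => g (b, x)))//; last first.
  exact: (measurableT_comp mg (pair2_measurable x)).
apply: eq_integral => t _.
pose q := ('X - x%:P) * Poly t.
have sq : (size q <= n.+1)%N.
  apply: leq_trans (size_polyMleq _ _) _; rewrite size_XsubC /=.
  by rewrite ltnS; apply: leq_trans (size_Poly _) _; rewrite size_tuple.
have qE : q = K (high ('X - x%:P) t) + (q`_0)%:P.
  apply/polyP => i; rewrite coefD coefMX coefC; case: i => [|i]/=; first by rewrite add0r.
  rewrite addr0 coef_Poly; have [ni|ni] := ltnP i n.
    by rewrite nth_high// size_XsubC/= addn1.
  have -> : q`_i.+1 = 0 by apply: nth_default; exact: leq_trans sq _.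
  by apply/esym/nth_default; rewrite size_map size_enum_ord.
have qx : q.[x] = 0 by rewrite hornerM hornerXsubC subrr mul0r.
have q0 : q`_0 = - (K (high ('X - x%:P) t)).[x].
  by have := qx; rewrite {1}qE hornerD hornerC => /eqP; rewrite addrC addr_eq0 => /eqP.
have q' : (K (high ('X - x%:P) t))^`().[x] = (Poly t).[x].
  transitivity (q^`().[x]); first by rewrite [in RHS]qE derivD derivC addr0.
  by rewrite derivM derivXsubC hornerD !hornerM hornerXsubC subrr mul0r addr0 hornerC mul1r.
rewrite /g /= q' -q0; congr (_ * Psi (_, _))%E.
apply: eq_from_tnth => i; rewrite tnth_mktuple.
case: (unliftP ord0 i) => [j ->|->]; rewrite ?tnthS ?tnth0//.
by rewrite tnth_mktuple size_XsubC/= addn1.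
Qed.

End real_step.

Section quad.
Context {R : realType}.
Local Notation Z := (R * R)%type.

Definition quad (z : Z) : {poly R} :=
  ('X - (2 * z.1)%:P) * 'X + (z.1 ^+ 2 + z.2 ^+ 2)%:P.

Lemma size_quad z : size (quad z) = 3%N.
Proof. by rewrite /quad size_MXaddC polyXsubC_eq0 /= size_XsubC. Qed.

Lemma quad_monic z : quad z \is monic.
Proof.
rewrite monicE lead_coefE size_quad /quad coefD coefMX coefC/= addr0.
by rewrite coefB coefX coefC subr0.
Qed.

Lemma ev_quad z w : ev (quad z) w =
  (complex_of_pair w - complex_of_pair z) * (complex_of_pair w - (complex_of_pair z)^*).
Proof.
rewrite /quad evMXaddC evD -polyCN evC evX; case: z => a b; case: w => c d.
apply/eqP; rewrite eq_complex/=; apply/andP; split; apply/eqP; ring.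
Qed.

(* For G = (X^2 - 2xX + x^2 + y^2) t, the lower two coefficients of G are recovered
   from the others and G(z) = 0, and G'(z) = 2iy t(z). *)
Section product.
Variables (n : nat) (t : n.-tuple R) (z : Z).
Let q := quad z * Poly t.
Let b := high (quad z) t.
Let H := Poly b * 'X * 'X.
Hypothesis z20 : z.2 != 0.

Lemma quad_mulE : q = (q`_1)%:P * 'X + H + (q`_0)%:P.
Proof.
have sq : (size q <= n.+2)%N.
  apply: leq_trans (size_polyMleq _ _) _; rewrite size_quad /=.
  by rewrite !ltnS; apply: leq_trans (size_Poly _) _; rewrite size_tuple.
apply/polyP => i; rewrite !coefD !coefMX !coefC; case: i => [|[|i]]/=.
- by rewrite !add0r.
- by rewrite !addr0.
rewrite add0r addr0 coef_Poly; have [ni|ni] := ltnP i n.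
  by rewrite nth_high// size_quad/= addn2.
have -> : q`_i.+2 = 0 by apply: nth_default; exact: leq_trans sq _.
by apply/esym/nth_default; rewrite size_map size_enum_ord.
Qed.

Lemma ev_quad_mul : ev q z = 0.
Proof. by rewrite evM ev_quad subrr !mul0r. Qed.

Lemma quad_mul_coef1 : q`_1 = - imK H z / z.2.
Proof.
have : imK q z = 0 by rewrite /imK ev_quad_mul.
rewrite {1}quad_mulE !imKD imKMX reKC !imKC mul0r !addr0 => /eqP.
by rewrite addr_eq0 => /eqP <-; rewrite mulfK.
Qed.

Lemma quad_mul_coef0 : q`_0 = - reK ((q`_1)%:P * 'X + H) z.
Proof.
have : reK q z = 0 by rewrite /reK ev_quad_mul.
by rewrite {1}quad_mulE reKD reKC => /eqP; rewrite addrC addr_eq0 => /eqP.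
Qed.

Lemma ev_quad_mul_deriv : ev ((q`_1)%:P * 'X + H)^`() z = (0 +i* (2 * z.2)) * ev (Poly t) z.
Proof.
transitivity (ev q^`() z); first by rewrite [in RHS]quad_mulE [in RHS]derivD derivC addr0.
rewrite /q derivM evD !evM ev_quad subrr !mul0r addr0; congr (_ * _).
rewrite /quad derivMXaddC derivXsubC mul1r evD evX evD -polyCN evC evX.
by case: (z) => x y /=; apply/eqP; rewrite eq_complex/=; apply/andP; split; apply/eqP; ring.
Qed.

(** As G'(z) = 2 i y t(z), both Im H' and Im K' equal 2 y Re t(z) and cancel between the two
    factors. If Re t(z) = 0 there is nothing to cancel: division by zero gives 0, whence the case
    distinction. *)
Lemma quad_mul_jac : 0 < z.2 ->
  `|imK H^`() z| / z.2 * jac ((q`_1)%:P * 'X + H) z =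
  if reK (Poly t) z == 0 then 0 else 4 * z.2 * normc (ev (Poly t) z) ^+ 2.
Proof.
move=> z2; have h := ev_quad_mul_deriv; set K := (_ * 'X + H) in h *.
have hr : reK K^`() z = - (2 * z.2 * imK (Poly t) z).
  by rewrite /reK h cReM /= mul0r sub0r.
have hi : imK K^`() z = 2 * z.2 * reK (Poly t) z.
  by rewrite /imK h cImM /= mul0r add0r.
have hH : imK H^`() z = imK K^`() z.
  by rewrite /K derivD imKD derivM derivC mul0r add0r derivX mulr1 imKC add0r.
rewrite /jac hH hr hi; case: eqP => [->|/eqP r0].
  by rewrite mulr0 normr0 invr0 !mulr0.
rewrite normc_sqr -/(reK _ _) -/(imK _ _) normrM [ `|2 * z.2|]gtr0_norm ?mulr_gt0//.
have r1 : `|reK (Poly t) z| != 0 by rewrite normr_eq0.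
by field; rewrite r1.
Qed.

End product.
End quad.

Lemma integral_lebesgue_complex (R : realType) (f : R * R -> \bar R) :
  (forall z, (0 <= f z)%E) -> measurable_fun setT f ->
  (\int[@lebesgue_complex R]_w f (pair_of_complex w) =
   \int[@lebesgue_measure R \x @lebesgue_measure R]_z f z)%E.
Proof.
move=> f0 mf; have mc := @measurable_complex_of_pair R.
have mfp : measurable_fun setT (fun w : R[i] => f (pair_of_complex w)).
  exact: (measurableT_comp mf (@measurable_pair_of_complex R)).
have h := @ge0_integral_pushforward _ _ (measurableTypeR R * measurableTypeR R)%type R[i] R
  (@complex_of_pair R) mc (@lebesgue_measure R \x @lebesgue_measure R)%E setT _ measurableT mfp.
transitivity (\int[pushforward (@lebesgue_measure R \x @lebesgue_measure R) (@complex_of_pair R)]_w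
    f (pair_of_complex w))%E.
  exact: eq_measure_integral.
rewrite h ?preimage_setT//; apply: eq_integral => z _ /=.
by rewrite complex_of_pairK.
Qed.

Section complex_step.
Context {R : realType}.
Local Notation RT := (measurableTypeR R).
Local Notation lam n := (power_measure (@lebesgue_measure R) n).
Local Notation mu := (@lebesgue_measure R).
Local Notation Z := (R * R)%type.

Let Hp n (b : n.-tuple R) : {poly R} := Poly b * 'X * 'X.
Let Kp n (c : R) (b : n.-tuple R) : {poly R} := c%:P * 'X + Hp b.
(** With b = (a_2, ..., a_n) given, [cz b z] and [az b z] are the values of a_1 and a_0 for which z
    is a root. *)
Let cz n (b : n.-tuple R) (z : Z) : R := - imK (Hp b) z / z.2.
Let az n (b : n.-tuple R) (z : Z) : R := - reK (Kp (cz b z) b) z.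

Let measurable_half_plane : measurable [set z : Z | 0 < z.2].
Proof.
have m2 : measurable_fun setT (snd : Z -> R) by exact: measurable_snd.
rewrite (_ : mkset _ = setT `&` snd @^-1` `]0, +oo[); first exact: m2.
by rewrite setTI; apply/seteqP; split => z /=; rewrite in_itv/= andbT.
Qed.

Let measurable_Hp d (Th : measurableType d) n (b : Th -> n.-tuple R) (z : Th -> Z) :
  measurable_fun setT b -> measurable_fun setT z ->
  [/\ measurable_fun setT (fun t => reK (Hp (b t)) (z t)),
   measurable_fun setT (fun t => imK (Hp (b t)) (z t)),
   measurable_fun setT (fun t => reK (Hp (b t))^`() (z t)) &
   measurable_fun setT (fun t => imK (Hp (b t))^`() (z t))].
Proof.
move=> mb mz.
have m0 : measurable_fun setT (fun t => [tuple of 0 :: [tuple of 0 :: b t]] : n.+2.-tuple R).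
  apply: measurable_cons; first exact: measurable_cst.
  by apply: measurable_cons => //; exact: measurable_cst.
have := measurable_reim_Poly m0 mz.
have E t : Poly [tuple of 0 :: [tuple of 0 :: b t]] = Hp (b t).
  by rewrite !Poly_cons !addr0.
move=> [h1 h2 h3 h4]; split.
- by apply: eq_measurable_fun h1 => t _; rewrite E.
- by apply: eq_measurable_fun h2 => t _; rewrite E.
- by apply: eq_measurable_fun h3 => t _; rewrite E.
- by apply: eq_measurable_fun h4 => t _; rewrite E.
Qed.

Let KpE n c (b : n.-tuple R) z :
  [/\ reK (Kp c b) z = c * z.1 + reK (Hp b) z, imK (Kp c b) z = c * z.2 + imK (Hp b) z,
   reK (Kp c b)^`() z = c + reK (Hp b)^`() z & imK (Kp c b)^`() z = imK (Hp b)^`() z].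
Proof.
have K' : (Kp c b)^`() = c%:P + (Hp b)^`().
  by rewrite /Kp derivD derivM derivC mul0r add0r derivX mulr1.
rewrite K' !reKD !imKD reKMX imKMX !reKC !imKC; split => //.
- by rewrite mul0r subr0.
- by rewrite mul0r addr0.
- by rewrite add0r.
Qed.

(* The hyperplane Re t(z) = 0 is null: solve for the constant coefficient of t. *)
Lemma integral_off_hyperplane n (h1 h2 : n.-tuple RT -> \bar R) (z : Z) :
  (forall t, (0 <= h1 t)%E) -> (forall t, (0 <= h2 t)%E) ->
  measurable_fun setT h1 -> measurable_fun setT h2 ->
  (forall t : n.-tuple RT, Poly t = 0 -> h1 t = h2 t) ->
  (forall t : n.-tuple RT, reK (Poly t) z != 0 -> h1 t = h2 t) ->
  (\int[lam n]_t h1 t = \int[lam n]_t h2 t)%E.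
Proof.
case: n h1 h2 => [|n] h1 h2 h10 h20 m1 m2 h0 h12.
  (* For n = 0 there is no constant coefficient to solve for and the measure is a Dirac mass, so the
     values at t = 0 must agree. *)
  by apply: eq_integral => t _; apply: h0; rewrite (tuple0 t).
rewrite (integral_powerS_swap _ h10 m1) (integral_powerS_swap _ h20 m2).
apply: eq_integral => t _; apply: ge0_ae_eq_integral => //.
- exact: measurable_fun_consl.
- exact: measurable_fun_consl.
exists [set - reK (Poly t * 'X) z]; split.
- exact: measurable_set1.
- exact: lebesgue_measure_set1.
- move=> x /= nx; apply: contrapT => xn; apply: nx => _; apply: h12.
  rewrite Poly_cons reKD reKC; apply/eqP => /eqP; rewrite addrC addr_eq0 => /eqP.
  exact: xn.
Qed.

Let measurable_cz d (Th : measurableType d) n (b : Th -> n.-tuple R) (z : Th -> Z) :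
  measurable_fun setT b -> measurable_fun setT z ->
  [/\ measurable_fun setT (fun t => cz (b t) (z t)),
   measurable_fun setT (fun t => az (b t) (z t)) &
   measurable_fun setT (fun t => jac (Kp (cz (b t) (z t)) (b t)) (z t))].
Proof.
move=> mb mz; have [h1 h2 h3 h4] := measurable_Hp mb mz.
have m1 : measurable_fun setT (fun t => (z t).1) by exact: (measurableT_comp measurable_fst mz).
have m2 : measurable_fun setT (fun t => (z t).2) by exact: (measurableT_comp measurable_snd mz).
have mc : measurable_fun setT (fun t => cz (b t) (z t)).
  rewrite /cz; apply: measurable_funM; first exact: measurableT_comp.
  by apply: (measurableT_comp measurable_invr).
split => //.
- rewrite /az; apply: measurableT_comp => //.
  rewrite (_ : (fun t => _) = fun t => cz (b t) (z t) * (z t).1 + reK (Hp (b t)) (z t)).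
    by apply: measurable_funD => //; exact: measurable_funM.
  by apply/funext => t; have [] := KpE (cz (b t) (z t)) (b t) (z t).
- rewrite (_ : (fun t => _) = fun t => ((cz (b t) (z t) + reK (Hp (b t))^`() (z t)) ^+ 2 +
     imK (Hp (b t))^`() (z t) ^+ 2) / `|imK (Hp (b t))^`() (z t)|).
    apply: measurable_funM.
      by apply: measurable_funD; apply: measurable_funX => //; exact: measurable_funD.
    by apply: (measurableT_comp measurable_invr); exact: measurableT_comp.
  by apply/funext => t; rewrite /jac; have [_ _ -> ->] := KpE (cz (b t) (z t)) (b t) (z t).
Qed.

(** The parameter t stands for (a_1, y), and the zeros are the points at height y of the curve Im K
    = 0; the value 1 excludes y <= 0. *)
Let family (n : nat) (b : n.-tuple R) (t z : Z) : R :=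
  if 0 < t.2 then `|imK (Kp t.1 b) z| + `|z.2 - t.2| else 1.

Let familyE n (b : n.-tuple R) t : [set z | family b t z = 0] =
  [set z | [/\ 0 < t.2, z.2 = t.2 & imK (Kp t.1 b) z = 0]].
Proof.
apply/seteqP; split => z; rewrite /family/=; case: ifPn => // t0.
- by move=> /normD_eq0[-> /eqP]; rewrite subr_eq0 => /eqP.
- by move=> /eqP; rewrite oner_eq0.
- by move=> [_ -> ->]; rewrite subrr normr0 addr0.
- by case.
Qed.

Let size_Kp n c (b : n.-tuple R) : Poly b != 0 -> size (Kp c b) = (size (Poly b)).+2.
Proof.
move=> b0; have sH : size (Hp b) = (size (Poly b)).+2.
  by rewrite /Hp !size_mulX ?mulf_neq0 ?polyX_eq0.
rewrite /Kp addrC size_polyDl// sH; apply: leq_ltn_trans (size_polyMleq _ _) _.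
rewrite size_polyX addn2/= ltnS size_polyC.
by rewrite ltnS; apply: leq_trans (leq_b1 _) _; rewrite size_poly_gt0.
Qed.

Let measurable_family n (b : n.-tuple R) (F : Z * Z -> \bar R) : Poly b != 0 ->
  (forall q, (0 <= F q)%E) -> measurable_fun setT F ->
  measurable_fun setT (fun t : RT * RT => zsum [set z | family b t z = 0] (fun z => F (t, z))).
Proof.
move=> b0 F0 mF.
apply: (@measurable_zsum _ _ (RT * RT)%type (family b) (size (Poly b)).+2) => //.
- move=> z; rewrite /family.
  have m1 : measurable_fun setT (fst : RT * RT -> R) by exact: measurable_fst.
  have m2 : measurable_fun setT (snd : RT * RT -> R) by exact: measurable_snd.
  apply: measurable_fun_ifT => //.
    by apply: measurable_fun_ltr => //.
  apply: measurable_funD; apply: measurableT_comp => //; last exact: measurable_funB.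
  rewrite (_ : (fun t => _) = fun t : RT * RT => t.1 * z.2 + imK (Hp b) z).
    by apply: measurable_funD => //; exact: measurable_funM.
  by apply/funext => t; have [] := KpE t.1 b z.
- move=> t; have [t0|t0] := boolP (0 < t.2); last first.
    rewrite (_ : family b t = cst 1); first by move=> z; exact: cvg_cst.
    by apply/funext => z; rewrite /family (negbTE t0).
  rewrite (_ : family b t = fun z => `|imK (Kp t.1 b) z| + `|z.2 - t.2|); last first.
    by apply/funext => z; rewrite /family t0.
  apply: continuous_normD => z; first exact: (continuous_reim _).2.
  by apply: cvgB; [exact: cvg_snd|exact: cvg_cst].
- move=> t; rewrite /family; have [t0|t0] := boolP (0 < t.2); last first.
    by exists [::] => // z /eqP; rewrite oner_eq0.
  have [||s ss sP] := @imK_line_roots _ (Kp t.1 b) t.2 => //; first by rewrite gt_eqF.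
    by rewrite size_Kp.
  exists (map (fun x => (x, t.2)) s); first by rewrite size_map ltnW// -(size_Kp t.1 b0).
  move=> z /normD_eq0[zK /eqP]; rewrite subr_eq0 => /eqP zt.
  apply/mapP; exists z.1; last by rewrite -zt -surjective_pairing.
  by apply: sP; rewrite -zt -surjective_pairing.
Qed.

Section density.
Variables (n : nat) (Psi : n.+2.-tuple RT * Z -> \bar R).
Hypotheses (P0 : forall q, (0 <= Psi q)%E) (mP : measurable_fun setT Psi).

(** The integrand in the variables (b, z) = (a_2, ..., a_n, z) after both changes of variables: the
    factor with H' stems from a_1, the factor [jac] from a_0. *)
Let W (b : n.-tuple RT) (z : Z) : \bar R :=
  (((`|imK (Hp b)^`() z| / z.2 * jac (Kp (cz b z) b) z)%:E *
    Psi ([tuple of az b z :: [tuple of cz b z :: b]], z)) : \bar R)%E.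

Let WT (q : n.-tuple RT * Z) : \bar R :=
  ((fun q => W q.1 q.2) \_ [set q | (0 < q.2.2)%R]) q.

Let jac_ge0 (p : {poly R}) (z : Z) : 0 <= jac p z.
Proof. by rewrite /jac divr_ge0// addr_ge0 ?sqr_ge0. Qed.

Let WT_ge0 q : (0 <= WT q)%E.
Proof.
rewrite /WT patchE; case: ifPn => // /[!inE] /= z0.
by rewrite /W mule_ge0// lee_fin mulr_ge0 ?jac_ge0// divr_ge0// ltW.
Qed.

Let measurable_WT : measurable_fun setT WT.
Proof.
have m1 : measurable_fun setT (fst : n.-tuple RT * Z -> n.-tuple R) by exact: measurable_fst.
have m2 : measurable_fun setT (snd : n.-tuple RT * Z -> Z) by exact: measurable_snd.
have m22 : measurable_fun setT (fun q : n.-tuple RT * Z => q.2.2).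
  exact: (measurableT_comp measurable_snd m2).
have [_ _ _ h] := measurable_Hp m1 m2.
have [c1 c2 c3] := measurable_cz m1 m2.
apply: measurable_patch.
  by rewrite -[X in measurable X]setTI; exact: (m2 measurableT _ measurable_half_plane).
apply: emeasurable_funM.
  apply/measurable_EFinP; apply: measurable_funM => //; apply: measurable_funM.
    exact: measurableT_comp.
  exact: (measurableT_comp measurable_invr).
apply: (measurableT_comp mP); apply/measurable_fun_pairP; split => //.
by apply: measurable_cons => //; exact: measurable_cons.
Qed.

(** For fixed b, [complex_root_formula] replaces a_0 by the ordinate y, and [line_root_formula] then
    replaces a_1 by the abscissa. The second needs y fixed and a_1 varying, so a_1 and y are
    interchanged in between. *)
Let inner (b : n.-tuple RT) :
  (\int[mu]_c \int[mu]_x zsum (zroots (Poly [tuple of x :: [tuple of c :: b]]))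
      ((fun z => Psi ([tuple of x :: [tuple of c :: b]], z)) \_ [set z | (0 < z.2)%R]) =
   \int[mu]_y \int[mu]_x WT (b, (x, y)))%E.
Proof.
(* A nonzero real polynomial of degree at most 1 has no root in the upper half-plane, and [zroots]
   gives none to the zero polynomial; the right-hand side contains the factor Im H' = 0. *)
have [b0|b0] := eqVneq (Poly b) 0.
  rewrite [RHS]integral0_eq; last first.
    move=> y _; apply: integral0_eq => x _; rewrite /WT patchE; case: ifPn => // _.
    by rewrite /W /Hp /= b0 !mul0r deriv0 /imK ev0 normr0 !mul0r mul0e.
  apply: integral0_eq => c _; apply: integral0_eq => x _.
  have -> : Poly [tuple of x :: [tuple of c :: b]] = c%:P * 'X + x%:P.
    by rewrite !Poly_cons b0 mul0r add0r.
  rewrite /zsum; apply: integral0_eq => z.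
  rewrite /zroots patchE; case: ifPn => // pn0 pz.
  case: ifPn => // /[!inE] /= z0; exfalso; move: pn0.
  move/ev_eq0: pz.
  rewrite reKD imKD reKMX imKMX !reKC !imKC mul0r subr0 mul0r !addr0 => -[+ /eqP].
  rewrite mulf_eq0 (gt_eqF z0) orbF => + /eqP c0.
  by rewrite c0 mul0r add0r => ->; rewrite mul0r addr0 eqxx.
have sK c : (2 < size (Kp c b))%N by rewrite size_Kp// !ltnS size_poly_gt0.
pose f c z := Psi ([tuple of (- reK (Kp c b) z)%R :: [tuple of c :: b]], z).
have mf : measurable_fun setT (fun q : RT * Z => f q.1 q.2).
  have m2 : measurable_fun setT (snd : RT * Z -> Z) by exact: measurable_snd.
  apply: (measurableT_comp mP); apply/measurable_fun_pairP; split => //.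
  apply: measurable_cons; last first.
    by apply: measurable_cons => //; exact: measurable_cst.
  apply: measurableT_comp => //.
  have [h1 _ _ _] := @measurable_Hp _ (RT * Z)%type n (fun=> b) snd (measurable_cst b) m2.
  rewrite (_ : (fun q => _) = fun q : RT * Z => q.1 * q.2.1 + reK (Hp b) q.2).
    apply: measurable_funD => //; apply: measurable_funM; first exact: measurable_fst.
    exact: (measurableT_comp measurable_fst m2).
  by apply/funext => q; have [] := KpE q.1 b q.2.
pose V (q : Z * Z) := ((fun q : Z * Z => (jac (Kp q.1.1 b) q.2)%:E * f q.1.1 q.2)
  \_ [set q | imK (Hp b)^`() q.2 != 0%R])%E q.
have V0 q : (0 <= V q)%E.
  by rewrite /V patchE; case: ifPn => // _; rewrite mule_ge0// ?lee_fin ?jac_ge0//; exact: P0.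
have mV : measurable_fun setT V.
  have m2 : measurable_fun setT (snd : Z * Z -> Z) by exact: measurable_snd.
  have m11 : measurable_fun setT (fun q : Z * Z => q.1.1).
    exact: (measurableT_comp measurable_fst measurable_fst).
  have [_ _ h3 h4] := @measurable_Hp _ (Z * Z)%type n (fun=> b) snd (measurable_cst b) m2.
  apply: measurable_patch.
    rewrite (_ : mkset _ = setT `&` (fun q : Z * Z => imK (Hp b)^`() q.2) @^-1` (~` [set 0])).
      by apply: h4 => //; apply: measurableC; exact: measurable_set1.
    by rewrite setTI; apply/seteqP; split => q /= /eqP.
  apply: emeasurable_funM; last first.
    have m3 : measurable_fun setT (fun q : Z * Z => (q.1.1, q.2)).
      exact/measurable_fun_pairP.
    exact: (measurableT_comp mf m3).
  apply/measurable_EFinP.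
  rewrite (_ : (fun q => _) = fun q : Z * Z => ((q.1.1 + reK (Hp b)^`() q.2) ^+ 2 +
     imK (Hp b)^`() q.2 ^+ 2) / `|imK (Hp b)^`() q.2|).
    apply: measurable_funM.
      by apply: measurable_funD; apply: measurable_funX => //; exact: measurable_funD.
    by apply: (measurableT_comp measurable_invr); exact: measurableT_comp.
  by apply/funext => q; rewrite /jac; have [_ _ -> ->] := KpE q.1.1 b q.2.
pose Q (t : RT * RT) := zsum [set z | family b t z = 0] (fun z => V (t, z)).
have Q0 t : (0 <= Q t)%E by exact: zsum_ge0.
have mQ : measurable_fun setT Q by exact: measurable_family.
transitivity (\int[mu]_c \int[mu]_y Q (c, y))%E.
  apply: eq_integral => c _.
  transitivity (\int[mu]_x zsum (zset (Kp c b + x%:P)) (f c \_ [set z | (0 < z.2)%R]))%E.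
    apply: eq_integral => x _.
    rewrite !Poly_cons (_ : (Poly b * 'X + c%:P) * 'X = Kp c b); last first.
      by rewrite /Kp /Hp mulrDl addrC.
    have -> : zroots (Kp c b + x%:P) = zset (Kp c b + x%:P).
      rewrite (_ : Kp c b = (Poly b * 'X + c%:P) * 'X); last by rewrite /Kp /Hp mulrDl addrC.
      apply: zroots_cons; apply/eqP => /(congr1 (fun q : {poly R} => size q)).
      by rewrite size_MXaddC (negbTE b0) size_poly0.
    apply: eq_zsum => z /ev_eq0[]; rewrite reKD reKC => /eqP.
    rewrite addrC addr_eq0 => /eqP -> _.
    by rewrite /f !patchE.
  have f0 z : (0 <= f c z)%E by exact: P0.
  have mfc : measurable_fun setT (f c) by exact: (measurableT_comp mf (pair1_measurable c)).
  rewrite (complex_root_formula (sK c) f0 mfc).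
  apply: eq_integral => y _; rewrite /Q familyE; apply: eq_zsum => z [/= y0 zy kz].
  rewrite /V !patchE /=; have [_ _ _ E] := KpE c b z.
  by congr (if _ then _ else _); apply/idP/idP => /[!inE]/=; rewrite E.
(* Exchange of a_1 and y. *)
rewrite (fubini_tonelli Q mQ Q0); apply: eq_integral => y _.
have [y0|y0] := boolP (0 < y); last first.
  rewrite [RHS]integral0_eq; last first.
    by move=> x _; rewrite /WT patchE; case: ifPn => // /[!inE]/=; rewrite (negbTE y0).
  apply: integral0_eq => c _; rewrite /Q familyE (_ : mkset _ = set0) ?zsum0//.
  by rewrite -subset0 => z [/=]; rewrite (negbTE y0).
pose f2 z := ((jac (Kp (cz b z) b) z)%:E * Psi ([tuple of az b z :: [tuple of cz b z :: b]], z))%E.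
have sH : (2 < size (Hp b))%N.
  by rewrite /Hp !size_mulX ?mulf_neq0 ?polyX_eq0// !ltnS size_poly_gt0.
transitivity (\int[mu]_c zsum [set z | z.2 = y /\ imK (c%:P * 'X + Hp b) z = 0%R]
             (f2 \_ [set z | imK (Hp b)^`() z != 0%R]))%E.
  apply: eq_integral => c _; rewrite /Q familyE.
  rewrite (_ : mkset _ = [set z | z.2 = y /\ imK (c%:P * 'X + Hp b) z = 0%R]); last first.
    by apply/seteqP; split => z /= [].
  apply: eq_zsum => z [/= zy kz].
  (* On the curve Im K = 0 the coefficient a_1 is determined by z, so the integrand can be written
     without it. *)
  have cE : cz b z = c.
    have [_ k2 _ _] := KpE c b z; move: kz; rewrite -/(Kp c b) k2 => /eqP.
    rewrite addr_eq0 => /eqP h; rewrite /cz -h mulfK// zy gt_eqF//.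
  rewrite /V /f2 !patchE /f /az cE/=.
  by congr (if _ then _ else _); apply/idP/idP => /[!inE].
have f20 z : (0 <= f2 z)%E by rewrite /f2 mule_ge0// lee_fin jac_ge0.
have mf2 : measurable_fun setT f2.
  have [c1 c2 c3] := measurable_cz (measurable_cst b : measurable_fun setT (fun _ : Z => b)) (@measurable_id _ Z setT).
  apply: emeasurable_funM; first exact/measurable_EFinP.
  apply: (measurableT_comp mP); apply/measurable_fun_pairP.
  split; last exact: measurable_id.
  by apply: measurable_cons => //; apply: measurable_cons => //; exact: measurable_cst.
rewrite (line_root_formula y0 sH f20 mf2).
apply: eq_integral => x _; rewrite /WT patchE mem_set//= /W /f2/=.
by rewrite EFinM muleA.
Qed.

Let quad_WT (t : n.-tuple RT) (z : Z) : 0 < z.2 -> reK (Poly t) z != 0 ->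
  WT (high (quad z) t, z) =
  ((4 * z.2 * normc (ev (Poly t) z) ^+ 2)%:E * Psi (mulp (quad z) n.+2 t, z))%E.
Proof.
move=> z0 r0; have z20 : z.2 != 0 by rewrite gt_eqF.
have c1 : cz (high (quad z) t) z = (quad z * Poly t)`_1 by rewrite quad_mul_coef1.
have a1 : az (high (quad z) t) z = (quad z * Poly t)`_0.
  by rewrite /az c1 quad_mul_coef0.
rewrite /WT patchE mem_set//= /W a1 c1 quad_mul_jac// (negbTE r0).
congr (_ * Psi (_, _))%E; apply: eq_from_tnth => i; rewrite tnth_mktuple.
case: (unliftP ord0 i) => [j ->|->]; rewrite ?tnthS ?tnth0//.
case: (unliftP ord0 j) => [m ->|->]; rewrite ?tnthS ?tnth0//.
by rewrite tnth_mktuple size_quad/= /bump/= !add1n addn2.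
Qed.

Lemma complex_step :
  (\int[lam n.+2]_a zsum (zroots (Poly a)) ((fun z => Psi (a, z)) \_ [set z | (0 < z.2)%R]) =
   \int[@lebesgue_complex R]_(w in @upper_half_plane R) \int[lam n]_t
     ((4 * (pair_of_complex w).2 * normc (ev (Poly t) (pair_of_complex w)) ^+ 2)%:E *
      Psi (mulp (quad (pair_of_complex w)) n.+2 t, pair_of_complex w)))%E.
Proof.
pose F (q : n.+2.-tuple RT * Z) := (Psi \_ [set q | (0 < q.2.2)%R]) q.
have F0 q : (0 <= F q)%E by rewrite /F patchE; case: ifPn.
have FE a : (fun z => Psi (a, z)) \_ [set z | (0 < z.2)%R] = fun z => F (a, z).
  by apply/funext => z; rewrite /F !patchE; congr (if _ then _ else _);
    apply/idP/idP => /[!inE].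
have mF : measurable_fun setT F.
  apply: measurable_patch => //.
  have m2 : measurable_fun setT (snd : n.+2.-tuple RT * Z -> Z) by exact: measurable_snd.
  by rewrite -[X in measurable X]setTI; exact: (m2 measurableT _ measurable_half_plane).
pose S (a : n.+2.-tuple RT) := zsum (zroots (Poly a)) (fun z => F (a, z)).
have S0 a : (0 <= S a)%E by exact: zsum_ge0.
have mS : measurable_fun setT S.
  exact: (@measurable_zsum_zroots _ _ (n.+2.-tuple RT) n.+2 id F).
transitivity (\int[lam n.+2]_a S a)%E.
  by apply: eq_integral => a _; rewrite FE.
rewrite (integral_powerS_swap _ S0 mS).
rewrite integral_powerS_swap; first last.
- exact: measurable_integral_cons.
- by move=> t; exact: integral_ge0.
pose lc := @lebesgue_complex R.
have mpc := @measurable_pair_of_complex R.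
pose V (q : n.-tuple RT * R[i]) := WT (q.1, pair_of_complex q.2).
have V0 q : (0 <= V q)%E by exact: WT_ge0.
have mV : measurable_fun setT V.
  apply: (measurableT_comp measurable_WT); apply/measurable_fun_pairP; split.
    exact: measurable_fst.
  exact: (measurableT_comp mpc measurable_snd).
transitivity (\int[lam n]_b \int[lc]_w V (b, w))%E.
  apply: eq_integral => b _.
  have mWb : measurable_fun setT (fun z : RT * RT => WT (b, z)).
    exact: (measurableT_comp measurable_WT (pair1_measurable b)).
  transitivity (\int[mu]_y \int[mu]_x WT (b, (x, y)))%E.
    rewrite -inner; apply: eq_integral => c _; apply: eq_integral => x _.
    by rewrite FE.
  have WTb0 z : (0 <= WT (b, z))%E by exact: WT_ge0.
  transitivity (\int[mu \x mu]_z WT (b, z))%E.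
    exact/esym/(@fubini_tonelli2 _ _ RT RT R mu mu (fun z => WT (b, z)) mWb WTb0).
  exact/esym/(integral_lebesgue_complex WTb0 mWb).
rewrite (fubini_tonelli V mV V0) [RHS]integral_mkcond.
apply: eq_integral => w _; rewrite patchE; set z := pair_of_complex w.
have wz : (w \in @upper_half_plane R) = (0 < z.2) by apply/idP/idP => /[!inE].
rewrite wz; have [z0|z0] := boolP (0 < z.2); last first.
  apply: integral0_eq => b _; rewrite /V /WT patchE; case: ifPn => // /[!inE]/= h.
  by rewrite -/z h in z0.
have mq i : measurable_fun setT (fun _ : n.-tuple RT => (quad z)`_i) by exact: measurable_cst.
have mVw : measurable_fun setT (fun b : n.-tuple RT => WT (b, z)).
  exact: (measurableT_comp measurable_WT (pair2_measurable z)).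
transitivity (\int[lam n]_t WT (high (quad z) t, z))%E.
  by rewrite (integral_high (quad_monic z) (fun b => WT_ge0 (b, z)) mVw).
pose h2 (t : n.-tuple RT) := ((4 * z.2 * normc (ev (Poly t) z) ^+ 2)%:E *
  Psi (mulp (quad z) n.+2 t, z))%E.
have h20 t : (0 <= h2 t)%E by rewrite mule_ge0// lee_fin mulr_ge0 ?sqr_ge0// mulr_ge0// ltW.
have mh1 : measurable_fun setT (fun t : n.-tuple RT => WT (high (quad z) t, z)).
  apply: (measurableT_comp mVw).
  exact: (@measurable_high _ _ (n.-tuple RT) (fun=> quad z) 3 n id (fun=> size_quad z)).
have mh2 : measurable_fun setT h2.
  apply: emeasurable_funM.
    apply/measurable_EFinP; apply: measurable_funM; first exact: measurable_cst.
    have [e1 e2 _ _] := @measurable_reim_Poly _ _ (n.-tuple RT) n id (fun=> z)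
      (@measurable_id _ (n.-tuple RT) setT) (measurable_cst z).
    rewrite (_ : (fun t => _) = fun t : n.-tuple RT => reK (Poly t) z ^+ 2 + imK (Poly t) z ^+ 2).
      by apply: measurable_funD; exact: measurable_funX.
    by apply/funext => t; rewrite normc_sqr.
  apply: (measurableT_comp mP); apply/measurable_fun_pairP.
  split; last exact: measurable_cst.
  apply/measurable_fun_tnthP => i.
  rewrite (_ : _ \o _ = fun t : n.-tuple RT => (quad z * Poly t)`_i); last first.
    by apply/funext => t /=; rewrite tnth_mktuple.
  apply: measurable_coefM => // j.
  exact: (@measurable_coef _ _ (n.-tuple RT) n id).
(* If Re t(z) = 0 the left integrand is 0 by the convention for division, while the right one need
   not be. At t = 0 both vanish, which settles the case n = 0. *)
apply: (integral_off_hyperplane _ h20 mh1 mh2 _ (z := z)).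
- by move=> t; exact: WT_ge0.
- move=> t t0; rewrite /h2 t0 ev0 normc0 expr0n/= mulr0 mul0e /WT patchE.
  case: ifPn => // _; rewrite /W /Hp /= (_ : Poly (high (quad z) t) = 0).
    by rewrite !mul0r deriv0 /imK ev0 normr0 !mul0r mul0e.
  apply/polyP => i; rewrite coef0 coef_Poly; have [ni|ni] := ltnP i n.
    by rewrite nth_high// t0 mulr0 coef0.
  by rewrite nth_default// size_tuple.
- by move=> t t0; rewrite quad_WT.
Qed.

End density.
End complex_step.

(** * Splitting off all the roots *)

Section root_counts.
Context {R : realType}.
Local Notation RT := (measurableTypeR R).
Local Notation Z := (R * R)%type.
Implicit Types (D p : {poly R}) (S : set Z).

Definition root_count p S : \bar R := counting (zroots p `&` S).

Lemma measurable_zroots p : measurable (zroots p).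
Proof.
rewrite /zroots; case: ifPn => [_|p0]; first exact: measurable0.
apply: countable_measurable => [z|]; first exact: measurable_point.
exact: countable_zset.
Qed.

Lemma mul_root_count (c : \bar R) p S : measurable S -> (0 <= c)%E ->
  (c * root_count p S = zsum (zroots p) (fun z => c * (\1_S z)%:E))%E.
Proof.
move=> mS c0; have mz := measurable_zroots p.
have m1 : measurable_fun (zroots p) (fun z => (\1_S z)%:E : \bar R).
  by apply: measurable_funTS; apply/measurable_EFinP; exact: measurable_indic.
rewrite /zsum ge0_integralZl//.
by rewrite integral_indic// setIC.
Qed.

Lemma measurable_root_count d (Th : measurableType d) n S (a : Th -> n.-tuple R) :
  measurable S -> measurable_fun setT a ->
  measurable_fun setT (fun t => root_count (Poly (a t)) S).
Proof.
move=> mS ma.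
rewrite (_ : (fun t => _) = fun t => zsum (zroots (Poly (a t))) (fun z => (\1_S z)%:E)).
  apply: (measurable_zsum_zroots (F := fun q => (\1_S q.2)%:E)) => //.
  apply/measurable_EFinP; exact: (measurableT_comp (measurable_indic mS) measurable_snd).
apply/funext => t; rewrite -[LHS]mul1e mul_root_count//.
by apply: eq_zsum => z _; rewrite mul1e.
Qed.

Lemma root_count_ge0 p S : (0 <= root_count p S)%E.
Proof. exact: measure_ge0. Qed.

Lemma root_countM D p S : (forall z, S z -> ev D z != 0) ->
  root_count (D * p) S = root_count p S.
Proof.
move=> DS; rewrite /root_count; congr counting; apply/seteqP; split => z [+ Sz].
  rewrite /zroots mulf_eq0; case: ifPn => //; rewrite negb_or => /andP[_ p0].
  rewrite /zset/= evM => /eqP; rewrite mulf_eq0 (negbTE (DS _ Sz)) /= => /eqP pz.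
  by rewrite /setI/= (negbTE p0).
rewrite /zroots; case: ifPn => // p0; rewrite /zset/= => pz.
have D0 : D != 0 by apply: contraTN (DS _ Sz) => /eqP ->; rewrite ev0 eqxx.
by rewrite mulf_eq0 (negbTE D0) (negbTE p0) /zset /= evM pz mulr0.
Qed.

Lemma size_mulp_le D n N (t : n.-tuple R) : D != 0 -> (size D + n <= N.+1)%N ->
  (size (D * Poly t)%R <= N)%N.
Proof.
move=> D0 DN; apply: leq_trans (size_polyMleq _ _) _; rewrite -ltnS.
have h : (size D + size (Poly t) <= N.+1)%N.
  apply: leq_trans DN; rewrite leq_add2l; apply: leq_trans (size_Poly _) _.
  by rewrite size_tuple.
by rewrite prednK// addn_gt0 size_poly_gt0 D0.
Qed.

(** [size] exceeds the degree by one, so the hypothesis says that D t fits into N coefficients. *)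
Lemma Poly_mulp D n N (t : n.-tuple R) : D != 0 -> (size D + n <= N.+1)%N ->
  Poly (mulp D N t) = D * Poly t.
Proof.
move=> D0 DN; apply/polyP => i; rewrite coef_Poly; have [iN|iN] := ltnP i N.
  by rewrite -(tnth_nth 0 (mulp D N t) (Ordinal iN)) tnth_mktuple.
rewrite !nth_default// ?size_tuple//.
by apply: leq_trans iN; exact: size_mulp_le.
Qed.

Lemma mulp_mulp D (E : {poly R}) n N M (t : n.-tuple R) : E != 0 -> (size E + n <= M.+1)%N ->
  mulp D N (mulp E M t) = mulp (D * E) N t.
Proof.
by move=> E0 EM; apply: eq_from_tnth => i; rewrite !tnth_mktuple Poly_mulp// mulrA.
Qed.

Lemma mulp1 n (t : n.-tuple R) : mulp 1 n t = t.
Proof.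
apply: eq_from_tnth => i; rewrite tnth_mktuple mul1r coef_Poly.
by rewrite (tnth_nth 0).
Qed.

Lemma measurable_mulp d (Th : measurableType d) (D : Th -> {poly R}) n N (t : Th -> n.-tuple R) :
  (forall i, measurable_fun setT (fun u => (D u)`_i)) -> measurable_fun setT t ->
  measurable_fun setT (fun u => mulp (D u) N (t u)).
Proof.
move=> mD mt; apply/measurable_fun_tnthP => i.
rewrite (_ : _ \o _ = fun u => (D u * Poly (t u))`_i); last first.
  by apply/funext => u /=; rewrite tnth_mktuple.
by apply: measurable_coefM => // j; exact: measurable_coef.
Qed.

End root_counts.

Section root_products.
Context {R : realType}.
Implicit Types (x : seq R) (z s : seq R[i]).

(** The entries of [mixed_tuple], but for sequences of any length, to which roots can be added one
    by one. *)
Definition root_list x z : seq R[i] := [seq a%:C | a <- x] ++ (z ++ [seq w^* | w <- z]).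

Definition root_poly x z : {poly R} :=
  \prod_(a <- x) ('X - a%:P) * \prod_(w <- z) quad (pair_of_complex w).

Fixpoint vandermonde s : R :=
  if s is u :: s' then \prod_(v <- s') normc (u - v) * vandermonde s' else 1.

(* Up to the factor 2 ^ l, the Jacobian of the map (x, z, p) |-> root_poly x z * p. *)
Definition weight x z (p : {poly R}) : R :=
  vandermonde (root_list x z) * \prod_(w <- root_list x z) normc (ev p (pair_of_complex w)).

Lemma pair_of_complexK : cancel (@pair_of_complex R) (@complex_of_pair R).
Proof. by case. Qed.

Lemma map_root_poly x z : map_poly (real_complex R) (root_poly x z) =
  \prod_(y <- root_list x z) ('X - y%:P).
Proof.
rewrite /root_poly /root_list rmorphM !rmorph_prod big_cat big_map; congr (_ * _).
  by apply: eq_bigr => a _; rewrite rmorphB /= map_polyX map_polyC.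
rewrite big_cat/= big_map -big_split/=; apply: eq_bigr => -[a b] _ /=.
rewrite /quad rmorphD rmorphM rmorphB /= map_polyX !map_polyC /=.
rewrite -[RHS]addr0; apply/eqP; rewrite addr0 -subr_eq0; apply/eqP.
transitivity ((((a +i* b) + (a -i* b)) - (2 * a)%:C)%:P * 'X +
   ((a ^+ 2 + b ^+ 2)%:C - (a +i* b) * (a -i* b))%:P).
  by rewrite !polyCB polyCD polyCM; ring.
have -> : (a +i* b) + (a -i* b) - (2 * a)%:C = 0.
  by apply/eqP; rewrite eq_complex/=; apply/andP; split; apply/eqP; ring.
have -> : (a ^+ 2 + b ^+ 2)%:C - (a +i* b) * (a -i* b) = 0.
  by apply/eqP; rewrite eq_complex/=; apply/andP; split; apply/eqP; ring.
by rewrite mul0r addr0.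
Qed.

Lemma ev_root_poly x z p : ev (root_poly x z) p = \prod_(y <- root_list x z) (complex_of_pair p - y).
Proof.
by rewrite /ev map_root_poly horner_prod; apply: eq_bigr => y _; rewrite hornerXsubC.
Qed.

(** Needed because a new nonreal root enters the list in two places: its conjugate comes after the
    nonreal roots already present. *)
Lemma vandermonde_insert s1 u s2 :
  vandermonde (s1 ++ u :: s2) = vandermonde (u :: s1 ++ s2).
Proof.
elim: s1 => //= v s1 ->; rewrite /= big_cat/= !big_cons !big_cat/= normcB.
ring.
Qed.

Lemma vandermonde_ge0 s : 0 <= vandermonde s.
Proof.
elim: s => //= u s IH; rewrite mulr_ge0// prodr_ge0// => v _; exact: normc_ge0.
Qed.

Lemma weight_ge0 x z p : 0 <= weight x z p.
Proof. by rewrite mulr_ge0 ?vandermonde_ge0// prodr_ge0// => v _; exact: normc_ge0. Qed.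

Lemma normc_prod (I : Type) (r : seq I) (F : I -> R[i]) :
  normc (\prod_(i <- r) F i) = \prod_(i <- r) normc (F i).
Proof.
elim: r => [|i r IH]; first by rewrite !big_nil (normcR 1) normr1.
by rewrite !big_cons normcM IH.
Qed.

(** The factor is the |t(a)| of [real_step], taken at the cofactor t = [root_poly x z * p]: the
    first part of t gives the new row of the Vandermonde product, p gives the new value. *)
Lemma weight_cons_real a x z p :
  weight (a :: x) z p = `|(root_poly x z * p).[a]| * weight x z p.
Proof.
rewrite -normcR -ev_real evM ev_root_poly normcM normc_prod.
rewrite /weight /= big_cons -/(root_list x z) /=.
rewrite (_ : pair_of_complex a%:C = (a, 0))//.
rewrite (_ : complex_of_pair (a, 0) = a%:C)//; ring.
Qed.

Lemma ev_conj (p : {poly R}) (w : R[i]) : ev p (pair_of_complex w^*) = (ev p (pair_of_complex w))^*.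
Proof.
elim/poly_ind: p => [|p c IH]; first by rewrite !ev0 conjc0.
rewrite !evMXaddC IH !pair_of_complexK rmorphD rmorphM /=; congr (_ + _).
by rewrite oppr0.
Qed.

Lemma normc_conj (w : R[i]) : normc w^* = normc w.
Proof. by case: w => a b /=; rewrite sqrrN. Qed.

(** Here 4 y |t(w)|^2 = 2 |w - conj w| |t(w)| |t(conj w)|, as |w - conj w| = 2 y and t is real. The
    values at w and at its conjugate supply one row of the Vandermonde product each, and the
    remaining 2 accumulates to 2^l. No real roots occur in the list because those are split off
    earlier. *)
Lemma weight_cons_complex (w : R[i]) z p : 0 < complex.Im w ->
  2 * weight [::] (w :: z) p =
  4 * complex.Im w * normc (ev (root_poly [::] z * p) (pair_of_complex w)) ^+ 2 * weight [::] z p.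
Proof.
move=> w0; rewrite evM normcM exprMn.
have e1 : normc (ev (root_poly [::] z) (pair_of_complex w)) =
    \prod_(y <- root_list [::] z) normc (w - y).
  by rewrite ev_root_poly normc_prod pair_of_complexK.
have e2 : normc (ev (root_poly [::] z) (pair_of_complex w)) =
    \prod_(y <- root_list [::] z) normc (w^* - y).
  by rewrite -normc_conj -ev_conj ev_root_poly normc_prod pair_of_complexK.
have e3 : normc (w - w^*) = 2 * complex.Im w.
  have -> : w - w^* = 0 +i* (2 * complex.Im w).
    by case: (w) => a b; apply/eqP; rewrite eq_complex/= opprK subrr eqxx/= mulrDl mul1r.
  by rewrite /normc/= expr0n add0r sqrtr_sqr gtr0_norm// mulr_gt0.
rewrite /weight /root_list /= vandermonde_insert /= big_cons !big_cat /= !big_cons.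
rewrite -/(root_list [::] z).
rewrite expr2 {1}e1 e2 e3 /root_list /= !big_cat /= ev_conj normc_conj.
ring.
Qed.

Lemma root_poly_monic x z : root_poly x z \is monic.
Proof.
rewrite monicMl; first by apply: monic_prod => w _; exact: quad_monic.
by apply: monic_prod => a _; exact: monicXsubC.
Qed.

Lemma size_root_poly x z : size (root_poly x z) = (size x + (size z).*2).+1.
Proof.
have m1 : \prod_(a <- x) ('X - a%:P) \is monic by apply: monic_prod => a _; exact: monicXsubC.
have m2 : \prod_(w <- z) quad (pair_of_complex w) \is monic.
  by apply: monic_prod => a _; exact: quad_monic.
have sq : size (\prod_(w <- z) quad (pair_of_complex w)) = (size z).*2.+1.
  elim: z {m2} => [|w z IH]; first by rewrite big_nil size_poly1.
  rewrite big_cons size_monicM ?quad_monic//; last first.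
    by rewrite monic_neq0// monic_prod// => a _; exact: quad_monic.
  by rewrite size_quad IH doubleS.
by rewrite /root_poly size_monicM ?monic_neq0// size_prod_XsubC sq addSn addnS.
Qed.

Lemma root_poly_neq0 x z : root_poly x z != 0.
Proof. by rewrite monic_neq0// root_poly_monic. Qed.

Lemma root_poly_nil : root_poly [::] [::] = 1.
Proof. by rewrite /root_poly !big_nil mulr1. Qed.

Lemma weight_nil p : weight [::] [::] p = 1.
Proof. by rewrite /weight big_nil /= mulr1. Qed.

End root_products.

Section measurable_weight.
Context {R : realType} {d : measure_display} {Th : measurableType d}.

Lemma measurable_complexP (f : Th -> R[i]) : measurable_fun setT f <->
  measurable_fun setT (fun t => complex.Re (f t)) /\
  measurable_fun setT (fun t => complex.Im (f t)).
Proof.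
split=> [mf|[m1 m2]].
  have mp := measurableT_comp (@measurable_pair_of_complex R) mf.
  split; first exact: (measurableT_comp measurable_fst mp).
  exact: (measurableT_comp measurable_snd mp).
have -> : f = (@complex_of_pair R) \o (fun t => (complex.Re (f t), complex.Im (f t))).
  by apply/funext => t /=; case: (f t).
apply: measurableT_comp; first exact: measurable_complex_of_pair.
exact/measurable_fun_pairP.
Qed.

Lemma measurable_normc (f : Th -> R[i]) : measurable_fun setT f ->
  measurable_fun setT (fun t => normc (f t)).
Proof.
move=> /measurable_complexP[m1 m2].
rewrite (_ : (fun t => _) = fun t => Num.sqrt (complex.Re (f t) ^+ 2 + complex.Im (f t) ^+ 2)).
  apply: (measurableT_comp (f := @Num.sqrt R)).
    by apply: continuous_measurable_fun => x; exact: sqrt_continuous.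
  by apply: measurable_funD; exact: measurable_funX.
by apply/funext => t; case: (f t).
Qed.

Lemma measurable_prod_seq (I : Type) (r : seq I) (h : I -> Th -> R) :
  (forall i, measurable_fun setT (h i)) ->
  measurable_fun setT (fun t => \prod_(i <- r) h i t).
Proof.
move=> mh; elim: r => [|i r IH].
  by under eq_fun do rewrite big_nil; exact: measurable_cst.
by under eq_fun do rewrite big_cons; exact: measurable_funM.
Qed.

Lemma measurable_normc_ev n (a : Th -> n.-tuple R) (w : Th -> R[i]) :
  measurable_fun setT a -> measurable_fun setT w ->
  measurable_fun setT (fun t => normc (ev (Poly (a t)) (pair_of_complex (w t)))).
Proof.
move=> ma mw; apply: measurable_normc; apply/measurable_complexP.
have mz := measurableT_comp (@measurable_pair_of_complex R) mw.
by have [? ? _ _] := measurable_reim_Poly ma mz.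
Qed.

Variables (I : Type) (f : I -> Th -> R[i]).
Hypothesis mf : forall i, measurable_fun setT (f i).

Lemma measurable_vandermonde (r : seq I) :
  measurable_fun setT (fun t => vandermonde [seq f i t | i <- r]).
Proof.
elim: r => [|i r IH] /=; first exact: measurable_cst.
apply: measurable_funM => //; under eq_fun do rewrite big_map.
apply: measurable_prod_seq => j; apply: measurable_normc.
have [a1 a2] := (measurable_complexP _).1 (mf i).
have [b1 b2] := (measurable_complexP _).1 (mf j).
apply/measurable_complexP; split.
  under eq_fun do rewrite cReD cReN; exact: measurable_funB.
under eq_fun do rewrite cImD cImN; exact: measurable_funB.
Qed.

End measurable_weight.

Section measurable_roots.
Context {R : realType} {d : measure_display} {Th : measurableType d}.

Lemma measurable_coef_prod (I : Type) (r : seq I) (D : I -> Th -> {poly R}) :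
  (forall i k, measurable_fun setT (fun t => (D i t)`_k)) ->
  forall k, measurable_fun setT (fun t => (\prod_(i <- r) D i t)`_k).
Proof.
move=> mD; elim: r => [|i r IH] k.
  under eq_fun do rewrite big_nil; exact: measurable_cst.
under eq_fun do rewrite big_cons; exact: measurable_coefM.
Qed.

Variables (k l : nat) (x : Th -> k.-tuple R) (z : Th -> l.-tuple R[i]).
Hypotheses (mx : measurable_fun setT x) (mz : measurable_fun setT z).

Let mxi i : measurable_fun setT (fun t => tnth (x t) i).
Proof. exact: (measurableT_comp (measurable_tnth i) mx). Qed.

Let mzi i : measurable_fun setT (fun t => tnth (z t) i).
Proof. exact: (measurableT_comp (measurable_tnth i) mz). Qed.

Let tuple_enum (T : Type) n (t : n.-tuple T) : t = [seq tnth t i | i <- enum 'I_n] :> seq T.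
Proof. by rewrite [in LHS](tuple_map_ord t). Qed.

Lemma measurable_root_poly i : measurable_fun setT (fun t => (root_poly (x t) (z t))`_i).
Proof.
rewrite (_ : (fun t => _) = fun t => (\prod_(i <- enum 'I_k) ('X - (tnth (x t) i)%:P) *
    \prod_(j <- enum 'I_l) quad (pair_of_complex (tnth (z t) j)))`_i); last first.
  apply/funext => t; rewrite /root_poly [in LHS](tuple_enum (x t)) [in LHS](tuple_enum (z t)).
  by rewrite !big_map.
apply: measurable_coefM => m; apply: measurable_coef_prod => {i m} i m.
  under eq_fun do rewrite coefB coefX coefC.
  apply: measurable_funB; first exact: measurable_cst.
  by case: (m == 0%N); [exact: mxi|exact: measurable_cst].
have [m1 m2] := (measurable_complexP _).1 (mzi i).
under eq_fun do rewrite /quad coefD coefC coefMX coefB coefX coefC.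
case: m => [|[|m]] /=.
- apply: measurable_funD; first exact: measurable_cst.
  by apply: measurable_funD; exact: measurable_funX.
- apply: measurable_funD; last exact: measurable_cst.
  apply: measurable_funB; first exact: measurable_cst.
  by apply: measurable_funM => //; exact: measurable_cst.
- exact: measurable_cst.
Qed.

(** Names the roots by a fixed index type, so that lists and products depending on the parameter
    become maps and products over a constant sequence. *)
Let node (i : 'I_k + ('I_l + 'I_l)) (t : Th) : R[i] :=
  match i with
  | inl i => (tnth (x t) i)%:C
  | inr (inl j) => tnth (z t) j
  | inr (inr j) => (tnth (z t) j)^*
  end.

Let nodes : seq ('I_k + ('I_l + 'I_l)) :=
  [seq inl i | i <- enum 'I_k] ++
  ([seq inr (inl j) | j <- enum 'I_l] ++ [seq inr (inr j) | j <- enum 'I_l]).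

Let root_listE t : root_list (x t) (z t) = [seq node i t | i <- nodes].
Proof.
rewrite /root_list [in LHS](tuple_enum (x t)) [in LHS](tuple_enum (z t)).
by rewrite /nodes !map_cat -!map_comp.
Qed.

Let measurable_node i : measurable_fun setT (node i).
Proof.
case: i => [i|[j|j]] /=.
- by apply/measurable_complexP; split => /=; [exact: mxi|exact: measurable_cst].
- exact: mzi.
- have [m1 m2] := (measurable_complexP _).1 (mzi j).
  apply/measurable_complexP; split.
    rewrite (_ : (fun t => _) = fun t => complex.Re (tnth (z t) j))//.
    by apply/funext => t /=; case: (tnth (z t) j).
  rewrite (_ : (fun t => _) = fun t => - complex.Im (tnth (z t) j)).
    exact: measurableT_comp.
  by apply/funext => t /=; case: (tnth (z t) j).
Qed.

Lemma measurable_weight n (a : Th -> n.-tuple R) : measurable_fun setT a ->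
  measurable_fun setT (fun t => weight (x t) (z t) (Poly (a t))).
Proof.
move=> ma; apply: measurable_funM.
  under eq_fun do rewrite root_listE; exact: measurable_vandermonde.
under eq_fun do rewrite root_listE big_map.
by apply: measurable_prod_seq => i; exact: measurable_normc_ev.
Qed.

End measurable_roots.

Lemma emeasurable_prod_seq d (Th : measurableType d) (R : realType) (I : Type) (r : seq I)
    (h : I -> Th -> \bar R) : (forall i, measurable_fun setT (h i)) ->
  measurable_fun setT (fun t => (\prod_(i <- r) h i t)%E).
Proof.
move=> mh; elim: r => [|i r IH].
  by under eq_fun do rewrite big_nil; exact: measurable_cst.
by under eq_fun do rewrite big_cons; exact: emeasurable_funM.
Qed.

(** * Correlation formulas for an arbitrary weight *)

Section correlation.
Context {R : realType}.
Local Notation RT := (measurableTypeR R).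
Local Notation lam n := (power_measure (@lebesgue_measure R) n).
Local Notation mu := (@lebesgue_measure R).
Local Notation lc := (@lebesgue_complex R).
Local Notation Z := (R * R)%type.

Definition real_points (A : set R) : set Z := [set z | z.2 = 0 /\ A z.1].
Definition complex_points (B : set R[i]) : set Z := (@complex_of_pair R) @^-1` B.

Lemma measurable_real_points A : measurable A -> measurable (real_points A).
Proof.
move=> mA; have -> : real_points A = A `*` [set 0].
  by apply/seteqP; split => z [] /=.
by apply: measurableX.
Qed.

Lemma measurable_complex_points B : measurable B -> measurable (complex_points B).
Proof. by []. Qed.

(** Here t is the last cofactor, with n coefficients. The weight F is arbitrary; for the product of
    the f_i this is the density of the theorem. *)
Definition density n N (F : N.-tuple RT -> \bar R) (x : seq R) (z : seq R[i]) : \bar R :=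
  (\int[lam n]_t ((2 ^+ size z * weight x z (Poly t))%:E * F (mulp (root_poly x z) N t)))%E.

Lemma density_ge0 n N (F : N.-tuple RT -> \bar R) x z :
  (forall a, (0 <= F a)%E) -> (0 <= density n F x z)%E.
Proof.
move=> F0; apply: integral_ge0 => t _; rewrite mule_ge0// lee_fin.
by rewrite mulr_ge0 ?weight_ge0// exprn_ge0.
Qed.

Lemma measurable_density k l n N (F : N.-tuple RT -> \bar R) :
  (forall a, (0 <= F a)%E) -> measurable_fun setT F ->
  measurable_fun setT (fun q : k.-tuple RT * l.-tuple R[i] => density n F q.1 q.2).
Proof.
move=> F0 mF.
pose H (p : (k.-tuple RT * l.-tuple R[i]) * n.-tuple RT) : \bar R :=
  ((2 ^+ l * weight p.1.1 p.1.2 (Poly p.2))%:E * F (mulp (root_poly p.1.1 p.1.2) N p.2))%E.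
have H0 p : (0 <= H p)%E.
  by rewrite mule_ge0// lee_fin mulr_ge0 ?weight_ge0// exprn_ge0.
have mx : measurable_fun setT (fun p : (k.-tuple RT * l.-tuple R[i]) * n.-tuple RT => p.1.1).
  exact: (measurableT_comp measurable_fst measurable_fst).
have mz : measurable_fun setT (fun p : (k.-tuple RT * l.-tuple R[i]) * n.-tuple RT => p.1.2).
  exact: (measurableT_comp measurable_snd measurable_fst).
have mt : measurable_fun setT (fun p : (k.-tuple RT * l.-tuple R[i]) * n.-tuple RT => p.2).
  exact: measurable_snd.
have mH : measurable_fun setT H.
  apply: emeasurable_funM.
    apply/measurable_EFinP; apply: measurable_funM; first exact: measurable_cst.
    exact: (measurable_weight mx mz mt).
  apply: (measurableT_comp mF); apply: measurable_mulp => //.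
  exact: (measurable_root_poly mx mz).
have := measurable_fun_fubini_tonelli_F (m2 := lam n) H mH H0.
apply: eq_measurable_fun => q _; apply: eq_integral => t _.
by rewrite /H /= size_tuple.
Qed.

Let measurable_complex_box l (B : 'I_l -> set R[i]) : (forall j, measurable (B j)) ->
  measurable [set z : l.-tuple R[i] | forall j, B j (tnth z j)].
Proof. exact: measurable_box. Qed.

Let cons_box d (T : measurableType d) l (B : 'I_l.+1 -> set T) (w : T) (z : l.-tuple T) :
  B ord0 w -> ([tuple of w :: z] \in [set z : l.+1.-tuple T | forall j, B j (tnth z j)]) =
  (z \in [set z : l.-tuple T | forall j, B (lift ord0 j) (tnth z j)]).
Proof.
move=> Bw; apply/idP/idP => /[!inE]/= h j; first by have := h (lift ord0 j); rewrite tnthS.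
by case: (unliftP ord0 j) => [i ->|->]; rewrite ?tnthS ?tnth0.
Qed.

Let ncons_box d (T : measurableType d) l (B : 'I_l.+1 -> set T) (w : T) (z : l.-tuple T) :
  ~ B ord0 w -> ([tuple of w :: z] \in [set z : l.+1.-tuple T | forall j, B j (tnth z j)]) = false.
Proof. by move=> Bw; apply/negP; rewrite inE => /(_ ord0); rewrite tnth0. Qed.

Let quad_neq0 (B0 B1 : set R[i]) (w : R[i]) z : B0 w -> B0 `&` B1 = set0 ->
  B0 `<=` @upper_half_plane R -> B1 `<=` @upper_half_plane R ->
  complex_points B1 z -> ev (quad (pair_of_complex w)) z != 0.
Proof.
move=> B0w dB u0 u1 B1z; rewrite ev_quad pair_of_complexK mulf_neq0// subr_eq0.
  apply/eqP => zw; suff : (B0 `&` B1) w by rewrite dB.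
  by split => //; rewrite -zw.
apply/eqP => zw; have w0 : 0 < complex.Im w := u0 _ B0w.
have : 0 < complex.Im (complex_of_pair z) := u1 _ B1z.
by rewrite zw; case: (w) w0 => a b /= b0; rewrite oppr_gt0 ltNge ltW.
Qed.

Lemma measurable_density_complex l n N (F : N.-tuple RT -> \bar R) :
  (forall a, (0 <= F a)%E) -> measurable_fun setT F ->
  measurable_fun setT (fun z : l.-tuple R[i] => density n F [::] z).
Proof.
move=> F0 mF.
have m0 : measurable_fun setT (fun z : l.-tuple R[i] => ([tuple], z) : 0.-tuple RT * l.-tuple R[i]).
  exact: measurable_fun_pair.
exact: (measurableT_comp (@measurable_density 0 l n _ F F0 mF) m0).
Qed.

Lemma integral_power0 d (T : measurableType d) (m : {sigma_finite_measure set T -> \bar R})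
    (A : set (0.-tuple T)) (f : 0.-tuple T -> \bar R) : A [tuple] -> measurable A ->
  measurable_fun setT f -> (\int[power_measure m 0]_(z in A) f z = f [tuple])%E.
Proof.
move=> A0 mA mf.
have h := @integral_dirac _ _ ([tuple] : 0.-tuple T) R _ mA f (measurable_funTS mf).
by apply: (etrans h); rewrite diracE mem_set// mul1e.
Qed.

Lemma density_nil N (F : N.-tuple RT -> \bar R) :
  density N F [::] [::] = (\int[lam N]_t F t)%E.
Proof.
by apply: eq_integral => t _; rewrite weight_nil root_poly_nil mulp1 expr0 mulr1 mul1e.
Qed.

Lemma complex_correlation l n N (F : N.-tuple RT -> \bar R) (B : 'I_l -> set R[i]) :
  N = (l.*2 + n)%N -> (forall a, (0 <= F a)%E) -> measurable_fun setT F ->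
  (forall j, measurable (B j)) -> (forall j, B j `<=` @upper_half_plane R) ->
  trivIset setT B ->
  (\int[lam N]_a (F a * \prod_(j < l) root_count (Poly a) (complex_points (B j))) =
   \int[power_measure lc l]_(z in [set z : l.-tuple R[i] | forall j, B j (tnth z j)])
     density n F [::] z)%E.
Proof.
elim: l N F B => [|l IH] N F B NE F0 mF mB uB tB.
  subst N; rewrite integral_power0//.
  - by rewrite density_nil; apply: eq_integral => a _; rewrite big_ord0 mule1.
  - by case.
  - exact: measurable_complex_box.
  - exact: measurable_density_complex.
have e : N = (l.*2 + n).+2 by [].
subst N; set n' := (l.*2 + n)%N.
pose S j := complex_points (B j).
pose Pr (a : n'.+2.-tuple RT) := (F a * \prod_(j < l) root_count (Poly a) (S (lift ord0 j)))%E.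
have Pr0 a : (0 <= Pr a)%E.
  by rewrite mule_ge0// prode_ge0// => j _; exact: root_count_ge0.
have mPr : measurable_fun setT Pr.
  apply: emeasurable_funM => //; apply: emeasurable_prod_seq => j.
  have mS : measurable (S (lift ord0 j)) := mB _.
  exact: (@measurable_root_count _ _ (n'.+2.-tuple RT) n'.+2 _ id mS (@measurable_id _ _ _)).
pose Psi (q : n'.+2.-tuple RT * Z) := (Pr q.1 * (\1_(S ord0) q.2)%:E)%E.
have Psi0 q : (0 <= Psi q)%E by rewrite mule_ge0// lee_fin.
have mPsi : measurable_fun setT Psi.
  apply: emeasurable_funM; first exact: (measurableT_comp mPr measurable_fst).
  apply/measurable_EFinP; apply: (measurableT_comp _ measurable_snd).
  by apply: measurable_indic; exact: mB.
transitivity (\int[lam n'.+2]_a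
    zsum (zroots (Poly a)) ((fun z => Psi (a, z)) \_ [set z | (0 < z.2)%R]))%E.
  apply: eq_integral => a _.
  transitivity (Pr a * root_count (Poly a) (S ord0))%E.
    by rewrite big_ord_recl /Pr muleCA muleC.
  rewrite mul_root_count//; last exact: mB.
  apply: eq_zsum => z _; rewrite patchE; case: ifPn => // /negP z0.
  rewrite indicE (_ : _ \in _ = false) ?mule0//; apply/negP => /[!inE] Sz.
  by apply: z0; rewrite inE; exact: (uB _ _ Sz).
rewrite complex_step// integral_mkcond [RHS]integral_mkcond.
rewrite integral_powerS; first last.
- by apply: measurable_patch; [exact: measurable_complex_box|exact: measurable_density_complex].
- by move=> z; rewrite patchE; case: ifPn => // _; exact: density_ge0.
apply: eq_integral => w _; rewrite patchE.
have SE z : (\1_(S ord0) (pair_of_complex z) : R) = (z \in B ord0)%:R.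
  rewrite indicE; congr (nat_of_bool _)%:R.
  by apply/idP/idP => /[!inE]; rewrite /S /complex_points/= pair_of_complexK.
have [Bw|Bw] := pselect (B ord0 w); last first.
  rewrite [RHS]integral0_eq; last by move=> z _; rewrite patchE ncons_box.
  case: ifPn => // _; apply: integral0_eq => t _.
  by rewrite /Psi SE (_ : _ \in _ = false) ?mule0//; apply/negP; rewrite inE.
rewrite mem_set; last exact: (uB _ _ Bw).
(* The weight on the cofactor for which the induction hypothesis is used: Jacobian factor times the
   old weight of the product. *)
pose F' (t : n'.-tuple RT) := ((4 * (pair_of_complex w).2 *
  normc (ev (Poly t) (pair_of_complex w)) ^+ 2)%:E *
  F (mulp (quad (pair_of_complex w)) n'.+2 t))%E.
have w0 : 0 < complex.Im w := uB _ _ Bw.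
have F'0 t : (0 <= F' t)%E.
  by rewrite mule_ge0// lee_fin mulr_ge0 ?sqr_ge0// mulr_ge0// ltW.
have mF' : measurable_fun setT F'.
  apply: emeasurable_funM.
    apply/measurable_EFinP; apply: measurable_funM; first exact: measurable_cst.
    apply: measurable_funX.
    exact: (@measurable_normc_ev _ _ (n'.-tuple RT) n' id (fun=> w)).
  apply: (measurableT_comp mF).
  apply: (@measurable_mulp _ _ (n'.-tuple RT) (fun=> quad (pair_of_complex w)) n' n'.+2 id) => //.
have sq : (size (quad (pair_of_complex w)) + n' <= n'.+2.+1)%N by rewrite size_quad.
have q0 : quad (pair_of_complex w) != 0 by rewrite monic_neq0// quad_monic.
transitivity (\int[lam n']_t (F' t * \prod_(j < l) root_count (Poly t)
    (complex_points (B (lift ord0 j)))))%E.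
  apply: eq_integral => t _; rewrite /Psi SE mem_set// mule1 /Pr /= /F' -muleA.
  congr (_ * (_ * _))%E; apply: eq_bigr => j _.
  rewrite Poly_mulp// root_countM// => z Sz.
  apply: (quad_neq0 Bw _ (uB ord0) (uB (lift ord0 j)) Sz).
  by move/trivIsetP : tB; apply.
rewrite (IH _ F' (fun j => B (lift ord0 j)))//; last first.
  by apply/trivIsetP => i j _ _ ij; move/trivIsetP : tB; apply => //; rewrite (inj_eq lift_inj).
rewrite integral_mkcond; apply: eq_integral => z _.
rewrite !patchE cons_box//; case: ifPn => // _.
apply: eq_integral => s _.
have sr : (size (root_poly [::] z) + n <= n'.+1)%N.
  by rewrite size_root_poly /= add0n addSn (size_tuple z).
rewrite /F' Poly_mulp ?root_poly_neq0// mulp_mulp ?root_poly_neq0//.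
have -> : root_poly [::] [tuple of w :: z] = quad (pair_of_complex w) * root_poly [::] z.
  by rewrite /root_poly !big_nil !mul1r big_cons.
rewrite [LHS]muleA -EFinM; congr (_%:E * _)%E.
(* The recursion produces 2 times the new weight, and this 2 raises 2^l to 2^(l + 1). *)
have := weight_cons_complex z (Poly s) w0; rewrite [(pair_of_complex w).2]/= => e2.
transitivity (2 ^+ size z * (2 * weight [::] (w :: z) (Poly s))); first by rewrite e2; ring.
by rewrite mulrA -exprSr.
Qed.

(** Induction on the number of real roots, with [complex_correlation] as the case k = 0. A real step
    divides by X - y, which has no root in the other sets: the other A_i are disjoint from A_0 and
    the B_j contain no real number. *)
Lemma mixed_correlation k l n N (F : N.-tuple RT -> \bar R)
    (A : 'I_k -> set R) (B : 'I_l -> set R[i]) :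
  N = (k + (l.*2 + n))%N -> (forall a, (0 <= F a)%E) -> measurable_fun setT F ->
  (forall i, measurable (A i)) -> trivIset setT A ->
  (forall j, measurable (B j)) -> (forall j, B j `<=` @upper_half_plane R) ->
  trivIset setT B ->
  (\int[lam N]_a (F a * (\prod_(i < k) root_count (Poly a) (real_points (A i)) *
      \prod_(j < l) root_count (Poly a) (complex_points (B j)))) =
   \int[power_measure mu k]_(x in [set x : k.-tuple RT | forall i, A i (tnth x i)])
     \int[power_measure lc l]_(z in [set z : l.-tuple R[i] | forall j, B j (tnth z j)])
       density n F x z)%E.
Proof.
elim: k N F A => [|k IH] N F A NE F0 mF mA tA mB uB tB.
  have mbox := measurable_complex_box mB.
  pose g (x : 0.-tuple RT) := (\int[power_measure lc l]_(z in [set z : l.-tuple R[i] |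
    forall j, B j (tnth z j)]) density n F x z)%E.
  have mg : measurable_fun setT g.
    rewrite (_ : g = cst (g [tuple])); first exact: measurable_cst.
    by apply/funext => x; rewrite (tuple0 x).
  rewrite (integral_power0 mu (f := g) _ _ mg); [|by case|exact: measurable_box].
  transitivity (\int[lam N]_a (F a * \prod_(j < l) root_count (Poly a) (complex_points (B j))))%E.
    by apply: eq_integral => a _; rewrite big_ord0 mul1e.
  exact: (complex_correlation NE F0 mF mB uB tB).
subst N; set n' := (k + (l.*2 + n))%N.
pose S i := real_points (A i).
pose Q (p : {poly R}) := (\prod_(j < l) root_count p (complex_points (B j)))%E.
pose Pr (a : n'.+1.-tuple RT) := (F a * (\prod_(j < k) root_count (Poly a) (S (lift ord0 j)) *
  Q (Poly a)))%E.
have prod_ge0 m (p : {poly R}) (h : 'I_m -> set Z) : (0 <= \prod_(j < m) root_count p (h j))%E.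
  by apply: prode_ge0 => j _; exact: root_count_ge0.
have Pr0 a : (0 <= Pr a)%E by rewrite /Pr mule_ge0// mule_ge0//; exact: prod_ge0.
have mPr : measurable_fun setT Pr.
  apply: emeasurable_funM => //; apply: emeasurable_funM; apply: emeasurable_prod_seq => j.
    have mS : measurable (S (lift ord0 j)) by exact: measurable_real_points.
    exact: (@measurable_root_count _ _ (n'.+1.-tuple RT) n'.+1 _ id mS (@measurable_id _ _ _)).
  have mS : measurable (complex_points (B j)) := mB _.
  exact: (@measurable_root_count _ _ (n'.+1.-tuple RT) n'.+1 _ id mS (@measurable_id _ _ _)).
pose Psi (q : n'.+1.-tuple RT * Z) := (Pr q.1 * (\1_(S ord0) q.2)%:E)%E.
have Psi0 q : (0 <= Psi q)%E by rewrite mule_ge0// lee_fin.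
have mPsi : measurable_fun setT Psi.
  apply: emeasurable_funM; first exact: (measurableT_comp mPr measurable_fst).
  apply/measurable_EFinP; apply: (measurableT_comp _ measurable_snd).
  by apply: measurable_indic; exact: measurable_real_points.
transitivity (\int[lam n'.+1]_a
    zsum (zroots (Poly a)) ((fun z => Psi (a, z)) \_ [set z | z.2 = 0%R]))%E.
  apply: eq_integral => a _.
  transitivity (Pr a * root_count (Poly a) (S ord0))%E.
    by rewrite big_ord_recl [RHS]muleC /Pr [RHS]muleCA; congr (_ * _)%E; rewrite [RHS]muleA.
  rewrite mul_root_count//; last exact: measurable_real_points.
  apply: eq_zsum => z _; rewrite patchE; case: ifPn => // /negP z0.
  rewrite indicE (_ : _ \in _ = false) ?mule0//; apply/negP => /[!inE] -[Sz _].
  by apply: z0; rewrite inE.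
rewrite real_step// [RHS]integral_mkcond.
pose g (x : k.+1.-tuple RT) := (\int[power_measure lc l]_(z in [set z : l.-tuple R[i] |
    forall j, B j (tnth z j)]) density n F x z)%E.
have g0 x : (0 <= g x)%E by apply: integral_ge0 => z _; exact: density_ge0.
have mg : measurable_fun setT g.
  pose h := (fun q : k.+1.-tuple RT * l.-tuple R[i] => density n F q.1 q.2) \_
    [set q | forall j, B j (tnth q.2 j)].
  have h0 q : (0 <= h q)%E by rewrite /h patchE; case: ifPn => // _; exact: density_ge0.
  have mh : measurable_fun setT h.
    apply: measurable_patch; last exact: measurable_density.
    rewrite -[X in measurable X]setTI.
    have m2 : measurable_fun setT (snd : k.+1.-tuple RT * l.-tuple R[i] -> l.-tuple R[i]).
      exact: measurable_snd.
    exact: (m2 measurableT _ (measurable_complex_box mB)).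
  have := measurable_fun_fubini_tonelli_F (m2 := power_measure lc l) h mh h0.
  apply: eq_measurable_fun => x _; rewrite /g integral_mkcond.
  apply: eq_integral => z _; rewrite /h !patchE.
  by congr (if _ then _ else _); apply/idP/idP => /[!inE].
have mbox : measurable [set x : k.+1.-tuple RT | forall i, A i (tnth x i)].
  exact: measurable_box.
rewrite -/(g _) (_ : (fun x => \int[_]_(z in _) _)%E = g)//.
rewrite (integral_powerS mu (F := g \_ _)); first last.
- exact: measurable_patch.
- by move=> x; rewrite patchE; case: ifPn.
apply: eq_integral => y _.
have SE : (\1_(S ord0) (y, 0) : R) = (y \in A ord0)%:R.
  rewrite indicE; congr (nat_of_bool _)%:R.
  by apply/idP/idP => /[!inE] => [[]|].
have [Ay|Ay] := pselect (A ord0 y); last first.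
  rewrite [RHS]integral0_eq; last by move=> z _; rewrite patchE ncons_box.
  apply: integral0_eq => t _.
  by rewrite /Psi SE (_ : _ \in _ = false) ?mule0//; apply/negP; rewrite inE.
pose F' (t : n'.-tuple RT) := (`|(Poly t).[y]|%:E * F (mulp ('X - y%:P) n'.+1 t))%E.
have F'0 t : (0 <= F' t)%E by rewrite mule_ge0// lee_fin.
have mF' : measurable_fun setT F'.
  apply: emeasurable_funM.
    apply/measurable_EFinP.
    have := @measurable_normc_ev _ _ (n'.-tuple RT) n' id (fun=> y%:C)
      (@measurable_id _ _ _) (measurable_cst _).
    by apply: eq_measurable_fun => t _; rewrite -normcR -ev_real.
  apply: (measurableT_comp mF).
  by apply: (@measurable_mulp _ _ (n'.-tuple RT) (fun=> 'X - y%:P) n' n'.+1 id).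
have sq : (size ('X - y%:P)%R + n' <= n'.+1.+1)%N by rewrite size_XsubC.
have q0 : 'X - y%:P != 0 by rewrite polyXsubC_eq0.
transitivity (\int[lam n']_t (F' t * (\prod_(j < k) root_count (Poly t)
    (real_points (A (lift ord0 j))) * \prod_(j < l) root_count (Poly t) (complex_points (B j)))))%E.
  apply: eq_integral => t _; rewrite /Psi SE mem_set// mule1 /Pr /= /F' -muleA.
  rewrite (Poly_mulp _ q0 sq); congr (_ * (_ * (_ * _)))%E; apply: eq_bigr => j _; apply: root_countM => z.
    move=> [z2 Az]; rewrite evD evX -polyCN evC rmorphN subr_eq0.
    apply/eqP => zy; have zyE : z.1 = y by case: (z) zy => a b [].
    move/trivIsetP : tA => /(_ ord0 (lift ord0 j) I I (neq_lift _ _)) tA0.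
    suff : (A ord0 `&` A (lift ord0 j)) y by rewrite tA0.
    by split => //; rewrite -zyE.
  move=> Bz; rewrite evD evX -polyCN evC rmorphN subr_eq0.
  apply/eqP => zy; have : 0 < complex.Im (complex_of_pair z) := uB _ _ Bz.
  by rewrite zy ltxx.
rewrite (IH _ F' (fun j => A (lift ord0 j)))//; last first.
  by apply/trivIsetP => i j _ _ ij; move/trivIsetP : tA; apply => //; rewrite (inj_eq lift_inj).
rewrite integral_mkcond; apply: eq_integral => x _.
rewrite !patchE (cons_box (B := A) _ Ay); case: ifPn => // _.
apply: eq_integral => z _; apply: eq_integral => s _.
have sr : (size (root_poly x z) + n <= n'.+1)%N.
  by rewrite size_root_poly (size_tuple z) (size_tuple x) addSn -addnA.
rewrite /F' Poly_mulp ?root_poly_neq0// mulp_mulp ?root_poly_neq0//.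
have -> : root_poly [tuple of y :: x] z = ('X - y%:P) * root_poly x z.
  by rewrite /root_poly big_cons mulrA.
rewrite [LHS]muleA -EFinM; congr (_%:E * _)%E.
by rewrite weight_cons_real; ring.
Qed.

End correlation.

(** * The law of the coefficients *)

Section box.
Context d (T : measurableType d) (R : realType) (n : nat).

Definition boxes : set (set (n.-tuple T)) :=
  [set C | exists2 A : 'I_n -> set T, (forall i, measurable (A i)) &
    C = [set t | forall i, A i (tnth t i)]].

Lemma measurable_boxes : (@measurable _ (n.-tuple T)) = <<s boxes >>.
Proof.
apply/seteqP; split.
  apply: smallest_sub; first exact: smallest_sigma_algebra.
  apply: (big_ind (fun X => X `<=` <<s boxes >>)) => [|X Y hX hY|i _].
  - exact: sub0set.
  - by rewrite subUset.
  - move=> _ [A mA <-]; apply: sub_sigma_algebra.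
    exists (fun j => if j == i then A else setT); first by move=> j; case: ifP.
    rewrite setTI; apply/seteqP; split => t /= At.
      by move=> j; case: ifP => // /eqP ->.
    by have := At i; rewrite eqxx.
apply: smallest_sub; first exact: sigma_algebra_measurable.
by move=> _ [A mA ->]; exact: measurable_box.
Qed.

Lemma boxesI : setI_closed boxes.
Proof.
move=> _ _ [A mA ->] [B mB ->]; exists (fun i => A i `&` B i).
  by move=> i; exact: measurableI.
apply/seteqP; split => t /=; first by move=> [h1 h2] i.
by move=> h; split => i; have [] := h i.
Qed.

Lemma boxesT : boxes setT.
Proof. by exists (fun=> setT) => //; apply/seteqP; split. Qed.

(** Boxes are stable under intersection, generate the product sigma-algebra and include the whole
    space, on which m1 is finite. *)
Lemma eq_measure_boxes (m1 m2 : {measure set (n.-tuple T) -> \bar R}) :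
  (m1 setT < +oo)%E ->
  (forall A : 'I_n -> set T, (forall i, measurable (A i)) ->
    m1 [set t | forall i, A i (tnth t i)] = m2 [set t | forall i, A i (tnth t i)]) ->
  forall B, measurable B -> m1 B = m2 B.
Proof.
move=> fin m12 B mB.
apply: (measure_unique boxes (fun=> setT)) => //.
- exact: measurable_boxes.
- exact: boxesI.
- by move=> _; exact: boxesT.
- by apply/seteqP; split => // t _; exists 0%N.
- by move=> _ [A mA ->]; exact: m12.
Qed.

End box.

Lemma integral_power_prod d (T : measurableType d) (R : realType)
    (m : {sigma_finite_measure set T -> \bar R}) n (h : 'I_n -> T -> \bar R) :
  (forall i x, (0 <= h i x)%E) -> (forall i, measurable_fun setT (h i)) ->
  (\int[power_measure m n]_t (\prod_(i < n) h i (tnth t i)) =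
   \prod_(i < n) \int[m]_x h i x)%E.
Proof.
move=> h0 mh; elim: n h h0 mh => [|n IH] h h0 mh.
  rewrite big_ord0 (@integral_power0 _ _ _ m setT (fun t => \prod_(i < 0) h i (tnth t i))%E)//.
    by rewrite big_ord0.
  by under eq_fun do rewrite big_ord0; exact: measurable_cst.
have mp k (g : 'I_k -> T -> \bar R) : (forall i, measurable_fun setT (g i)) ->
    measurable_fun setT (fun t : k.-tuple T => \prod_(i < k) g i (tnth t i))%E.
  move=> mg; apply: emeasurable_prod_seq => i.
  exact: (measurableT_comp (mg i) (measurable_tnth i)).
have p0 k (g : 'I_k -> T -> \bar R) (t : k.-tuple T) : (forall i x, (0 <= g i x)%E) ->
    (0 <= \prod_(i < k) g i (tnth t i))%E.
  by move=> g0; apply: prode_ge0 => i _; exact: g0.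
rewrite integral_powerS; [|by move=> t; exact: p0|exact: mp].
rewrite big_ord_recl -(IH (fun i => h (lift ord0 i)))//.
transitivity (\int[m]_x (h ord0 x * \int[power_measure m n]_t
    (\prod_(i < n) h (lift ord0 i) (tnth t i))))%E.
  apply: eq_integral => x _; rewrite -ge0_integralZl//.
  - apply: eq_integral => t _; rewrite big_ord_recl tnth0.
    by congr (_ * _)%E; apply: eq_bigr => i _; rewrite tnthS.
  - exact: (mp n (fun i => h (lift ord0 i)) (fun i => mh _)).
  - by move=> t _; exact: (p0 n (fun i => h (lift ord0 i))).
rewrite ge0_integralZr//.
by apply: integral_ge0 => t _; exact: (p0 n (fun i => h (lift ord0 i))).
Qed.

Section law.
Context d (T : measurableType d) (R : realType) (P : probability T R).
Variables (n : nat) (xi : 'I_n -> {RV P >-> R}) (f : 'I_n -> R -> R).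
Hypotheses (xi_independent : mutually_independent xi)
  (xi_density : forall i, has_density (xi i) (f i)).
Local Notation RT := (measurableTypeR R).
Local Notation lam n := (power_measure (@lebesgue_measure R) n).

Definition random_tuple (omega : T) : n.-tuple RT := [tuple xi i omega | i < n].

Lemma measurable_random_tuple : measurable_fun setT random_tuple.
Proof.
apply/measurable_fun_tnthP => i.
rewrite (_ : _ \o _ = xi i); first exact: (@measurable_funPT _ _ _ _ (xi i)).
by apply/funext => omega /=; rewrite tnth_mktuple.
Qed.

Let D (a : n.-tuple RT) : R := \prod_(i < n) f i (tnth a i).

Let f0 i x : 0 <= f i x.
Proof. by have [] := xi_density i. Qed.

Let mf i : measurable_fun setT (f i).
Proof. by have [] := xi_density i. Qed.

Let D0 a : 0 <= D a.
Proof. by apply: prodr_ge0. Qed.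

Let mD : measurable_fun setT D.
Proof.
apply: measurable_prod_seq => i.
exact: (measurableT_comp (mf i) (measurable_tnth i)).
Qed.

Let law_ex : exists m : {measure set (n.-tuple RT) -> \bar R},
  forall B, m B = (\int[lam n]_(a in B) (D a)%:E)%E.
Proof.
pose q B := (\int[lam n]_(a in B) (D a)%:E)%E.
have q0 : q set0 = 0%E by exact: integral_set0.
have q_ge0 A : (0 <= q A)%E by apply: integral_ge0 => a _; rewrite lee_fin.
have q_add : semi_sigma_additive q.
  apply: semi_sigma_additive_nng_induced => [|a]; last by rewrite lee_fin.
  exact/measurable_EFinP.
pose qM := isMeasure.Build _ _ _ q q0 q_ge0 q_add.
pose m1 : {measure set (n.-tuple RT) -> \bar R} := HB.pack q qM.
by exists m1.
Qed.

(** By independence the law of the coefficient vector agrees on boxes with the measure of density D,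
    hence everywhere. *)
Lemma expectation_random_tuple (H : n.-tuple RT -> \bar R) :
  (forall a, (0 <= H a)%E) -> measurable_fun setT H ->
  (\int[P]_omega H (random_tuple omega) =
   \int[lam n]_a ((\prod_(i < n) f i (tnth a i))%:E * H a))%E.
Proof.
move=> H0 mH; have mX := measurable_random_tuple.
have h := @ge0_integral_pushforward _ _ _ _ R random_tuple mX P setT H measurableT mH (fun a _ => H0 a).
rewrite preimage_setT in h; rewrite -[LHS]h {h}.
have [m mE] := law_ex.
apply: (ge0_integral_density (D := D)) => //.
move=> B mB _; rewrite -mE; move: B mB.
apply: (@eq_measure_boxes _ RT R n (pushforward P random_tuple) m).
  have PT : (P setT < +oo)%E by rewrite probability_setT ltry.
  exact: PT.
move=> A mA; rewrite mE integral_mkcond.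
(* Restricting the product density to a box restricts each factor to its side, so that the integral
   factorizes. *)
have E a : ((fun a => (D a)%:E) \_ [set t : n.-tuple RT | forall i, A i (tnth t i)]) a =
    (\prod_(i < n) ((fun x => (f i x)%:E) \_ (A i)) (tnth a i))%E.
  rewrite patchE; case: ifPn => [/[!inE] /= Aa|/negP Aa].
    by rewrite -prodEFin; apply: eq_bigr => i _; rewrite patchE mem_set.
  have [i Ai] : exists i, ~ A i (tnth a i).
    by apply/existsNP => h; apply: Aa; rewrite inE.
  by rewrite (bigD1 i)//= patchE memNset// mul0e.
under eq_integral do rewrite E.
rewrite (@integral_power_prod _ RT R lebesgue_measure n (fun i => (fun x => (f i x)%:E) \_ (A i))); first last.
- move=> i; have mfi : measurable_fun setT (fun x : RT => (f i x)%:E).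
    by apply/measurable_EFinP; exact: mf.
  exact: (measurable_patch (mA i) mfi).
- by move=> i x; rewrite patchE; case: ifPn => //; rewrite lee_fin.
have := xi_independent [set: 'I_n]%SET mA.
rewrite (_ : \bigcap_(i in _) _ = random_tuple @^-1` [set t | forall i, A i (tnth t i)]); last first.
  apply/seteqP; split => [t h i|t h i _] /=.
    by rewrite tnth_mktuple; apply: h; rewrite /= inE.
  by have := h i; rewrite tnth_mktuple.
move=> h; apply: (etrans h); apply: eq_big => [i|i _]; first by rewrite inE.
have [_ _ h'] := xi_density i; rewrite -integral_mkcond.
exact: (h' (A i) (mA i)).
Qed.

End law.

(** * Vieta's formulas and the explicit density *)

Section vieta.
Context {R : realType}.

Lemma prod_choice_XsubC m (w : m.-tuple R[i]) (J : {set 'I_m}) :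
  \prod_(i < m) (if i \in J then - (tnth w i)%:P else 'X) =
  ((-1) ^+ #|J| * \prod_(i in J) tnth w i)%:P * 'X^(m - #|J|).
Proof.
rewrite (bigID (mem J)) /=; congr (_ * _).
  rewrite (eq_bigr (fun i => (- tnth w i)%:P)); last by move=> i ->; rewrite polyCN.
  by rewrite -(rmorph_prod (@polyC R[i])) prodrN.
rewrite (eq_bigr (fun i => 'X)); last by move=> i /negbTE ->.
rewrite (eq_bigl (mem (~: J))); last by move=> i; rewrite /= inE.
by rewrite prodr_const -[X in _ = 'X^(X - _)]card_ord -(cardsC J) addKn.
Qed.

(** Expanding the product, J is the set of factors that contribute - v instead of X; exactly the
    sets with e elements contribute to this coefficient. *)
Lemma coef_prod_XsubC m (w : m.-tuple R[i]) (e : nat) : (e <= m)%N ->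
  (\prod_(v <- w) ('X - v%:P))`_(m - e) = (-1) ^+ e * elem_sym w e%:Z.
Proof.
move=> em; rewrite big_tuple /elem_sym.
under eq_bigr do rewrite addrC.
rewrite bigA_distr coef_sum (bigID (fun J : {set 'I_m} => #|J| == e)) /=.
have cJ (J : {set 'I_m}) : (#|J| <= m)%N by rewrite -[leqRHS]card_ord max_card.
rewrite [X in _ + X]big1 ?addr0 => [|J Je].
  rewrite big_distrr /=; apply: eq_bigr => J /eqP Je.
  by rewrite prod_choice_XsubC coefCM coefXn Je eqxx mulr1.
rewrite prod_choice_XsubC coefCM coefXn (_ : (_ == _)%N = false) ?mulr0//.
apply/negP => /eqP h; move: Je; rewrite -(subKn (cJ J)) -h subKn// eqxx.
by [].
Qed.

End vieta.

Section matching.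
Context {R : realType}.
Local Notation RT := (measurableTypeR R).
Local Notation Z := (R * R)%type.

Lemma vandermondeE m (w : m.-tuple R[i]) : vandermonde w =
  \prod_(i < m) \prod_(j < m | (i < j)%N) normc (tnth w i - tnth w j).
Proof.
elim: m w => [|m IH] w; first by rewrite big_ord0 (tuple0 w).
case/tupleP: w => u w; rewrite /= IH big_ord_recl; congr (_ * _).
  rewrite big_tuple [RHS]big_mkcond big_ord_recl /= mul1r; apply: eq_bigr => i _.
  by rewrite tnth0 tnthS.
apply: eq_bigr => i _; rewrite [RHS]big_mkcond big_ord_recl /= mul1r -big_mkcond.
by apply: eq_big => [j|j _]; rewrite ?tnthS.
Qed.

Lemma ev_Poly n (t : n.-tuple R) (v : R[i]) : ev (Poly t) (pair_of_complex v) =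
  \sum_(j < n) (tnth t j)%:C * v ^+ j.
Proof.
rewrite /ev pair_of_complexK (@horner_coef_wide _ n); last first.
  rewrite size_map_poly; apply: leq_trans (size_Poly _) _; by rewrite size_tuple.
by apply: eq_bigr => j _; rewrite coef_map coef_Poly (tnth_nth 0).
Qed.

Lemma counting_image (U V : choiceType) (g : U -> V) (X : set U) : injective g ->
  counting (g @` X) = counting X :> \bar R.
Proof.
move=> gi; rewrite /counting.
have [fX|iX] := pselect (finite_set X).
  rewrite !asboolT//; last exact: finite_image.
  rewrite fset_set_image// finmap.card_imfset//.
rewrite !asboolF// => /(@finite_preimage _ _ _ g) h; apply: iX.
have {}h := h (in2W gi); apply: (sub_finite_set _ h).
exact: preimage_image.
Qed.

(** The identity is checked in the complex numbers, where the product splits into linear factors; it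
    descends to the reals since the elementary symmetric polynomials of a family closed under
    conjugation are real. *)
Lemma coef_root_poly k l (x : k.-tuple R) (z : l.-tuple R[i]) (e : nat) : (e <= k + (l + l))%N ->
  (root_poly x z)`_(k + (l + l) - e) = (-1) ^+ e * complex.Re (elem_sym (mixed_tuple x z) e%:Z).
Proof.
move=> em; apply: (fmorph_inj (real_complex R)).
rewrite -[LHS]coef_map map_root_poly rmorphM rmorphXn rmorphN1.
have := coef_prod_XsubC (mixed_tuple x z) em; rewrite elem_sym_mixed_tuple_real.
exact.
Qed.

Lemma elem_sym_eq0 m (w : m.-tuple R[i]) (e : int) : (e < 0) || (m%:Z < e) -> elem_sym w e = 0.
Proof.
case: e => [e|e]//= me; apply: big_pred0 => J; apply/negbTE/eqP => Je.
by move: me; rewrite ltz_nat -Je ltnNge -[X in (_ <= X)%N]card_ord max_card.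
Qed.

(** The right-hand side is the argument of f_i in [rho]. Exponents e < 0 and e > m belong to
    coefficients of [root_poly] outside its range, and both vanish; in particular the sign for
    negative e is immaterial. *)
Lemma coef_root_poly_mul k l (x : k.-tuple R) (z : l.-tuple R[i]) n (t : n.-tuple R) (i : nat) :
  (root_poly x z * Poly t)`_i = \sum_(j < n)
    let e := (k + (l + l))%N%:Z - i%:Z + j%:Z in
    (-1) ^ e * complex.Re (elem_sym (mixed_tuple x z) e) * tnth t j.
Proof.
set m := (k + (l + l))%N.
have -> : Poly t = \sum_(j < n) (tnth t j)%:P * 'X^j.
  apply/polyP => c; rewrite coef_Poly coef_sum.
  under eq_bigr do rewrite coefCM coefXn.
  have [cn|cn] := ltnP c n; last first.
    rewrite nth_default ?size_tuple// big1// => j _.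
    by rewrite (_ : (_ == _)%N = false) ?mulr0//; apply/negbTE; rewrite gtn_eqF// (leq_trans _ cn).
  rewrite (bigD1 (Ordinal cn))//= eqxx mulr1 (tnth_nth 0) big1 ?addr0// => j jc.
  rewrite (_ : (_ == _)%N = false) ?mulr0//; apply/negbTE; apply: contraNneq jc => cj.
  by apply/eqP/val_inj.
rewrite mulr_sumr coef_sum; apply: eq_bigr => j _ /=.
rewrite mulrCA coefCM mulrC coefMXn; congr (_ * _).
case: ltnP => ij.
  by rewrite elem_sym_eq0 ?mulr0//; apply/orP; right; lia.
have [ijm|ijm] := leqP (i - j)%N m; last first.
  rewrite elem_sym_eq0 ?mulr0; last by apply/orP; left; lia.
  rewrite nth_default// size_root_poly !size_tuple.
  by move: ijm; rewrite /m; lia.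
have -> : m%:Z - i%:Z + j%:Z = (m - (i - j))%N%:Z by lia.
by rewrite -coef_root_poly ?leq_subr// subKn.
Qed.

(** The arguments of the f_i in [rho] are the coefficients of the product of [root_poly] with t, and
    its last product consists of the values of t at the chosen roots. Only the constant has to be
    moved under the integral. *)
Lemma rho_density n (f : 'I_n.+1 -> R -> R) k l (x : k.-tuple R) (z : l.-tuple R[i]) :
  (forall i, measurable_fun setT (f i)) -> (forall i y, 0 <= f i y) ->
  ((2 ^+ l)%:E * rho f (mixed_tuple x z))%E =
  density (n - (k + (l + l))).+1 (fun a : n.+1.-tuple RT => (\prod_(i < n.+1) f i (tnth a i))%:E) x z.
Proof.
move=> mf f0; rewrite /rho /density; set q := (n - _).+1.
pose g (t : q.-tuple RT) := (\prod_(w <- root_list x z) normc (ev (Poly t) (pair_of_complex w)) *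
  \prod_(i < n.+1) f i (tnth (mulp (root_poly x z) n.+1 t) i))%R.
have g0 t : 0 <= g t.
  by rewrite mulr_ge0// prodr_ge0// => w _; exact: normc_ge0.
have mg : measurable_fun setT g.
  apply: measurable_funM; apply: measurable_prod_seq => w.
    exact: (@measurable_normc_ev _ _ (q.-tuple RT) q id (fun=> w) (@measurable_id _ _ _) (measurable_cst _)).
  apply: (measurableT_comp (mf w)).
  rewrite (_ : (fun t => _) = fun t : q.-tuple RT => (root_poly x z * Poly t)`_w); last first.
    by apply/funext => t; rewrite tnth_mktuple.
  apply: measurable_coefM => i; first exact: measurable_cst.
  exact: (@measurable_coef _ _ (q.-tuple RT) q id).
rewrite -vandermondeE muleA -EFinM.
rewrite (eq_integral (fun t => (g t)%:E)); last first.
  move=> t _; rewrite /g mulrC; congr (_ * _)%:E.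
    rewrite (big_tuple _ _ (mixed_tuple x z)).
    by apply: eq_bigr => i _; rewrite ev_Poly.
  by apply: eq_bigr => i _; rewrite tnth_mktuple coef_root_poly_mul.
rewrite -ge0_integralZl_EFin//; first last.
- by rewrite mulr_ge0 ?vandermonde_ge0// exprn_ge0.
- exact/measurable_EFinP.
- by move=> t _; rewrite lee_fin.
apply: eq_integral => t _.
by rewrite /g size_tuple /weight -!EFinM; congr (_%:E); rewrite !mulrA.
Qed.

End matching.

(** * Zeros of the random polynomial *)

Section zero_counts.
Context d (T : measurableType d) (R : realType) (P : probability T R).
Variables (n : nat) (xi : 'I_n.+1 -> {RV P >-> R}).
Local Notation RT := (measurableTypeR R).

Lemma random_polyE omega :
  random_poly xi omega = map_poly (real_complex R) (Poly (random_tuple xi omega)).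
Proof.
apply/polyP => i; rewrite /random_poly coef_sum coef_map coef_Poly.
under eq_bigr do rewrite coefZ coefXn.
have [ni|ni] := ltnP i n.+1; last first.
  rewrite nth_default ?size_tuple// big1// => j _.
  by rewrite (_ : (_ == _)%N = false) ?mulr0//; apply/negbTE; rewrite gtn_eqF// (leq_trans _ ni).
rewrite (bigD1 (Ordinal ni))//= eqxx mulr1 big1 ?addr0 => [|j jc].
  by rewrite -(tnth_nth 0 (random_tuple xi omega) (Ordinal ni)) tnth_mktuple.
rewrite (_ : (_ == _)%N = false) ?mulr0//; apply/negbTE; apply: contraNneq jc => cj.
by apply/eqP/val_inj.
Qed.

(** For the zero polynomial the two sides follow different conventions: every point is a root of it,
    while [zroots] is empty. *)
Lemma zero_measure_complex omega B : Poly (random_tuple xi omega) != 0 ->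
  zero_measure (random_poly xi omega) B =
  root_count (Poly (random_tuple xi omega)) (complex_points B).
Proof.
move=> p0; rewrite /zero_measure /root_count random_polyE.
rewrite -(@counting_image _ _ _ (@complex_of_pair R)); last exact: (can_inj (@complex_of_pairK R)).
congr counting; apply/seteqP; split => [w [/= rw Bw]|_ [z [zz Bz] <-]].
  exists (pair_of_complex w); last by rewrite pair_of_complexK.
  split; last by rewrite /complex_points/= pair_of_complexK.
  by rewrite /zroots (negbTE p0) /zset/= /ev pair_of_complexK; apply/eqP.
by split => //=; move: zz; rewrite /zroots (negbTE p0) /zset /= => /eqP.
Qed.

Lemma complex_points_real (A : set R) : complex_points (real_complex R @` A) = real_points A.
Proof.
apply/seteqP; split => [[a b] /= [y Ay [<- <-]]//|[a b] [/= -> Aa]].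
by exists a.
Qed.

End zero_counts.

Theorem theorem2p1 (R : realType) (d : measure_display) (T : measurableType d)
    (P : probability T R) (n : nat) (xi : 'I_n.+1 -> {RV P >-> R})
    (f : 'I_n.+1 -> R -> R) (k l : nat)
    (n_ge1 : (1 <= n)%N)
    (xi_independent : mutually_independent xi)
    (xi_density : forall i, has_density (xi i) (f i))
    (kl : (1 <= k + 2 * l <= n)%N) :
  is_mixed_correlation P (random_poly xi)
    (fun (x : k.-tuple R) (z : l.-tuple R[i]) =>
       ((2 ^+ l)%:E * rho f (mixed_tuple x z))%E).
Proof.
have mf i : measurable_fun setT (f i) by have [] := xi_density i.
have f0 i y : 0 <= f i y by have [] := xi_density i.
pose RT := measurableTypeR R.
pose F (a : n.+1.-tuple RT) : \bar R := (\prod_(i < n.+1) f i (tnth a i))%:E.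
have F0 a : (0 <= F a)%E by rewrite lee_fin prodr_ge0.
have mF : measurable_fun setT F.
  apply/measurable_EFinP; apply: measurable_prod_seq => i.
  exact: (measurableT_comp (mf i) (measurable_tnth i)).
pose q := (n - (k + (l + l))).+1.
have NE : n.+1 = (k + (l.*2 + q))%N by rewrite /q; lia.
have rE (x : k.-tuple R) (z : l.-tuple R[i]) :
    ((2 ^+ l)%:E * rho f (mixed_tuple x z))%E = density q F x z by exact: rho_density.
have mr := @measurable_density R k l q n.+1 F F0 mF.
split => [[x z] _|/=|A B mA mB tA tB].
- by rewrite rE; exact: density_ge0.
- apply: measurable_funTS; apply: eq_measurable_fun mr => -[x z] _.
  by rewrite rE.
pose h (a : n.+1.-tuple RT) := (\prod_(i < k) root_count (Poly a) (real_points (A i)) *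
  \prod_(j < l) root_count (Poly a) (complex_points (B j)))%E.
have h0 a : (0 <= h a)%E.
  by apply: mule_ge0; apply: prode_ge0 => i _; exact: root_count_ge0.
have mh : measurable_fun setT h.
  apply: emeasurable_funM; apply: emeasurable_prod_seq => j.
    have mS := measurable_real_points (mA j).
    exact: (@measurable_root_count _ _ (n.+1.-tuple RT) n.+1 _ id mS (@measurable_id _ _ _)).
  have mS := measurable_complex_points (mB j).1.
  exact: (@measurable_root_count _ _ (n.+1.-tuple RT) n.+1 _ id mS (@measurable_id _ _ _)).
have mX := measurable_random_tuple xi.
transitivity (\int[P]_omega h (random_tuple xi omega))%E.
  (* G = 0 forces the coefficient xi_0 to be 0, an event of probability zero because xi_0 has a
     density. *)
  have mN : measurable (xi ord0 @^-1` [set 0]).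
    have mxi := @measurable_funPT _ _ _ _ (xi ord0).
    by rewrite -[X in measurable X]setTI; exact: (mxi measurableT _ (measurable_set1 0)).
  have PN : P (xi ord0 @^-1` [set 0]) = 0%E.
    have [_ _ h1] := xi_density ord0.
    by apply: (etrans (h1 _ (measurable_set1 0))); rewrite integral_set1.
  pose L omega := (\prod_(i < k) zero_measure (random_poly xi omega) (real_complex R @` A i) *
    \prod_(j < l) zero_measure (random_poly xi omega) (B j))%E.
  pose s omega : R := \sum_(i < n.+1) `|tnth (random_tuple xi omega) i|.
  have s0 omega : (s omega == 0) = (Poly (random_tuple xi omega) == 0).
    exact: tuple_norm_eq0.
  have LE omega : Poly (random_tuple xi omega) != 0 -> L omega = h (random_tuple xi omega).
    move=> p0; congr (_ * _)%E; apply: eq_bigr => i _; rewrite zero_measure_complex//.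
    by rewrite complex_points_real.
  pose L0 := (\prod_(i < k) zero_measure (0 : {poly R[i]}) (real_complex R @` A i) *
    \prod_(j < l) zero_measure (0 : {poly R[i]}) (B j))%E.
  (* The expectation is taken over an integrand that must be measurable on the exceptional event G =
     0 as well; there it is the constant L0. *)
  have LE' : L = fun omega => if s omega == 0 then L0 else h (random_tuple xi omega).
    apply/funext => omega; rewrite s0; case: ifPn => [/eqP p0|]; last exact: LE.
    by rewrite /L random_polyE p0 map_poly0.
  apply: ge0_ae_eq_integral => //.
  - rewrite -/L LE'; apply: measurable_fun_ifT => //; last exact: (measurableT_comp mh mX).
    apply: measurable_fun_eqr => //; apply: measurable_sum => i.
    by apply: measurableT_comp => //; exact: (measurableT_comp (measurable_tnth i) mX).
  - exact: (measurableT_comp mh mX).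
  - by move=> omega _; apply: mule_ge0; apply: prode_ge0 => i _; exact: measure_ge0.
  exists (xi ord0 @^-1` [set 0]); split => // omega /= nL; apply: contrapT => x0.
  apply: nL => _; apply: LE; apply/eqP => /(congr1 (fun p : {poly R} => p`_0)).
  rewrite coef0 coef_Poly -(tnth_nth 0 (random_tuple xi omega) ord0) tnth_mktuple.
  exact: x0.
rewrite (expectation_random_tuple xi_independent xi_density h0 mh).
rewrite (@mixed_correlation R k l q n.+1 F A B NE F0 mF mA tA (fun j => (mB j).1) (fun j => (mB j).2) tB).
rewrite [RHS]integral_mkcond [LHS]integral_mkcond.
pose Box := [set p : k.-tuple RT * l.-tuple R[i] |
  (forall i, A i (tnth p.1 i)) /\ (forall j, B j (tnth p.2 j))].
pose r := (fun p : k.-tuple RT * l.-tuple R[i] => density q F p.1 p.2) \_ Box.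
have r0 p : (0 <= r p)%E by rewrite /r patchE; case: ifPn => // _; exact: density_ge0.
have mbA : measurable [set x : k.-tuple RT | forall i, A i (tnth x i)] by exact: measurable_box.
have mbB : measurable [set z : l.-tuple R[i] | forall j, B j (tnth z j)].
  by apply: measurable_box => j; exact: (mB j).1.
have mBox : measurable Box.
  rewrite (_ : Box = [set x : k.-tuple RT | forall i, A i (tnth x i)] `*`
    [set z : l.-tuple R[i] | forall j, B j (tnth z j)]); first exact: measurableX.
  by apply/seteqP; split.
have mr' : measurable_fun setT r by exact: measurable_patch.
(* The iterated integral over the A_i and the B_j is turned into one integral against the product
   measure by extending the density by 0 outside the box. *)
transitivity (\int[power_measure (@lebesgue_measure R) k \x power_measure (@lebesgue_complex R) l]_p r p)%E.
  rewrite (fubini_tonelli1 r mr' r0); apply: eq_integral => x _.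
  rewrite patchE /fubini_F /r; case: ifPn => [/[!inE] /= Ax|/negP Ax].
    rewrite integral_mkcond; apply: eq_integral => z _; rewrite !patchE.
    by congr (if _ then _ else _); apply/idP/idP => /[!inE] => [|[]].
  apply/esym/integral0_eq => z _; rewrite patchE; case: ifPn => // /[!inE] -[Ax' _].
  by exfalso; apply: Ax; rewrite inE.
apply: eq_integral => p _; rewrite /r !patchE; case: ifPn => // _.
Qed.
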